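(* Let $H,U$ be Hilbert spaces and let $(A,B)$ satisfy: (1) $A:D(A)\subset H\to H$ generates a $C_0$-group $S(\cdot)$ on $H$; (2) $B\in\mathcal{L}(U;D(A^* )')$; (3) for every $T>0$ there is $C(T)>0$ with $\int_0^T\|B^*S^*(t)\varphi\|_{U'}^2dt\le C(T)\|\varphi\|_{H'}^2$ for all $\varphi\in D(A^* )$; (4) there are constants $\alpha>0$, $C_1(\alpha)\ge 0$, $C_2(\alpha)\ge 1$ (fixed from now on) such that $$\|S^*(t)\varphi\|^2_{H'}\le C_1(\alpha)\int_0^t\|B^*S^*(s)\varphi\|_{U'}^2ds+C_2(\alpha)e^{-\alpha t}\|\varphi\|^2_{H'}\quad\text{for all } t>0,\ \varphi\in D(A^* ).$$ Then for each $T\in(\alpha^{-1}\ln[C_2(\alpha)],+\infty)$ with $T>0$, setting $\widehat{\varepsilon}:=T^{-1}\ln[C_2(\alpha)]$, the operator $$K_T:=-TC_1(\alpha)e^{\alpha T}J_1B^*\Pi_{\alpha,\widehat{\varepsilon},T}^{-1}:\ \Pi_{\alpha,\widehat{\varepsilon},T}[D(A^* )]\to U$$ is a feedback law stabilizing the system $x'(t)=Ax(t)+Bu(t)$, $t>0$, with the decay rate $\frac12\left(\alpha-T^{-1}\ln[C_2(\alpha)]\right)$.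
   Context: Notation. For a Hilbert space $X$, $X'$ is its dual, $\langle\cdot,\cdot\rangle_{X,X'}$ the (bilinear) dual pairing, and $X''$ is identified with $X$; $H$ and $U$ are not identified with their duals. For a densely defined closed operator $L$ on $X$, $D(L)$ carries the graph norm $(\|x\|_X^2+\|Lx\|_X^2)^{1/2}$, and the adjoint $L^*$ on $X'$ is defined by $\langle Lx,y\rangle_{X,X'}=\langle x,L^*y\rangle_{X,X'}$. $S^*(t):=S(t)^*$ is the adjoint group on $H'$, generated by $A^*$. $D(A^* )''$ is identified with $D(A^* )$, so $B^*\in\mathcal{L}(D(A^* );U')$. $\mathbb{R}^+=[0,\infty)$. $J_1:U'\to U$ and $J_2:H'\to H$ are the canonical conjugate-linear Riesz isomorphisms; in particular $\langle J_1 f,f\rangle_{U,U'}=\|f\|_{U'}^2$ and $\langle J_2\varphi,\varphi\rangle_{H,H'}=\|\varphi\|_{H'}^2$. $\widetilde{A}\in\mathcal{L}(H;D(A^* )')$ is the unique extension of $A$ given by $\langle \widetilde{A}\varphi,\psi\rangle_{D(A^* )',D(A^* )}=\langle\varphi,A^*\psi\rangle_{H,H'}$ for $\varphi\in H$, $\psi\in D(A^* )$; $H$ is embedded in $D(A^* )'$ through $\langle\cdot,\cdot\rangle_{H,H'}$. Under (1)-(3), for every $T>0$ the map $\varphi\mapsto B^*S^*(\cdot)\varphi$ is bounded from $(D(A^* ),\|\cdot\|_{H'})$ to $L^2(-T,T;U')$, so it extends uniquely to a continuous operator $\varphi\mapsto \widetilde{B^*S^*}(\cdot)\varphi$ from $H'$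 to $L^2_{loc}(\mathbb{R};U')$. Operators. For $\varepsilon\in[0,\alpha)$, $T>0$, $t\in[0,T]$, define $\Lambda_{\alpha,\varepsilon,T}(t):H'\to H$ and $\Pi_{\alpha,\varepsilon,T}:H'\to H$ by $$\langle \Lambda_{\alpha,\varepsilon,T}(t)\varphi,\psi\rangle_{H,H'}=C_1(\alpha)e^{\alpha T}\int_0^t e^{-(\alpha-\varepsilon)s}\langle J_1\widetilde{B^*S^*}(-s)\varphi,\widetilde{B^*S^*}(-s)\psi\rangle_{U,U'}ds+C_2(\alpha)e^{-(\alpha-\varepsilon)t}\langle J_2S^*(-t)\varphi,S^*(-t)\psi\rangle_{H,H'},$$ $$\langle \Pi_{\alpha,\varepsilon,T}\varphi,\psi\rangle_{H,H'}=\int_0^T\langle\Lambda_{\alpha,\varepsilon,T}(t)\varphi,\psi\rangle_{H,H'}dt,\qquad \varphi,\psi\in H'.$$ These are conjugate-linear and bounded, and $\Pi_{\alpha,\varepsilon,T}$ is invertible under (1)-(4). Feedback law. An operator $K$ is a feedback law stabilizing $x'=Ax+Bu$ with decay rate $\omega>0$ if there is a $C_0$-semigroup $\mathcal{S}(\cdot)$ on $H$ with generator $\mathcal{A}:D(\mathcal{A})\subset H\to H$ such that $K\in\mathcal{L}(D(\mathcal{A});U)$ (in particular $K$ has domain $D(\mathcal{A})$, with the graph norm) and: (i) there is $C\ge1$ with $\|\mathcal{S}(t)\|_{\mathcal{L}(H)}\le Ce^{-\omega t}$ for all $t\in\mathbb{R}^+$; (ii) $\mathcal{A}x=(\widetilde{A}+BK)x$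 for all $x\in D(\mathcal{A})$; (iii) there is $C'\ge0$ with $\|K\mathcal{S}(\cdot)x\|_{L^2(\mathbb{R}^+;U)}\le C'\|x\|_H$ for all $x\in D(\mathcal{A})$. *)

(* Defs.v *)
From HB Require Import structures.
From mathcomp Require Import all_boot all_order all_algebra.
From mathcomp Require Import complex.
From mathcomp Require Import all_classical all_reals all_analysis.

Set Implicit Arguments.
Unset Strict Implicit.
Unset Printing Implicit Defensive.

Import Order.TTheory GRing.Theory Num.Theory.
Import numFieldNormedType.Exports.

Local Open Scope classical_set_scope.
Local Open Scope ring_scope.

(* Hilbert spaces are real or complex: everything below is parametrised by
   the scalar field, which is R or R[i]. *)
Variant scalar_kind := RealScalars | ComplexScalars.

Definition scalarField (R : realType) (s : scalar_kind) : numFieldType :=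
  match s with
  | RealScalars => (R : numFieldType)
  | ComplexScalars => (R[i] : numFieldType)
  end.

Section Scalars.
Context {R : realType}.

Definition sreal {s : scalar_kind} : R -> scalarField R s :=
  match s return R -> scalarField R s with
  | RealScalars => fun x => x
  | ComplexScalars => fun x => Complex x 0
  end.

Definition sRe {s : scalar_kind} : scalarField R s -> R :=
  match s return scalarField R s -> R with
  | RealScalars => fun z => z
  | ComplexScalars => fun z => complex.Re z
  end.

Definition sconj {s : scalar_kind} : scalarField R s -> scalarField R s :=
  match s return scalarField R s -> scalarField R s with
  | RealScalars => fun z => z
  | ComplexScalars => fun z => conjc z
  end.

(* Lebesgue integral over D of a scalar-valued function of a real variable. *)
Definition sintegral {s : scalar_kind} :
    set R -> (R -> scalarField R s) -> scalarField R s :=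
  match s return set R -> (R -> scalarField R s) -> scalarField R s with
  | RealScalars => fun D f => \int[lebesgue_measure]_(t in D) f t
  | ComplexScalars => fun D f =>
      Complex (\int[lebesgue_measure]_(t in D) complex.Re (f t))
              (\int[lebesgue_measure]_(t in D) complex.Im (f t))
  end.

Variable s : scalar_kind.
Implicit Types (x y : R) (z w : scalarField R s).

Lemma sreal1 : @sreal s 1 = 1.
Proof. by case: s. Qed.

Lemma srealD : {morph @sreal s : x y / x + y}.
Proof.
by case: s => //= x y; rewrite -[RHS]/(Complex (x + y) (0 + 0)) addr0.
Qed.

Lemma srealM : {morph @sreal s : x y / x * y}.
Proof.
case: s => //= x y.
by rewrite -[RHS]/(Complex (x * y - 0 * 0) (x * 0 + 0 * y)) !mulr0 mul0r subr0 addr0.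
Qed.

Lemma ler_sreal : {mono @sreal s : x y / x <= y}.
Proof. by case: s => //= x y; rewrite lecR. Qed.

Lemma sreal0 : @sreal s 0 = 0.
Proof. by case: s. Qed.

Lemma sRe_norm z : sreal (sRe `|z|) = `|z|.
Proof. by case: s z => //= -[a b]. Qed.

Lemma srealK x : sRe (@sreal s x) = x.
Proof. by case: s. Qed.

Lemma sRe_ge0 z : 0 <= z -> sreal (sRe z) = z.
Proof.
case: s z => //= -[a b].
by rewrite lecE /= => /andP[/eqP -> _].
Qed.

End Scalars.

(* The library's norms take values in the scalar field; nrm is real. *)
Definition nrm (R : realType) (s : scalar_kind)
    (V : normedModType (scalarField R s)) (x : V) : R := sRe `|x|.

Section RealNorm.
Context (R : realType) (s : scalar_kind) (V : normedModType (scalarField R s)).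
Implicit Types x y : V.

Lemma nrmE x : sreal (nrm x) = `|x|.
Proof. exact/sRe_ge0/normr_ge0. Qed.

Lemma nrm_ge0 x : 0 <= nrm x.
Proof. by rewrite -(ler_sreal s) nrmE sreal0. Qed.

Lemma nrm0 : nrm (0 : V) = 0.
Proof. by rewrite /nrm normr0 -(@sreal0 R s) srealK. Qed.

Lemma ler_nrmD x y : nrm (x + y) <= nrm x + nrm y.
Proof. by rewrite -(ler_sreal s) srealD !nrmE ler_normD. Qed.

Lemma nrmZ (a : scalarField R s) x : nrm (a *: x) = sRe `|a| * nrm x.
Proof.
by rewrite -[RHS](srealK s) srealM nrmE sRe_norm -normrZ.
Qed.

Lemma nrm0_eq0 x : nrm x = 0 -> x = 0.
Proof. by move=> x0; apply/eqP; rewrite -normr_eq0 -nrmE x0 sreal0. Qed.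

End RealNorm.

HB.mixin Record isHilbert (R : realType) (s : scalar_kind) H
    & CompleteNormedModule (scalarField R s) H := {
  inner : H -> H -> scalarField R s;
  inner_linearl : forall (a : scalarField R s) (x y z : H),
    inner (a *: x + y) z = a * inner x z + inner y z;
  inner_sym : forall x y : H, inner y x = sconj (inner x y);
  inner_norm : forall x : H, inner x x = `|x| ^+ 2
}.

#[short(type="hilbertType")]
HB.structure Definition Hilbert (R : realType) (s : scalar_kind) :=
  {H of isHilbert R s H & CompleteNormedModule (scalarField R s) H}.

Section BoundedOperators.
Context (R : realType) (s : scalar_kind) (V W : normedModType (scalarField R s)).

Definition bounded_op : set (V -> W) :=
  [set f | linear f /\ exists c : R, forall x, nrm (f x) <= c * nrm x].

Definition bounded_op_pred : {pred V -> W} := mem bounded_op.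

Record bop := Bop { bop_fun :> V -> W; _ : bop_fun \in bounded_op_pred }.

HB.instance Definition _ := [isSub for bop_fun].
HB.instance Definition _ := [Choice of bop by <:].

Lemma bop_submod_closed : GRing.submod_closed bounded_op_pred.
Proof.
split.
  apply/mem_set; split; first by move=> a x y; rewrite scaler0 addr0.
  by exists 0 => x; rewrite nrm0 mul0r.
move=> a f g /set_mem[fl [c fc]] /set_mem[gl [d gd]]; apply/mem_set; split.
  move=> b x y /=.
  have E u : (a *: f + g) u = a *: f u + g u by [].
  by rewrite !E fl gl !scalerDr !scalerA addrACA (mulrC a b).
exists (sRe `|a| * c + d) => x; rewrite mulrDl.
apply: le_trans (ler_nrmD _ _) _; apply: lerD; last exact: gd.
rewrite nrmZ -mulrA; apply: ler_wpM2l; last exact: fc.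
exact: (@nrm_ge0 R s (scalarField R s)^o a).
Qed.

HB.instance Definition _ :=
  GRing.isSubmodClosed.Build _ _ bounded_op_pred bop_submod_closed.
HB.instance Definition _ := [SubChoice_isSubLmodule of bop by <:].

Implicit Types (f g : bop) (x y : V).

Lemma bop_linear f : linear f.
Proof. by have /set_mem[] := valP f. Qed.

HB.instance Definition _ f :=
  GRing.isLinear.Build _ _ _ _ (bop_fun f) (bop_linear f).

Lemma bop_bounded f : exists c : R, forall x, nrm (f x) <= c * nrm x.
Proof. by have /set_mem[] := valP f. Qed.

Lemma bopP f g : f =1 g -> f = g.
Proof. by move=> fg; apply/val_inj/funext. Qed.

Lemma bopD f g x : (f + g) x = f x + g x.
Proof. by []. Qed.

Lemma bopZ (a : scalarField R s) f x : (a *: f) x = a *: f x.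
Proof. by []. Qed.

Definition opnorm f : R := sup [set nrm (f x) | x in [set x | nrm x <= 1]].

Lemma opnorm_has_sup f : has_sup [set nrm (f x) | x in [set x | nrm x <= 1]].
Proof.
split; first by exists (nrm (f 0)), 0 => //=; rewrite nrm0 ler01.
have [c fc] := bop_bounded f; exists `|c| => _ [x /= x1 <-].
rewrite (le_trans (fc x))// (le_trans (ler_norm _))// normrM.
by rewrite (ger0_norm (nrm_ge0 x)) ler_piMr.
Qed.

Lemma opnorm_ge0 f : 0 <= opnorm f.
Proof.
apply: ub_le_sup; first by case: (opnorm_has_sup f).
by exists 0 => /=; rewrite ?nrm0 ?ler01// linear0 nrm0.
Qed.

Lemma le_opnorm f x : nrm (f x) <= opnorm f * nrm x.
Proof.
have [x0|x0] := eqVneq (nrm x) 0.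
  by rewrite x0 (nrm0_eq0 x0) linear0 nrm0 mulr0.
have xgt0 : 0 < nrm x by rewrite lt_neqAle eq_sym x0 nrm_ge0.
have nv : sRe `|sreal (nrm x)^-1 : scalarField R s| = (nrm x)^-1.
  rewrite ger0_norm ?srealK// -(@sreal0 R s) ler_sreal.
  by rewrite invr_ge0 nrm_ge0.
rewrite -ler_pdivrMr// mulrC -nv -nrmZ -linearZ.
apply: ub_le_sup; first by case: (opnorm_has_sup f).
by exists (sreal (nrm x)^-1 *: x) => //=; rewrite nrmZ nv mulVf.
Qed.

Lemma opnorm_le f c : 0 <= c -> (forall x, nrm (f x) <= c * nrm x) ->
  opnorm f <= c.
Proof.
move=> c0 fc; apply: ge_sup; first by case: (opnorm_has_sup f).
by move=> _ [x /= x1 <-]; rewrite (le_trans (fc x))// ler_piMr.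
Qed.

Let bop_norm f : scalarField R s := sreal (opnorm f).

Let bop_ler_normD f g : bop_norm (f + g) <= bop_norm f + bop_norm g.
Proof.
rewrite -srealD ler_sreal; apply: opnorm_le => [|x].
  by rewrite addr_ge0 ?opnorm_ge0.
by rewrite bopD mulrDl (le_trans (ler_nrmD _ _))// lerD ?le_opnorm.
Qed.

Let bop_normrZ (a : scalarField R s) f : bop_norm (a *: f) = `|a| * bop_norm f.
Proof.
have a0 : 0 <= sRe `|a| by exact: (@nrm_ge0 R s (scalarField R s)^o a).
rewrite -[`|a|]sRe_norm -srealM; congr sreal.
apply/eqP; rewrite eq_le; apply/andP; split.
  apply: opnorm_le => [|x]; first by rewrite mulr_ge0 ?opnorm_ge0.
  by rewrite bopZ nrmZ -mulrA ler_wpM2l ?le_opnorm.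
have [->|az] := eqVneq a 0.
  by rewrite normr0 -(@sreal0 R s) srealK mul0r opnorm_ge0.
have agt0 : 0 < sRe `|a|.
  rewrite lt_neqAle a0 andbT; apply: contra az => /eqP ra.
  by rewrite -normr_eq0 -sRe_norm -ra sreal0.
rewrite mulrC -ler_pdivlMr//; apply: opnorm_le => [|x].
  by rewrite divr_ge0 ?opnorm_ge0.
rewrite mulrAC ler_pdivlMr// mulrC -nrmZ -bopZ; exact: le_opnorm.
Qed.

Let bop_normr0_eq0 f : bop_norm f = 0 -> f = 0.
Proof.
move=> /(congr1 sRe); rewrite srealK -(@sreal0 R s) srealK => f0.
apply: bopP => x; apply: nrm0_eq0; apply/eqP.
by rewrite eq_le nrm_ge0 andbT -(mul0r (nrm x)) -f0 le_opnorm.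
Qed.

HB.instance Definition _ := Lmodule_isNormed.Build (scalarField R s) bop
  bop_ler_normD bop_normrZ bop_normr0_eq0.

Lemma nrm_bopE f : nrm f = opnorm f.
Proof. exact: srealK. Qed.

End BoundedOperators.

Section Composition.
Context (R : realType) (s : scalar_kind) (X Y Z : normedModType (scalarField R s)).

Lemma bop_comp_subproof (g : bop Y Z) (f : bop X Y) :
  g \o f \in @bounded_op_pred R s X Z.
Proof.
apply/mem_set; split; first by move=> a x y /=; rewrite !linearP.
exists (opnorm g * opnorm f) => x /=.
rewrite (le_trans (le_opnorm g _))// -mulrA.
by rewrite ler_wpM2l ?le_opnorm// opnorm_ge0.
Qed.

Definition bop_comp g f : bop X Z := Bop (bop_comp_subproof g f).

End Composition.

(* X', with the operator norm; the pairing <x, f>_{X,X'} is f x. *)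
Definition dual (R : realType) (s : scalar_kind)
  (X : normedModType (scalarField R s)) := bop X (scalarField R s)^o.

Definition transpose (R : realType) (s : scalar_kind)
    (X Y : normedModType (scalarField R s)) (T : bop X Y) (f : dual Y) : dual X :=
  bop_comp f T.

(* J f is the vector with <v, f> = inner v (J f) for every v. *)
Definition riesz (R : realType) (s : scalar_kind) (H : hilbertType R s)
    (f : dual H) : H :=
  xget 0 [set x : H | forall v, f v = inner v x].

(* A partially defined operator; the values of op outside dom carry no
   meaning. *)
Record unbounded (X Y : Type) :=
  Unbounded { dom : set X; op :> X -> Y }.

Section UnboundedOperators.
Context (R : realType) (s : scalar_kind).

Definition adjoint (X : normedModType (scalarField R s)) (L : unbounded X X) :
    unbounded (dual X) (dual X) :=
  let is_adj (f g : dual X) := forall x, dom L x -> f (L x) = g x in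
  {| dom := [set f | exists g, is_adj f g];
     op := fun f => xget 0 [set g | is_adj f g] |}.

Definition graph_norm (X Y : normedModType (scalarField R s)) (L : unbounded X Y)
    (x : X) : R :=
  Num.sqrt (nrm x ^+ 2 + nrm (L x) ^+ 2).

(* F is a bounded linear operator from dom L, with the graph norm, to Z. *)
Definition graph_bounded (X Y Z : normedModType (scalarField R s))
    (L : unbounded X Y) (F : X -> Z) : Prop :=
  (forall (a : scalarField R s) (x y : X), dom L x -> dom L y ->
     F (a *: x + y) = a *: F x + F y) /\
  (exists c : R, forall x, dom L x -> nrm (F x) <= c * graph_norm L x).

(* B in L(U; D(L)'), where a member of D(L)' is given by a function on X of
   which only the restriction to dom L is used. *)
Definition bounded_to_dual (U X Y : normedModType (scalarField R s))
    (L : unbounded X Y) (B : U -> X -> (scalarField R s)^o) : Prop :=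
  [/\ forall u, graph_bounded L (B u),
      forall (a : scalarField R s) (u v : U) (x : X), dom L x ->
        B (a *: u + v) x = a *: B u x + B v x
    & exists c : R, forall (u : U) (x : X), dom L x ->
        nrm (B u x) <= c * nrm u * graph_norm L x].

End UnboundedOperators.

Section Semigroups.
Context (R : realType) (s : scalar_kind) (X : normedModType (scalarField R s)).
Implicit Types (S : R -> bop X X).

Definition C0_group S : Prop :=
  [/\ forall x, S 0 x = x,
      forall t r x, S (t + r) x = S t (S r x)
    & forall x, S t x @[t --> (0 : R)] --> x].

(* Only the values S t with t >= 0 are used. *)
Definition C0_semigroup S : Prop :=
  [/\ forall x, S 0 x = x,
      forall t r x, 0 <= t -> 0 <= r -> S (t + r) x = S t (S r x)
    & forall x, S t x @[t --> 0^'+] --> x].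

(* A is the generator of S, where h tends to 0 along F: the filter 0^' for a
   group and 0^'+ for a semigroup. *)
Definition generates (F : set_system R) S (A : unbounded X X) : Prop :=
  let quotient x (h : R) : X := sreal h^-1 *: (S h x - x) in
  (forall x, dom A x <-> cvg (quotient x @ F)) /\
  (forall x, dom A x -> quotient x @ F --> A x).

End Semigroups.

Section SquareIntegrable.
Context (R : realType) (s : scalar_kind) (V : normedModType (scalarField R s)).
Implicit Types (D : set R) (f : R -> V).

Definition simple_fun f : Prop :=
  finite_set (range f) /\ forall v, measurable (f @^-1` [set v]).

Definition strongly_measurable D f : Prop :=
  exists g : nat -> R -> V, (forall n, simple_fun (g n)) /\
    forall t, D t -> g n t @[n --> \oo] --> f t.

Definition l2sq D f : \bar R :=
  (\int[lebesgue_measure]_(t in D) (nrm (f t) ^+ 2)%:E)%E.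

(* Classes modulo equality almost everywhere are represented by functions. *)
Definition L2 D f : Prop := strongly_measurable D f /\ (l2sq D f < +oo)%E.

Definition L2loc f : Prop := forall T : R, 0 < T -> L2 `[- T, T] f.

End SquareIntegrable.

Section ControlSystem.
Context (R : realType) (s : scalar_kind) (H U : hilbertType R s).
Variables (A : unbounded H H) (S : R -> bop H H).
Variable B : U -> dual H -> (scalarField R s)^o.

Definition adjoint_group (t : R) : dual H -> dual H := transpose (S t).

(* The extension of A to an operator from H to the dual of dom (adjoint A). *)
Definition Atilde (x : H) : dual H -> (scalarField R s)^o :=
  fun f => adjoint A f x.

Definition Bstar (f : dual H) : dual U :=
  xget 0 [set g : dual U | forall u, g u = B u f].

(* Meaningful for f in dom (adjoint A). *)
Definition observation (f : dual H) : R -> dual U :=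
  fun t => Bstar (adjoint_group t f).

Definition is_observation_extension (E : dual H -> R -> dual U) : Prop :=
  [/\ forall f, L2loc (E f),
      forall (a : scalarField R s) (f g : dual H),
        {ae @lebesgue_measure R, forall t, E (a *: f + g) t = a *: E f t + E g t},
      forall T : R, 0 < T -> exists c : R, forall f,
        (l2sq `[(- T)%R, T] (E f) <= (c * nrm f ^+ 2)%:E)%E
    & forall f, dom (adjoint A) f ->
        {ae @lebesgue_measure R, forall t, E f t = observation f t}].

(* The continuous extension of observation to all of H', with values in
   L^2_loc(R; U'); it is unique up to equality almost everywhere. *)
Definition observation_ext : dual H -> R -> dual U :=
  xget (fun _ _ => 0) is_observation_extension.

Variables (alpha C1 C2 eps T : R).

Definition Lambda_form (t : R) (f g : dual H) : scalarField R s :=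
  sreal (C1 * expR (alpha * T)) *
    sintegral `[0, t] (fun r => sreal (expR (- ((alpha - eps) * r))) *
      observation_ext g (- r) (riesz (observation_ext f (- r)))) +
  sreal (C2 * expR (- ((alpha - eps) * t))) *
    adjoint_group (- t) g (riesz (adjoint_group (- t) f)).

Definition Lambda (t : R) (f : dual H) : H :=
  xget 0 [set x : H | forall g : dual H, g x = Lambda_form t f g].

Definition Pi (f : dual H) : H :=
  xget 0 [set x : H | forall g : dual H,
    g x = sintegral `[0, T] (fun t => g (Lambda t f))].

Definition Pi_inv (x : H) : dual H := xget 0 [set f | Pi f = x].

End ControlSystem.

Definition feedback (R : realType) (s : scalar_kind) (H U : hilbertType R s)
    (A : unbounded H H) (S : R -> bop H H) (B : U -> dual H -> (scalarField R s)^o)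
    (alpha C1 C2 T : R) : unbounded H U :=
  let eps := T^-1 * ln C2 in
  {| dom := Pi A S B alpha C1 C2 eps T @` dom (adjoint A);
     op := fun x => - (sreal (T * C1 * expR (alpha * T)) *:
       riesz (Bstar B (Pi_inv A S B alpha C1 C2 eps T x))) |}.

Definition stabilizing_feedback (R : realType) (s : scalar_kind)
    (H U : hilbertType R s) (A : unbounded H H)
    (B : U -> dual H -> (scalarField R s)^o) (K : unbounded H U) (omega : R) : Prop :=
  0 < omega /\
  exists (Sc : R -> bop H H) (Ac : unbounded H H),
    [/\ C0_semigroup Sc,
        generates 0^'+ Sc Ac,
        dom K = dom Ac /\ graph_bounded Ac K
      & [/\ exists C : R, 1 <= C /\
              forall t : R, 0 <= t -> nrm (Sc t) <= C * expR (- (omega * t)),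
            (* equality in the dual of dom (adjoint A) *)
            forall x, dom Ac x -> forall f, dom (adjoint A) f ->
              f (Ac x) = Atilde A x f + B (K x) f
          & exists C : R, 0 <= C /\ forall x, dom Ac x ->
              strongly_measurable `[0, +oo[ (fun t => K (Sc t x)) /\
              (l2sq `[0%R, +oo[ (fun t => K (Sc t x)) <=
                ((C * nrm x) ^+ 2)%:E)%E]].

(* Main.v *)
Require Import Defs.
From HB Require Import structures.
From mathcomp Require Import all_boot all_order all_algebra.
From mathcomp Require Import complex ring lra.
From mathcomp Require Import all_classical all_reals all_analysis.
From mathcomp Require Import measurable_realfun.

Set Implicit Arguments.
Unset Strict Implicit.
Unset Printing Implicit Defensive.

Import Order.TTheory GRing.Theory Num.Theory.
Import numFieldNormedType.Exports.

Local Open Scope classical_set_scope.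
Local Open Scope ring_scope.

(** Everything is transported from [H'] to [H] by the Riesz map: [y] stands for
    the functional [rd y = <., y>], [Sd] is the adjoint group, [Ad] its
    generator, with domain [Dd], and [obsop] is [B^*]. As [rd] is conjugate
    linear over complex scalars, calculus is done with the real inner product
    [rin] only, and scalar identities are recovered from the real parts of
    multiples ([sRe_inj]).

    Write [beta = alpha - eps], [c = C1 e^(alpha T)], [k = c T], and let [P] and
    [L] be the operators on [H] that represent [Pi] and [Lambda(T)]
    ([gramian_ex]). Along an orbit, the integrands of
    [<P S^*(rho) y, S^*(rho) z>] depend on [rho] only through a shift of the
    integration variable, so differentiating at [rho = 0] gives, as forms on
    the domain of [A^*], the Riccati identity ([riccati_identity])
    [[
      A P + P A^* = k B B^* + C2 - L - beta P.
    ]]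
    The choice of [eps] is [e^(eps T) = C2]. It turns the observability
    hypothesis at time [T] into [L >= C2] ([gramian_observability]), because
    the weights [e^(- beta r)] in [L] are at least [e^(- beta T)] and
    [c e^(- beta T) = C1 C2].

    The closed loop operator is [A - k B B^* P^-1] on [P Dd]. By the identity it
    equals [P (- A^* + M) P^-1] with the bounded operator
    [M = P^-1 (C2 - L) - beta]: up to conjugation, the closed loop is a bounded
    perturbation of the generator of the group [S^*(-t)], and no unbounded
    perturbation has to be handled ([bounded_perturbation], [closed_loop]).
    For the conjugate group [G], the function [V = <P y, y>] satisfies
    [[
      V' <= - beta V - k |B^* y|^2
    ]]
    along orbits, by the identity and [L >= C2]. As [P] is bounded and coercive,
    Gronwall's argument gives the decay rate [beta / 2], and integrating the
    last term gives the square integrability of the feedback.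

    Coercivity of [P] comes from the term [C2 |S^*(-t) y|^2] of [Lambda(t)],
    and [P] is inverted by the Lax-Milgram theorem ([coercive_inv]). The form
    defining [Lambda] contains an extension of the observation to all of [H']
    that is chosen among the maps with the required properties; such a map is
    constructed as an almost everywhere limit along fast approximations by
    vectors of the domain ([observation_extP]). *)

(** * Scalars through their real parts *)

Section ScalarFacts.
Context {R : realType} {s : scalar_kind}.
Implicit Types (z w : scalarField R s) (r : R).

Lemma srealN r : @sreal R s (- r) = - sreal r.
Proof.
by apply/eqP; rewrite -subr_eq0 opprK -srealD addNr sreal0.
Qed.

Lemma sreal_is_zmod_morphism : zmod_morphism (@sreal R s).
Proof. by move=> x y; rewrite srealD srealN. Qed.

Lemma sreal_is_monoid_morphism : monoid_morphism (@sreal R s).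
Proof. by split; [exact: sreal1|exact: srealM]. Qed.

HB.instance Definition _ :=
  GRing.isZmodMorphism.Build R (scalarField R s) (@sreal R s)
    sreal_is_zmod_morphism.
HB.instance Definition _ :=
  GRing.isMonoidMorphism.Build R (scalarField R s) (@sreal R s)
    sreal_is_monoid_morphism.

Lemma sRe_is_zmod_morphism : zmod_morphism (@sRe R s).
Proof. by case: s => //= -[a b] [c d]. Qed.

HB.instance Definition _ :=
  GRing.isZmodMorphism.Build (scalarField R s) R (@sRe R s)
    sRe_is_zmod_morphism.

Lemma sRe_srealM r z : sRe (sreal r * z) = r * sRe z.
Proof. by case: s z => //= -[a b] /=; rewrite mul0r subr0. Qed.

Lemma sconj_sreal r : sconj (sreal r : scalarField R s) = sreal r.
Proof. by case: s => //=; rewrite oppr0. Qed.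

Lemma sRe_sconj z : sRe (sconj z) = sRe z.
Proof. by case: s z => //= -[]. Qed.

Lemma sconjK : involutive (@sconj R s).
Proof. by case: s => //= -[a b] /=; rewrite opprK. Qed.

Lemma sconjM z w : sconj (z * w) = sconj z * sconj w.
Proof. by case: s z w => //= z w; rewrite rmorphM. Qed.

Lemma sconjD z w : sconj (z + w) = sconj z + sconj w.
Proof. by case: s z w => //= z w; rewrite rmorphD. Qed.

Lemma sconj_mulr z : z * sconj z = `|z| ^+ 2.
Proof.
case: s z => /= [z|z]; first by rewrite real_normK ?num_real.
by rewrite sqr_normc.
Qed.

Lemma normr_sconj z : `|sconj z| = `|z|.
Proof.
by apply/eqP; rewrite -(eqrXn2 (n := 2))// -!sconj_mulr sconjK mulrC.
Qed.

Lemma sRe_norm_sreal r : sRe `|sreal r : scalarField R s| = `|r|.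
Proof.
have [r0|r0] := leP 0 r.
  by rewrite ger0_norm ?srealK ?ger0_norm// -(sreal0 s) ler_sreal.
rewrite -normrN -srealN ger0_norm ?srealK ?ltr0_norm//.
by rewrite -(sreal0 s) ler_sreal oppr_ge0 ltW.
Qed.

Lemma sRe_norm_ge0 z : 0 <= sRe `|z|.
Proof. by rewrite -(ler_sreal s) sRe_norm sreal0. Qed.

Lemma ltr_sreal : {mono @sreal R s : x y / x < y}.
Proof.
by move=> x y; rewrite !lt_neqAle ler_sreal (can_eq (@srealK R s)).
Qed.

Lemma gt0_sreal z : 0 < z -> exists2 r : R, 0 < r & z = sreal r.
Proof.
move=> z0; exists (sRe z); last by rewrite sRe_ge0// ltW.
by rewrite -ltr_sreal sreal0 sRe_ge0// ltW.
Qed.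

(** Multiplying by a unit scalar turns a scalar into its modulus; this is how
    bounds on real parts become bounds on moduli. *)
Lemma sphase z : exists a : scalarField R s,
  sRe `|a| <= 1 /\ sRe (a * z) = sRe `|z|.
Proof.
have [->|z0] := eqVneq z 0.
  by exists 0; rewrite !mulr0 normr0 raddf0 ler01.
exists (sconj z / `|z|); split.
  by rewrite normrM normr_sconj normfV normr_id divff ?normr_eq0// -(sreal1 s) srealK.
by rewrite mulrAC [_ * z]mulrC sconj_mulr expr2 mulfK ?normr_eq0.
Qed.

(** The passage from real to scalar identities: an equation need only be
    checked on real parts, provided it is checked on all multiples. *)
Lemma sRe_inj z w : (forall a, sRe (a * z) = sRe (a * w)) -> z = w.
Proof.
move=> zw; apply/eqP; rewrite -subr_eq0 -normr_eq0 -sRe_norm.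
have [a [_ <-]] := sphase (z - w).
by rewrite mulrBr raddfB /= zw subrr sreal0.
Qed.

Lemma ler_norm_sRe z : `|sRe z| <= sRe `|z|.
Proof.
suff H w : sRe w <= sRe `|w|.
  by rewrite ler_norml lerNl -raddfN /= H -normrN H.
case: s w => /= [w|[a b]] /=; first exact: ler_norm.
rewrite (le_trans (ler_norm _))// -sqrtr_sqr ler_wsqrtr// lerDl.
exact: sqr_ge0.
Qed.

End ScalarFacts.

Notation "r *:: x" := (sreal r *: x) (at level 40, left associativity).

Section NrmFacts.
Context {R : realType} {s : scalar_kind} {V : normedModType (scalarField R s)}.
Implicit Types (x y z : V) (r : R).

Lemma nrmN x : nrm (- x) = nrm x.
Proof. by rewrite /nrm normrN. Qed.

Lemma oppsr x : - x = (-1) *:: x.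
Proof. by rewrite srealN sreal1 scaleN1r. Qed.

Lemma nrmBC x y : nrm (x - y) = nrm (y - x).
Proof. by rewrite -nrmN opprB. Qed.

Lemma ler_nrmB x y : nrm (x - y) <= nrm x + nrm y.
Proof. by rewrite -(nrmN y) ler_nrmD. Qed.

Lemma ler_nrm_distD z x y : nrm (x - y) <= nrm (x - z) + nrm (z - y).
Proof. by rewrite -(subrKA z x (-y)) ler_nrmD. Qed.

Lemma nrm_sZ r x : nrm (r *:: x) = `|r| * nrm x.
Proof. by rewrite nrmZ sRe_norm_sreal. Qed.

Lemma ler_dist_nrm x y : `|nrm x - nrm y| <= nrm (x - y).
Proof.
have H a b : nrm a - nrm b <= nrm (a - b).
  by rewrite lerBlDr -{1}(subrK b a) ler_nrmD.
by rewrite ler_norml H andbT lerNl opprB nrmBC H.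
Qed.

Lemma cvg_nrm {T} (F : set_system T) {FF : Filter F} (u : T -> V) (x : V) :
  u @ F --> x <-> forall e : R, 0 < e -> \forall t \near F, nrm (u t - x) < e.
Proof.
rewrite cvgrPdist_lt; split => [H e e0|H _ /gt0_sreal[e e0 ->]].
  have : (0 : scalarField R s) < sreal e by rewrite -(sreal0 s) ltr_sreal.
  by move=> /H; apply: filterS => t; rewrite -nrmE ltr_sreal nrmBC.
by move: e0 => /H; apply: filterS => t; rewrite -nrmE ltr_sreal nrmBC.
Qed.

Lemma cvg_nrm_real {T} (F : set_system T) {FF : Filter F} (u : T -> V) (x : V) :
  u @ F --> x <-> nrm (u t - x) @[t --> F] --> (0 : R).
Proof.
rewrite cvg_nrm cvgrPdist_lt; split => H e /H; apply: filterS => t;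
  by rewrite sub0r normrN ger0_norm ?nrm_ge0.
Qed.

End NrmFacts.

Lemma nrm_complete {R : realType} {s : scalar_kind}
    (V : completeNormedModType (scalarField R s)) (u : nat -> V) :
  (forall e : R, 0 < e -> exists N, forall n m, (N <= n)%N -> (N <= m)%N ->
     nrm (u n - u m) < e) -> cvg (u @ \oo).
Proof.
move=> H; apply/cauchy_cvgP/cauchy_exP => _ /gt0_sreal[e e0 ->].
have [N HN] := H e e0; exists (u N); exists N => // n /= Nn.
by rewrite -ball_normE /ball_ /= -nrmE ltr_sreal HN.
Qed.

(** * The real inner product and the Riesz theorem *)

Section RealInner.
Context {R : realType} {s : scalar_kind} {H : hilbertType R s}.
Implicit Types (x y z : H) (r : R) (a : scalarField R s).

Definition rin x y : R := sRe (inner x y).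

Lemma innerDl x y z : inner (x + y) z = inner x z + inner y z.
Proof. by rewrite -{1}(scale1r x) inner_linearl mul1r. Qed.

Lemma innerZl a x z : inner (a *: x) z = a * inner x z.
Proof.
have E : inner (0 : H) z = 0.
  by apply: (addrI (inner 0 z)); rewrite -innerDl !addr0.
by rewrite -(addr0 (a *: x)) inner_linearl E addr0.
Qed.

Lemma innerDr x y z : inner z (x + y) = inner z x + inner z y.
Proof. by rewrite inner_sym innerDl sconjD -!inner_sym. Qed.

Lemma innerZr a x z : inner z (a *: x) = sconj a * inner z x.
Proof. by rewrite inner_sym innerZl sconjM -!inner_sym. Qed.

Lemma rinC x y : rin x y = rin y x.
Proof. by rewrite /rin inner_sym sRe_sconj. Qed.

Lemma rinDl x y z : rin (x + y) z = rin x z + rin y z.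
Proof. by rewrite /rin innerDl raddfD. Qed.

Lemma rinZl r x z : rin (r *:: x) z = r * rin x z.
Proof. by rewrite /rin innerZl sRe_srealM. Qed.

Lemma rinNl x z : rin (- x) z = - rin x z.
Proof. by rewrite oppsr rinZl mulN1r. Qed.

Lemma rinBl x y z : rin (x - y) z = rin x z - rin y z.
Proof. by rewrite rinDl rinNl. Qed.

Lemma rinDr x y z : rin z (x + y) = rin z x + rin z y.
Proof. by rewrite !(rinC z) rinDl. Qed.

Lemma rinZr r x z : rin z (r *:: x) = r * rin z x.
Proof. by rewrite !(rinC z) rinZl. Qed.

Lemma rinNr x z : rin z (- x) = - rin z x.
Proof. by rewrite !(rinC z) rinNl. Qed.

Lemma rinBr x y z : rin z (x - y) = rin z x - rin z y.
Proof. by rewrite !(rinC z) rinBl. Qed.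

Lemma rin0l z : rin 0 z = 0.
Proof. by rewrite -(subrr (0 : H)) rinBl subrr. Qed.

Lemma rin0r z : rin z 0 = 0.
Proof. by rewrite rinC rin0l. Qed.

Definition rinE := (rinDl, rinDr, rinBl, rinBr, rinNl, rinNr, rinZl, rinZr).

Lemma rinxx x : rin x x = nrm x ^+ 2.
Proof. by rewrite /rin inner_norm -nrmE -rmorphXn srealK. Qed.

Lemma rin_sconj a x y : rin (a *: x) y = rin x (sconj a *: y).
Proof. by rewrite /rin innerZl innerZr sconjK. Qed.

Lemma CauchySchwarz x y : `|rin x y| <= nrm x * nrm y.
Proof.
have key (t : R) : 0 <= nrm x ^+ 2 - 2 * t * rin x y + t ^+ 2 * nrm y ^+ 2.
  have := sqr_ge0 (nrm (x - t *:: y)); rewrite -(rinxx (x - t *:: y)) !rinE !rinxx.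
  by rewrite (rinC y x) => /le_trans; apply; rewrite le_eqVlt; apply/predU1P; left; ring.
have [y0|y0] := eqVneq (nrm y) 0.
  by rewrite (nrm0_eq0 y0) rin0r normr0 nrm0 mulr0.
have yp : 0 < nrm y by rewrite lt_neqAle eq_sym y0 nrm_ge0.
rewrite -ler_sqr ?nnegrE ?mulr_ge0 ?nrm_ge0// real_normK ?num_real//.
have := key (rin x y / nrm y ^+ 2).
have -> : nrm x ^+ 2 - 2 * (rin x y / nrm y ^+ 2) * rin x y +
    (rin x y / nrm y ^+ 2) ^+ 2 * nrm y ^+ 2 =
    (nrm x ^+ 2 * nrm y ^+ 2 - rin x y ^+ 2) / nrm y ^+ 2 by field.
by rewrite pmulr_lge0 ?invr_gt0 ?exprn_gt0// subr_ge0 exprMn.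
Qed.

Lemma rin_le x y : rin x y <= nrm x * nrm y.
Proof. exact: le_trans (ler_norm _) (CauchySchwarz x y). Qed.

Lemma rin_inj x y : (forall z, rin x z = rin y z) -> x = y.
Proof.
move=> xy; apply/eqP; rewrite -subr_eq0; apply/eqP/nrm0_eq0/eqP.
by rewrite -sqrf_eq0 -rinxx rinBl xy subrr.
Qed.

Lemma nrm_le_rin x (c : R) : 0 <= c -> (forall z, rin x z <= c * nrm z) ->
  nrm x <= c.
Proof.
move=> c0 /(_ x); rewrite rinxx expr2.
have [->//|x0] := eqVneq (nrm x) 0.
by rewrite ler_pM2r// lt_neqAle eq_sym x0 nrm_ge0.
Qed.

End RealInner.

(** The Lax-Milgram theorem for a symmetric form on a closed subspace. The
    minimising sequences of the energy [b v v - 2 phi v] are Cauchy by the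
    parallelogram identity, and the first variation at the minimiser vanishes.
    The cases used are the Riesz theorem ([b] the inner product), the
    projection theorem behind density statements, and the invertibility of
    coercive operators. *)
Section LaxMilgram.
Context {R : realType} {s : scalar_kind} {H : hilbertType R s}.
Variables (D : set H) (b : H -> H -> R) (phi : H -> R) (kappa M c : R).
Hypothesis D0 : D 0.
Hypothesis DD : forall x y, D x -> D y -> D (x + y).
Hypothesis DZ : forall (r : R) x, D x -> D (r *:: x).
Hypothesis Dcl : forall (u : nat -> H) x,
  (forall n, D (u n)) -> u @ \oo --> x -> D x.
Hypothesis bC : forall x y, b x y = b y x.
Hypothesis bD : forall x y z, b (x + y) z = b x z + b y z.
Hypothesis bZ : forall r x z, b (r *:: x) z = r * b x z.
Hypothesis bM : forall x y, `|b x y| <= M * nrm x * nrm y.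
Hypothesis kappa0 : 0 < kappa.
Hypothesis bk : forall x, kappa * nrm x ^+ 2 <= b x x.
Hypothesis phiD : forall x y, phi (x + y) = phi x + phi y.
Hypothesis phiZ : forall r x, phi (r *:: x) = r * phi x.
Hypothesis phic : forall x, phi x <= c * nrm x.

Let J v := b v v - 2 * phi v.

Let bDr x y z : b z (x + y) = b z x + b z y.
Proof. by rewrite !(bC z) bD. Qed.

Let bZr r x z : b z (r *:: x) = r * b z x.
Proof. by rewrite !(bC z) bZ. Qed.

Lemma LaxMilgram : exists2 x, D x & forall v, D v -> phi v = b x v.
Proof.
have Jlb v : - (c ^+ 2 / kappa) <= J v.
  apply: (@le_trans _ _ (kappa * nrm v ^+ 2 - 2 * (c * nrm v))); last first.
    by apply: lerB; [exact: bk|rewrite ler_pM2l].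
  have : 0 <= (kappa * nrm v - c) ^+ 2 / kappa.
    by rewrite mulr_ge0 ?sqr_ge0// invr_ge0 ltW.
  have -> : (kappa * nrm v - c) ^+ 2 / kappa =
    kappa * nrm v ^+ 2 - 2 * (c * nrm v) + c ^+ 2 / kappa by field; rewrite gt_eqF.
  by lra.
(* A minimising sequence is Cauchy because the energy at the midpoint of two of
   its terms is at least the infimum. *)
pose m := inf [set J v | v in D].
have hi : has_inf [set J v | v in D].
  split; first by exists (J 0); exists 0.
  by exists (- (c ^+ 2 / kappa)) => _ [v _ <-].
have mJ v : D v -> m <= J v.
  by move=> Dv; apply: ge_inf; [case: hi|exists v].
have /choice[u hu] : forall n : nat, exists v, D v /\ J v < m + n.+1%:R^-1.
  move=> n; have n0 : (0 : R) < n.+1%:R^-1 by rewrite invr_gt0.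
  have [_ [v Dv <-] lt] := inf_adherent n0 hi.
  by exists v.
have par v w : D v -> D w ->
    kappa * nrm (v - w) ^+ 2 <= 2 * (J v - m) + 2 * (J w - m).
  move=> Dv Dw; apply: le_trans (bk _) _.
  have := mJ _ (DZ 2^-1 (DD Dv Dw)); rewrite /J.
  rewrite (oppsr w) !(bD, bDr, bZ, bZr, phiD, phiZ) (bC w v).
  by lra.
have ucauchy (e : R) : 0 < e -> exists N, forall i j, (N <= i)%N -> (N <= j)%N ->
    nrm (u i - u j) < e.
  move=> e0; have k4 : 0 < kappa * e ^+ 2 / 4.
    by rewrite divr_gt0// mulr_gt0// exprn_gt0.
  have [N _ HN] : \forall n \near \oo, n.+1%:R^-1 < kappa * e ^+ 2 / 4.
    exact: near_infty_natSinv_lt (PosNum k4).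
  exists N => i j Ni Nj.
  rewrite -(@ltr_pXn2r _ 2)// ?nnegrE ?nrm_ge0 ?ltW//.
  rewrite -(ltr_pM2l kappa0); apply: le_lt_trans (par _ _ (hu i).1 (hu j).1) _.
  have := (hu i).2; have := (hu j).2; have := HN _ Ni; have := HN _ Nj => /=.
  move: (j.+1%:R^-1) (i.+1%:R^-1) (kappa * e ^+ 2) => a a' ke.
  by lra.
have /cvg_ex[/= x ux] := nrm_complete ucauchy.
exists x; first by apply: Dcl ux => n; case: (hu n).
move=> v Dv.
(* The first variation at the limit, obtained before taking the limit in order
   to avoid proving that [J] is continuous. *)
have var t : 0 <= 2 * t * (b x v - phi v) + t ^+ 2 * b v v.
  apply/ler_addgt0Pr => /= e' e0; have [e ee] : exists e : R, e = e' by exists e'.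
  rewrite -ee in e0 *; move: ee => _.
  have K0 : 0 < 2 * `|t| * (`|M| * nrm v) + 2.
    by rewrite ltr_wpDl// !mulr_ge0// nrm_ge0.
  have eK : 0 < e / (2 * `|t| * (`|M| * nrm v) + 2) by rewrite divr_gt0.
  move/cvg_nrm: ux => /(_ _ eK) ux.
  have : \forall n \near \oo, n.+1%:R^-1 < e / (2 * `|t| * (`|M| * nrm v) + 2).
    exact: near_infty_natSinv_lt (PosNum eK).
  move=> un; near \oo => n.
  have n1 : nrm (u n - x) < e / (2 * `|t| * (`|M| * nrm v) + 2) by near: n.
  have n2 : n.+1%:R^-1 < e / (2 * `|t| * (`|M| * nrm v) + 2) by near: n.
  have := mJ _ (DD (hu n).1 (DZ t Dv)); have := (hu n).2.
  rewrite /J !(bD, bDr, bZ, bZr, phiD, phiZ) (bC v (u n)) => h1 h2.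
  have h3 : t * b (u n) v - t * b x v <= `|t| * (`|M| * nrm v) * nrm (u n - x).
    have -> : t * b (u n) v - t * b x v = t * b (u n - x) v.
      by rewrite (oppsr x) bD bZ; ring.
    rewrite (le_trans (ler_norm _))// normrM -mulrA ler_wpM2l//.
    rewrite (le_trans (bM _ _))// mulrAC -mulrA -mulrA.
    rewrite (le_trans (ler_norm _))// normrM ler_wpM2l//.
    by rewrite ger0_norm ?mulr_ge0 ?nrm_ge0.
  have h4 : `|t| * (`|M| * nrm v) * nrm (u n - x) <=
      `|t| * (`|M| * nrm v) * (e / (2 * `|t| * (`|M| * nrm v) + 2)).
    by rewrite ler_wpM2l ?mulr_ge0 ?nrm_ge0// ltW.
  have h5 : (2 * `|t| * (`|M| * nrm v) + 2) * (e / (2 * `|t| * (`|M| * nrm v) + 2)) = e.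
    by rewrite mulrC divfK// gt_eqF.
  set q := e / _ in n1 n2 h4 h5.
  move: (n.+1%:R^-1) n2 h1 => a n2 h1; move: q n1 n2 h4 h5 => r n1 n2 h4 h5.
  have := nrm_ge0 (u n - x).
  by lra.
apply/eqP; rewrite eq_sym -subr_eq0; apply/eqP.
set d := b x v - phi v in var *; set B := b v v in var.
have B0 : 0 <= B by rewrite /B (le_trans _ (bk _))// mulr_ge0 ?sqr_ge0// ltW.
have B1 : 0 < B + 1 by rewrite ltr_wpDl.
(* The minimiser of the quadratic in [t], with [B + 1] for [B] to cover [B = 0]. *)
have := var (- d / (B + 1)).
have -> : 2 * (- d / (B + 1)) * d + (- d / (B + 1)) ^+ 2 * B =
  - (d ^+ 2 * (B + 2)) / (B + 1) ^+ 2 by field; rewrite gt_eqF// ltr_wpDl.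
rewrite pmulr_lge0 ?invr_gt0 ?exprn_gt0// oppr_ge0.
rewrite pmulr_lle0 ?ltr_wpDl// => d0.
by apply/eqP; rewrite -sqrf_eq0 eq_le d0 sqr_ge0.
Unshelve. all: by end_near. Qed.

End LaxMilgram.

Section BoundedLinear.
Context {R : realType} {s : scalar_kind} {V W : normedModType (scalarField R s)}.

Definition mkbop (f : V -> W) (fb : bounded_op f) : bop V W := Bop (mem_set fb).

Lemma bounded_opP (f : V -> W) (c : R) :
  (forall x y, f (x + y) = f x + f y) ->
  (forall a x, f (a *: x) = a *: f x) ->
  (forall x, nrm (f x) <= c * nrm x) -> bounded_op f.
Proof.
by move=> fD fZ fc; split; [move=> a x y; rewrite fD fZ|exists c].
Qed.

Lemma bopDr (T : bop V W) x y : T (x + y) = T x + T y.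
Proof. exact: linearD. Qed.

Lemma bopBr (T : bop V W) x y : T (x - y) = T x - T y.
Proof. exact: linearB. Qed.

Lemma bopZr (T : bop V W) a x : T (a *: x) = a *: T x.
Proof. exact: linearZ. Qed.

Lemma bop0r (T : bop V W) : T 0 = 0.
Proof. exact: linear0. Qed.

Lemma bop_sZ (T : bop V W) r x :
  T (r *:: x) = r *:: T x.
Proof. exact: linearZ. Qed.

End BoundedLinear.

(** Gliding hump: if the norms were unbounded, a point could be moved by
    geometrically decreasing steps so that each step makes one more operator
    large and the later steps cannot undo it. *)
Lemma uniform_boundedness {R : realType} {s : scalar_kind}
    (V : completeNormedModType (scalarField R s))
    (W : normedModType (scalarField R s)) (I : Type) (T : I -> bop V W) :
  (forall x, exists c : R, forall i, nrm (T i x) <= c) ->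
  exists M : R, forall i, opnorm (T i) <= M.
Proof.
move=> Tc; apply: contrapT => /forallNP nM.
have big (M : R) : exists i, M < opnorm (T i).
  by have /existsNP[i /negP] := nM M; rewrite -ltNge; exists i.
have /choice[i hi] : forall n : nat, exists i, n%:R * 3 ^+ n < opnorm (T i).
  by move=> n; exact: big.
(* As [2 xr = (x0 + xr) - (x0 - xr)], the operator is large at one of the points
   [x0 + xr] and [x0 - xr]. *)
have hump (n : nat) (x0 : V) : exists x, nrm (x - x0) <= 3^-1 ^+ n /\
    2 / 3 * 3^-1 ^+ n * opnorm (T (i n)) <= nrm (T (i n) x).
  have N0 : 0 < opnorm (T (i n)).
    by apply: le_lt_trans (hi n); rewrite mulr_ge0// exprn_ge0.
  have e0 : 0 < opnorm (T (i n)) / 3 by rewrite divr_gt0.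
  have [_ [xi /= xi1 <-]] := sup_adherent e0 (opnorm_has_sup (T (i n))).
  rewrite -/(opnorm _) => big1.
  have r0 : 0 <= (3^-1 : R) ^+ n by rewrite exprn_ge0// invr_ge0.
  pose xr := (3^-1 ^+ n) *:: xi.
  have xr1 : nrm xr <= 3^-1 ^+ n by rewrite nrm_sZ ger0_norm// ler_piMr.
  have Txr : 2 / 3 * 3^-1 ^+ n * opnorm (T (i n)) <= nrm (T (i n) xr).
    rewrite /xr linearZ nrm_sZ ger0_norm// mulrAC [leLHS]mulrC ler_wpM2l//.
    by lra.
  have : nrm (T (i n) xr) *+ 2 <= nrm (T (i n) (x0 + xr)) + nrm (T (i n) (x0 - xr)).
    rewrite -[_ *+ 2]mulr_natl -(ger0_norm (ler0n R 2)) -nrm_sZ.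
    apply: le_trans (ler_nrmB _ _).
    by rewrite linearB linearD opprB [_ xr - _]addrC addrACA subrr add0r rmorph_nat scaler_nat mulr2n.
  have [h|h] := leP (nrm (T (i n) (x0 - xr))) (nrm (T (i n) (x0 + xr))) => h2.
    exists (x0 + xr); rewrite addrC addKr; split=> //.
    by apply: le_trans Txr _; lra.
  exists (x0 - xr); rewrite addrC addKr nrmN; split=> //.
  by apply: le_trans Txr _; lra.
have /choice[F hF] : forall p : nat * V, exists x, nrm (x - p.2) <= 3^-1 ^+ p.1 /\
    2 / 3 * 3^-1 ^+ p.1 * opnorm (T (i p.1)) <= nrm (T (i p.1) x).
  by move=> [n x0]; exact: hump.
have [x xS] : exists x : nat -> V, forall n, x n.+1 = F (n, x n).
  by exists (fix x n := if n is k.+1 then F (k, x k) else 0 : V).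
have tail n k : nrm (x (n + k).+1 - x n.+1) <= 2^-1 * (3^-1 ^+ n - 3^-1 ^+ (n + k)).
  elim: k => [|k IH]; first by rewrite addn0 !subrr nrm0 mulr0.
  rewrite addnS; apply: le_trans (ler_nrm_distD (x (n + k).+1) _ _) _.
  have := (hF ((n + k).+1, x (n + k).+1)).1; rewrite -xS /= exprS => h.
  have := lerD h IH.
  by move: (3^-1 ^+ (n + k)) => q; lra.
have tl n k : nrm (x (n + k).+1 - x n.+1) <= 2^-1 * 3^-1 ^+ n.
  apply: le_trans (tail n k) _; rewrite ler_pM2l// lerBlDr lerDl.
  by rewrite exprn_ge0// invr_ge0.
have xc : cvg (x @ \oo).
  apply: nrm_complete => e e0.
  have : (fun n => (3^-1 : R) ^+ n) @ \oo --> (0 : R).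
    by apply: cvg_expr; rewrite ger0_norm ?invr_ge0// invf_lt1// ltr1n.
  move=> /cvgrPdist_lt/(_ _ e0)[N _ HN]; exists N.+1 => n m Nn Nm.
  have tN k : (N < k)%N -> nrm (x k - x N.+1) <= 2^-1 * 3^-1 ^+ N.
    by case: k => // k; rewrite ltnS => /subnKC <-; exact: tl.
  apply: le_lt_trans (ler_nrm_distD (x N.+1) _ _) _.
  rewrite [nrm (x N.+1 - _)]nrmBC.
  have := HN N (leqnn _); rewrite /= sub0r normrN ger0_norm ?exprn_ge0 ?invr_ge0//.
  by have := tN _ Nn; have := tN _ Nm; move: (3^-1 ^+ N) => q; lra.
move/cvg_ex: xc => [/= y xy].
have [c hc] := Tc y.
have yx n : nrm (y - x n.+1) <= 2^-1 * 3^-1 ^+ n.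
  apply/ler_addgt0Pr => e e0.
  move/cvg_nrm: xy => /(_ _ e0)[N _ HN].
  have nN : (N <= (n + N).+1)%N by rewrite leqW// leq_addl.
  have := HN _ nN => /=; rewrite nrmBC => h.
  apply: le_trans (ler_nrm_distD (x (n + N).+1) _ _) _.
  by rewrite addrC lerD// ltW.
have lin n : n%:R <= 6 * c.
  have h1 := (hF (n, x n)).2; rewrite -xS /= in h1.
  have h3 : nrm (T (i n) (x n.+1)) <= nrm (T (i n) y) + nrm (T (i n) (y - x n.+1)).
    rewrite linearB; apply: le_trans (ler_nrmB _ _).
    by rewrite subKr.
  have h4 : nrm (T (i n) (y - x n.+1)) <= opnorm (T (i n)) * (2^-1 * 3^-1 ^+ n).
    by apply: le_trans (le_opnorm _ _) _; rewrite ler_wpM2l ?opnorm_ge0.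
  have h5 := hc (i n).
  have h6 : n%:R <= 3^-1 ^+ n * opnorm (T (i n)).
    rewrite exprVn ler_pdivlMl ?exprn_gt0// mulrC ltW// hi.
  move: (3^-1 ^+ n) (opnorm _) h1 h4 h6 => a b h1 h4 h6.
  by lra.
have := lin (Num.truncn (6 * c)).+1; rewrite leNgt => /negP; apply.
exact: Num.Theory.truncnS_gt.
Qed.

Section Riesz.
Context {R : realType} {s : scalar_kind} {H : hilbertType R s}.
Implicit Types (x y z : H) (r : R) (a : scalarField R s).

Lemma real_riesz (phi : H -> R) (c : R) :
  (forall x y, phi (x + y) = phi x + phi y) ->
  (forall r x, phi (r *:: x) = r * phi x) ->
  (forall x, phi x <= c * nrm x) -> exists x, forall v, phi v = rin x v.
Proof.
move=> phiD phiZ phic.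
have [x _ hx] := @LaxMilgram R s H setT rin phi 1 1 c Logic.I
  (fun _ _ _ _ => Logic.I) (fun _ _ _ => Logic.I) (fun _ _ _ _ => Logic.I)
  rinC rinDl rinZl (ltac:(by move=> x y; rewrite mul1r CauchySchwarz)) ltr01
  (ltac:(by move=> x; rewrite mul1r rinxx)) phiD phiZ phic.
by exists x => v; exact: hx.
Qed.

Lemma rd_subproof y : bounded_op (fun v : H => inner v y : (scalarField R s)^o).
Proof.
apply: (@bounded_opP _ _ _ _ _ (nrm y)).
- by move=> u v; rewrite innerDl.
- by move=> a u; rewrite innerZl.
move=> v; have [a [a1 ea]] := sphase (inner v y).
rewrite {1}/nrm -ea -innerZl (le_trans (rin_le _ _))// mulrC ler_wpM2l ?nrm_ge0//.
by rewrite nrmZ ler_piMl// nrm_ge0.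
Qed.

(** The inverse of [riesz]. *)
Definition rd y : dual H := mkbop (rd_subproof y).

Lemma rdE y v : rd y v = inner v y. Proof. by []. Qed.

Lemma dual_real_inj (f g : dual H) :
  (forall v, sRe (f v) = sRe (g v)) -> f = g.
Proof.
move=> fg; apply: bopP => v; apply: sRe_inj => a.
by have := fg (a *: v); rewrite !linearZ.
Qed.

Lemma dual_rep (f : dual H) : exists y, f = rd y.
Proof.
have [||x|y hy] := @real_riesz (fun v => sRe (f v)) (opnorm f).
- by move=> x y; rewrite linearD raddfD.
- by move=> r x; rewrite linearZ -sRe_srealM.
- apply: le_trans (le_opnorm f x).
  exact: le_trans (ler_norm _) (ler_norm_sRe _).
by exists y; apply: dual_real_inj => v; rewrite hy rinC.
Qed.

Lemma rd_inj : injective rd.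
Proof.
move=> x y /(congr1 (@bop_fun _ _ _ _)) xy; apply: rin_inj => z.
by rewrite !(rinC _ z) /rin -!rdE; congr sRe; rewrite /= in xy; exact: (congr1 (@^~ z) xy).
Qed.

Lemma rdK y : riesz (rd y) = y.
Proof.
rewrite /riesz; case: xgetP => [x _ /= hx|/(_ y) []//].
by apply: rd_inj; apply: bopP => v; exact/esym/hx.
Qed.

Lemma rieszK (f : dual H) : rd (riesz f) = f.
Proof. by have [y ->] := dual_rep f; rewrite rdK. Qed.

Lemma rieszE (f : dual H) v : f v = inner v (riesz f).
Proof. by rewrite -{1}(rieszK f). Qed.

Lemma rdD x y : rd (x + y) = rd x + rd y.
Proof. by apply: bopP => v; rewrite bopD !rdE innerDr. Qed.

Lemma rdZ a x : rd (a *: x) = sconj a *: rd x.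
Proof. by apply: bopP => v; rewrite bopZ !rdE innerZr. Qed.

Lemma rdB x y : rd (x - y) = rd x - rd y.
Proof.
by rewrite oppsr rdD rdZ sconj_sreal -oppsr.
Qed.

Lemma nrm_rd y : nrm (rd y) = nrm y.
Proof.
apply/eqP; rewrite eq_le; apply/andP; split.
  rewrite nrm_bopE; apply: opnorm_le => [|v]; first exact: nrm_ge0.
  have [a [a1 ea]] := sphase (inner v y).
  rewrite {1}/nrm -ea -innerZl (le_trans (rin_le _ _))// mulrC ler_wpM2l ?nrm_ge0//.
  by rewrite nrmZ ler_piMl// nrm_ge0.
apply: nrm_le_rin => [|v]; first exact: nrm_ge0.
rewrite rinC nrm_bopE; apply: le_trans (le_opnorm _ _).
exact: le_trans (ler_norm _) (ler_norm_sRe _).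
Qed.

Lemma nrm_riesz (f : dual H) : nrm (riesz f) = nrm f.
Proof. by rewrite -nrm_rd rieszK. Qed.

Lemma rieszD (f g : dual H) : riesz (f + g) = riesz f + riesz g.
Proof. by apply: rd_inj; rewrite rdD !rieszK. Qed.

Lemma rieszZ a (f : dual H) : riesz (a *: f) = sconj a *: riesz f.
Proof. by apply: rd_inj; rewrite rdZ !rieszK sconjK. Qed.

Lemma rieszB (f g : dual H) : riesz (f - g) = riesz f - riesz g.
Proof. by apply: rd_inj; rewrite rdB !rieszK. Qed.

End Riesz.

Section HilbertOperators.
Context {R : realType} {s : scalar_kind} {H : hilbertType R s}.
Implicit Types (x y z : H) (r : R) (a : scalarField R s).

Lemma adj_subproof (T : bop H H) :
  bounded_op (fun y => riesz (transpose T (rd y))).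
Proof.
apply: (@bounded_opP _ _ _ _ _ (opnorm T)).
- move=> x y; rewrite rdD -rieszD; congr riesz; exact: bopP.
- move=> a x; rewrite rdZ -[in RHS](sconjK a) -rieszZ; congr riesz; exact: bopP.
move=> x; rewrite nrm_riesz nrm_bopE; apply: opnorm_le.
  by rewrite mulr_ge0 ?opnorm_ge0 ?nrm_ge0.
move=> v; apply: le_trans (le_opnorm (rd x) _) _.
rewrite -(nrm_bopE (rd x)) nrm_rd [leRHS]mulrAC mulrC.
by rewrite ler_wpM2r ?nrm_ge0// le_opnorm.
Qed.

Definition adj (T : bop H H) : bop H H := mkbop (adj_subproof T).

Lemma rd_adj (T : bop H H) y : rd (adj T y) = transpose T (rd y).
Proof. exact: rieszK. Qed.

Lemma inner_adj (T : bop H H) x y : inner (T x) y = inner x (adj T y).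
Proof. by rewrite -[RHS]rdE rd_adj. Qed.

Lemma rin_adj (T : bop H H) x y : rin (T x) y = rin x (adj T y).
Proof. by rewrite /rin inner_adj. Qed.

Lemma opnorm_adj (T : bop H H) : opnorm (adj T) <= opnorm T.
Proof.
apply: opnorm_le => [|x]; first exact: opnorm_ge0.
apply: nrm_le_rin => [|z]; first by rewrite mulr_ge0 ?opnorm_ge0 ?nrm_ge0.
rewrite rinC -rin_adj (le_trans (rin_le _ _))// mulrAC ler_wpM2r ?nrm_ge0//.
exact: le_opnorm.
Qed.

Lemma coercive_surj (P : bop H H) (kappa : R) : 0 < kappa ->
  (forall x y, rin (P x) y = rin (P y) x) ->
  (forall x, kappa * nrm x ^+ 2 <= rin (P x) x) ->
  forall z, exists x, P x = z.
Proof.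
move=> k0 PC Pk z.
have [|||||||||||||x _ hx] := @LaxMilgram R s H setT (fun x y => rin (P x) y) (rin z)
  kappa (opnorm P) (nrm z) => //.
- by move=> x y v; rewrite linearD rinDl.
- by move=> r x v; rewrite bop_sZ rinZl.
- move=> x y; apply: le_trans (CauchySchwarz _ _) _.
  by rewrite ler_wpM2r ?nrm_ge0 ?le_opnorm.
- by move=> x y; exact: rinDr.
- by move=> r x; exact: rinZr.
- by move=> x; exact: rin_le.
by exists x; apply: rin_inj => v; rewrite -hx.
Qed.

Lemma coercive_nrm (P : bop H H) (kappa : R) : 0 < kappa ->
  (forall x, kappa * nrm x ^+ 2 <= rin (P x) x) ->
  forall x, kappa * nrm x <= nrm (P x).
Proof.
move=> k0 Pk x; have [->|x0] := eqVneq (nrm x) 0; first by rewrite mulr0 nrm_ge0.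
have xp : 0 < nrm x by rewrite lt_neqAle eq_sym x0 nrm_ge0.
by rewrite -(ler_pM2r xp) -mulrA -expr2 (le_trans (Pk _))// rin_le.
Qed.

(** Surjectivity is the Lax-Milgram theorem; coercivity bounds the inverse. *)
Lemma coercive_inv (P : bop H H) (kappa : R) : 0 < kappa ->
  (forall x y, rin (P x) y = rin (P y) x) ->
  (forall x, kappa * nrm x ^+ 2 <= rin (P x) x) ->
  exists Q : bop H H, cancel P Q /\ cancel Q P.
Proof.
move=> k0 PC Pk.
have /choice[q hq] := coercive_surj k0 PC Pk.
have Pinj x y : P x = P y -> x = y.
  move=> xy; apply/eqP; rewrite -subr_eq0; apply/eqP/nrm0_eq0/eqP.
  have := coercive_nrm k0 Pk (x - y).
  rewrite bopBr xy subrr nrm0 pmulr_rle0// => h.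
  by rewrite eq_le h nrm_ge0.
have qb : bounded_op q.
  apply: (@bounded_opP _ _ _ _ _ kappa^-1).
  - by move=> x y; apply: Pinj; rewrite bopDr !hq.
  - by move=> a x; apply: Pinj; rewrite bopZr !hq.
  move=> x; rewrite ler_pdivlMl//; apply: le_trans (coercive_nrm k0 Pk _) _.
  by rewrite hq.
exists (mkbop qb); split => x /=; last exact: hq.
by apply: Pinj; rewrite hq.
Qed.

(** A subspace whose orthogonal complement vanishes is dense: otherwise the
    projection theorem gives a nonzero vector orthogonal to its closure. *)
Lemma dense_of_orthogonal (D : set H) : D 0 ->
  (forall x y, D x -> D y -> D (x + y)) ->
  (forall r x, D x -> D (r *:: x)) ->
  (forall x, (forall v, D v -> rin x v = 0) -> x = 0) ->
  forall x (e : R), 0 < e -> exists2 v, D v & nrm (x - v) < e.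
Proof.
move=> D0 DD DZ Dperp x.
pose Dc := [set x | forall e : R, 0 < e -> exists2 v, D v & nrm (x - v) < e].
have DDc v : D v -> Dc v by move=> Dv e e0; exists v => //; rewrite subrr nrm0.
have [|||||||||||||p Dp hp] := @LaxMilgram R s H Dc rin (rin x) 1 1 (nrm x).
- exact: DDc.
- move=> y z hy hz e e0; have e20 : 0 < e / 2 by rewrite divr_gt0.
  have [v Dv v1] := hy _ e20; have [w Dw w1] := hz _ e20.
  exists (v + w); first exact: DD.
  rewrite opprD addrACA (le_lt_trans (ler_nrmD _ _))// (splitr e) ltrD//.
- move=> r y hy e e0; have K0 : 0 < `|r| + 1 by rewrite ltr_wpDl.
  have [v Dv v1] := hy _ (divr_gt0 e0 K0).
  exists (r *:: v); first exact: DZ.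
  rewrite -scalerBr nrm_sZ; apply: (@le_lt_trans _ _ ((`|r| + 1) * nrm (y - v))).
    by rewrite ler_wpM2r ?nrm_ge0// lerDl.
  by rewrite mulrC -ltr_pdivlMr.
- move=> u y hu /cvg_nrm uy e e0; have e20 : 0 < e / 2 by rewrite divr_gt0.
  have [N _ HN] := uy _ e20; have [v Dv v1] := hu N _ e20.
  exists v => //; apply: le_lt_trans (ler_nrm_distD (u N) _ _) _.
  by rewrite (splitr e) ltrD// nrmBC; exact: HN (leqnn _).
- exact: rinC.
- exact: rinDl.
- exact: rinZl.
- by move=> y z; rewrite mul1r CauchySchwarz.
- exact: ltr01.
- by move=> y; rewrite mul1r rinxx.
- by move=> y z; exact: rinDr.
- by move=> r y; exact: rinZr.
- by move=> y; exact: rin_le.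
(* [p] is the projection of [x] on the closure. *)
suff -> : x = p by exact: Dp.
apply/eqP; rewrite -subr_eq0; apply/eqP/Dperp => v Dv.
by rewrite rinBl hp ?subrr//; exact: DDc.
Qed.

End HilbertOperators.

(** * Derivatives and primitives of functions of a real variable *)

Section RealCalculus.
Context {R : realType}.
Implicit Types (u v F G f g : R -> R) (a b t h : R).

Local Notation mu := (@lebesgue_measure R).

Lemma is_derive1P f t d :
  is_derive t 1 f d <-> h^-1 * (f (t + h) - f t) @[h --> 0^'] --> d.
Proof.
have E : (fun h => h^-1 *: ((f \o shift t) (h *: 1) - f t)) =
         (fun h => h^-1 * (f (t + h) - f t)).
  by apply/funext => h; rewrite /= /GRing.scale /= mulr1 (addrC h).
split=> [[df fd]|fd].
  by rewrite -fd /derive E; move: df; rewrite /derivable E.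
split; first by rewrite /derivable E; apply/cvg_ex; exists d.
by rewrite /derive E; exact: cvg_lim.
Qed.

Lemma derivable_continuous_at F t d : is_derive t 1 F d -> {for t, continuous F}.
Proof. by move=> [? _]; exact/differentiable_continuous/derivable1_diffP. Qed.

Lemma derive_continuous F f : (forall t, is_derive t 1 F (f t)) -> continuous F.
Proof. by move=> Ff t; exact: derivable_continuous_at (Ff t). Qed.

Lemma eq_of_derive F G f t : (forall t, is_derive t 1 F (f t)) ->
  (forall t, is_derive t 1 G (f t)) -> F 0 = G 0 -> F t = G t.
Proof.
move=> Ff Gf FG; apply/eqP; rewrite -subr_eq0; apply/eqP.
rewrite -(subrr (F 0)) {2}FG.
apply: (@is_derive_0_is_cst _ (fun t => F t - G t)) => x.
by apply: is_derive_eq; rewrite subrr.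
Qed.

Lemma derive_le F f a b : a <= b -> (forall t, is_derive t 1 F (f t)) ->
  (forall t, a <= t <= b -> 0 <= f t) -> F a <= F b.
Proof.
move=> ab Ff f0.
have [|c cab E] := @MVT_segment R F f a b ab (fun t _ => Ff t).
  by apply: continuous_subspaceT; exact: derive_continuous Ff.
by rewrite -subr_ge0 E mulr_ge0 ?subr_ge0// f0.
Qed.

Lemma continuous_integrable u a b : continuous u ->
  mu.-integrable `[a, b] (EFin \o u).
Proof.
move=> cu; apply: continuous_compact_integrable; first exact: segment_compact.
exact: continuous_subspaceT.
Qed.

Lemma Rint_split u a b c : continuous u -> a <= b -> b <= c ->
  \int[mu]_(s in `[a, c]) u s =
  \int[mu]_(s in `[a, b]) u s + \int[mu]_(s in `[b, c]) u s.
Proof.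
move=> cu ab bc.
have iab : (BLeft a <= BRight b)%O by rewrite bnd_simp.
have ibc : (BRight b <= BRight c)%O by rewrite bnd_simp.
have E := @Rintegral_itvB R u (BLeft a) (BRight c) b
  (continuous_integrable a c cu) iab ibc.
have I : mu.-integrable `]b, c] (EFin \o u).
  apply: integrableS (continuous_integrable b c cu) => //.
  by apply: subset_itvr; rewrite bnd_simp.
have E2 := Rintegral_itv_obnd_cbnd I.
by rewrite -E2 -E subrKC.
Qed.

Lemma Rint_point u a : \int[mu]_(s in `[a, a]) u s = 0.
Proof. by rewrite set_itv1 Rintegral_set1. Qed.

Lemma Rint_rev u a b : a < b -> \int[mu]_(s in `[b, a]) u s = 0.
Proof. by move=> ab; rewrite set_itv_ge ?bnd_simp -?ltNge// Rintegral_set0. Qed.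

(** The primitive is the oriented integral from [0], a difference of two integrals
    over intervals of which one is degenerate. *)
Lemma primitive_ex u : continuous u ->
  exists F, F 0 = 0 /\ forall t, is_derive t 1 F (u t).
Proof.
move=> cu.
pose F t := \int[mu]_(s in `[0, t]) u s - \int[mu]_(s in `[t, 0]) u s.
have FN (N : R) t : 0 < N -> - N < t ->
    F t = \int[mu]_(s in `[- N, t]) u s - \int[mu]_(s in `[- N, 0]) u s.
  move=> N0 Nt; rewrite /F; have [t0|t0] := leP 0 t.
    rewrite (@Rint_split u (- N) 0 t)//; last by rewrite oppr_le0 ltW.
    rewrite addrAC subrr add0r.
    move: t0; rewrite le_eqVlt => /predU1P[<-|t0]; first by rewrite Rint_point subr0.
    by rewrite (Rint_rev u t0) subr0.
  rewrite (@Rint_split u (- N) t 0)//; try exact: ltW.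
  by rewrite (Rint_rev u t0) sub0r opprD addNKr.
exists F; split; first by rewrite /F subrr.
move=> t.
pose N : R := `|t| + 1.
have N0 : 0 < N by rewrite ltr_wpDl.
have tt1 : t < t + 1 by rewrite ltrDl.
have Nt : - N < t by rewrite ltrNl /N (le_lt_trans (ler_norm _))// normrN ltrDl.
have [dF Fd] := @continuous_FTC1_closed R u (- N) t (t + 1) tt1
  (continuous_integrable (- N) (t + 1) cu) Nt (cu t).
have : is_derive t 1 (fun t => \int[mu]_(s in `[- N, t]) u s) (u t).
  by split; [exact: dF|rewrite -derive1E; exact: Fd].
move=> /is_derive1P dF'; apply/is_derive1P; apply: cvg_trans dF'.
apply: near_eq_cvg.
have tN : 0 < t + N by rewrite -ltrBlDr sub0r.
near=> h; rewrite (FN N t)// (FN N (t + h))//; first by congr (_ * _); ring.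
suff : `|h| < t + N by rewrite ltr_norml => /andP[h1 _]; lra.
near: h; apply: dnbhs0_lt; exact: tN.
Unshelve. all: by end_near. Qed.

Lemma integral_derive u F a b : continuous u -> a <= b ->
  (forall t, is_derive t 1 F (u t)) ->
  (\int[mu]_(s in `[a, b]) (u s)%:E = (F b - F a)%:E)%E.
Proof.
move=> cu; rewrite le_eqVlt => /predU1P[<- _|ab Fu].
  by rewrite set_itv1 integral_set1 subrr.
have cF := derive_continuous Fu.
rewrite (@continuous_FTC2 _ u F)//.
- exact: continuous_subspaceT.
- split.
  + by move=> x _; case: (Fu x).
  + by apply: cvg_at_right_filter; exact: cF.
  + by apply: cvg_at_left_filter; exact: cF.
- by move=> x _; rewrite derive1E; apply: derive_val.
Qed.

Lemma is_derive_expRM (b t : R) :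
  is_derive t 1 (fun t => expR (b * t)) (b * expR (b * t)).
Proof.
have d : is_derive t 1 (fun t => b * t) b.
  by apply: is_derive_eq; rewrite /GRing.scale /= mulr1.
by rewrite mulrC; exact: (@is_derive1_comp R expR (fun t => b * t)).
Qed.

End RealCalculus.

(** * Differentiation of Hilbert-valued functions *)

Section VectorCalculus.
Context {R : realType} {s : scalar_kind} {H : hilbertType R s}.
Implicit Types (w u v : R -> H) (x y z d : H) (t h r a b p q : R).

Lemma cvg_rin {T} (F : set_system T) {FF : Filter F} (f g : T -> H) x y :
  f @ F --> x -> g @ F --> y -> rin (f t) (g t) @[t --> F] --> rin x y.
Proof.
move=> /cvg_nrm fx /cvg_nrm gy; apply/cvgrPdist_lt => e e0.
pose K := nrm x + nrm y + 1.
have K0 : 0 < K by rewrite ltr_wpDl ?addr_ge0 ?nrm_ge0.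
pose q := Num.min 1 (e / (2 * K)).
have q0 : 0 < q by rewrite lt_min ltr01/= divr_gt0// mulr_gt0.
have q1 : q <= 1 by rewrite ge_min lexx.
have qe : q * (2 * K) <= e by rewrite -ler_pdivlMr ?mulr_gt0// ge_min lexx orbT.
near=> t.
have f1 : nrm (f t - x) < q by near: t; exact: fx.
have g1 : nrm (g t - y) < q by near: t; exact: gy.
have E : rin x y - rin (f t) (g t) = - (rin (f t - x) (g t - y) +
    rin (f t - x) y + rin x (g t - y)) by rewrite !rinE; ring.
rewrite E normrN.
have c1 := CauchySchwarz (f t - x) (g t - y).
have c2 := CauchySchwarz (f t - x) y.
have c3 := CauchySchwarz x (g t - y).
apply: le_lt_trans (ler_normD _ _) _.
apply: (@le_lt_trans _ _ (nrm (f t - x) * nrm (g t - y) + nrm (f t - x) * nrm y + nrm x * nrm (g t - y))).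
  by apply: lerD => //; apply: le_trans (ler_normD _ _) _; apply: lerD.
move: (nrm_ge0 (f t - x)) (nrm_ge0 (g t - y)) (nrm_ge0 x) (nrm_ge0 y) => n1 n2 n3 n4.
apply: lt_le_trans qe; rewrite /K.
have m1 : nrm (f t - x) * nrm (g t - y) <= q * 1.
  by apply: ler_pM => //; [exact: ltW|apply: ltW; exact: lt_le_trans q1].
have m2 : nrm (f t - x) * nrm y <= q * nrm y by rewrite ler_wpM2r// ltW.
have m3 : nrm x * nrm (g t - y) <= nrm x * q by rewrite ler_wpM2l// ltW.
have : 0 <= q * (nrm x + nrm y) by rewrite mulr_ge0 ?addr_ge0// ltW.
by lra.
Unshelve. all: by end_near. Qed.

Lemma continuous_rin u v : continuous u -> continuous v ->
  continuous (fun t => rin (u t) (v t)).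
Proof. by move=> cu cv t; apply: cvg_rin; [exact: cu|exact: cv]. Qed.

Lemma continuous_nrm {V : normedModType (scalarField R s)} (f : R -> V) :
  continuous f -> continuous (fun t => nrm (f t)).
Proof.
move=> cf t; apply/cvgrPdist_lt => e e0.
have /cvg_nrm/(_ _ e0) := cf t; apply: filterS => r.
by rewrite distrC; apply: le_lt_trans; exact: ler_dist_nrm.
Qed.

(** The weak derivative reduces statements on curves in [H] to statements on
    real functions, and is all that primitives of curves need. *)
Definition wderiv w u := forall z t, is_derive t 1 (fun t => rin (w t) z) (rin (u t) z).

Definition sderiv w t d := h^-1 *:: (w (t + h) - w t) @[h --> 0^'] --> d.

Lemma mean_value_ineq w u (G g : R -> R) a b : a <= b -> wderiv w u ->
  (forall t, is_derive t 1 G (g t)) ->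
  (forall t, a <= t <= b -> nrm (u t) <= g t) -> nrm (w b - w a) <= G b - G a.
Proof.
move=> ab wu Gg ug.
have H1 z : rin (w b - w a) z <= (G b - G a) * nrm z.
  have D t : is_derive t 1 (fun t => nrm z * G t - rin (w t) z) (nrm z * g t - rin (u t) z).
    have := Gg t => Ggt; have := wu z t => wut.
    by apply: is_derive_eq.
  have D0 t : a <= t <= b -> 0 <= nrm z * g t - rin (u t) z.
    move=> tab; rewrite subr_ge0 (le_trans (rin_le _ _))// mulrC ler_wpM2l ?nrm_ge0//.
    exact: ug.
  by have := derive_le ab D D0; rewrite rinBl; lra.
apply: nrm_le_rin H1; have := derive_le ab Gg; rewrite -subr_ge0; apply => t tab.
by apply: le_trans (nrm_ge0 _) (ug t tab).
Qed.

Lemma eq_of_wderiv w v u t : wderiv w u -> wderiv v u -> w 0 = v 0 -> w t = v t.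
Proof.
move=> wu vu wv; apply: rin_inj => z.
by apply: (@eq_of_derive R (fun t => rin (w t) z) (fun t => rin (v t) z)
  (fun t => rin (u t) z)) => //; rewrite wv.
Qed.

(** The primitives of the functions [rin (u t) z] are linear in [z] and bounded
    by the primitive of [nrm (u t)], so that the Riesz theorem assembles them
    into a curve. *)
Lemma vprimitive_ex u : continuous u -> exists w, w 0 = 0 /\ wderiv w u.
Proof.
move=> cu.
have cuz z : continuous (fun t => rin (u t) z).
  by apply: continuous_rin => // t; exact: cst_continuous.
have /choice[F hF] z := primitive_ex (cuz z).
have [G [G0 hG]] := primitive_ex (continuous_nrm cu).
have FD z1 z2 t : F (z1 + z2) t = F z1 t + F z2 t.
  apply: (@eq_of_derive R (F (z1 + z2)) (fun t => F z1 t + F z2 t) (fun t => rin (u t) (z1 + z2))).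
  - by case: (hF (z1 + z2)).
  - move=> r; have := (hF z1).2 r; have := (hF z2).2 r => d1 d2.
    by apply: is_derive_eq; rewrite rinDr.
  - by rewrite !(hF _).1 addr0.
have FZ r z t : F (r *:: z) t = r * F z t.
  apply: (@eq_of_derive R (F (r *:: z)) (fun t => r * F z t) (fun t => rin (u t) (r *:: z))).
  - by case: (hF (r *:: z)).
  - move=> q; have := (hF z).2 q => d1.
    by apply: is_derive_eq; rewrite rinZr.
  - by rewrite !(hF _).1 mulr0.
have Fb z t : F z t <= `|G t| * nrm z.
  have D q : is_derive q 1 (fun t => nrm z * G t - F z t) (nrm z * nrm (u q) - rin (u q) z).
    by have := hG q => d1; have := (hF z).2 q => d2; apply: is_derive_eq.
  have D' q : is_derive q 1 (fun t => nrm z * G t + F z t) (nrm z * nrm (u q) + rin (u q) z).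
    by have := hG q => d1; have := (hF z).2 q => d2; apply: is_derive_eq.
  have cs q : - (nrm z * nrm (u q)) <= rin (u q) z <= nrm z * nrm (u q).
    by rewrite -ler_norml mulrC CauchySchwarz.
  have [t0|t0] := leP 0 t.
    have D0 q : 0 <= q <= t -> 0 <= nrm z * nrm (u q) - rin (u q) z.
      by have /andP[] := cs q; lra.
    have := derive_le t0 D D0; rewrite G0 (hF z).1 mulr0 subr0.
    rewrite subr_ge0 => /le_trans; apply; rewrite mulrC ler_wpM2r ?nrm_ge0//.
    exact: ler_norm.
  have D0 q : t <= q <= 0 -> 0 <= nrm z * nrm (u q) + rin (u q) z.
    by have /andP[] := cs q; lra.
  have := derive_le (ltW t0) D' D0; rewrite G0 (hF z).1 mulr0 addr0 => h.
  apply: (@le_trans _ _ (- (nrm z * G t))); first by lra.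
  by rewrite -mulrN mulrC ler_wpM2r ?nrm_ge0// -normrN ler_norm.
have /choice[w hw] t : exists x, forall z, F z t = rin x z.
  exact: (@real_riesz _ _ _ (F^~ t) `|G t|).
exists w; split.
  by apply: rin_inj => z; rewrite -hw (hF z).1 rin0l.
move=> z t; have -> : (fun t => rin (w t) z) = F z by apply/funext => q; rewrite -hw.
exact: (hF z).2.
Qed.

(** The mean value inequality applied to [w q - q u(t)], whose weak derivative
    [u q - u t] is small near [t]. *)
Lemma wderiv_sderiv w u t : wderiv w u -> {for t, continuous u} -> sderiv w t (u t).
Proof.
move=> wu cu; apply/cvg_nrm => e e0.
have e20 : 0 < e / 2 by rewrite divr_gt0.
have /cvg_nrm/(_ _ e20) := cu; rewrite near_nbhs => -[/= r r0 hr].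
near=> h.
have h0 : h != 0 by near: h; exact: nbhs_dnbhs_neq.
have hr1 : `|h| < r by near: h; apply: dnbhs0_lt; exact: r0.
pose wt q := w q - q *:: u t.
have wtD : wderiv wt (fun q => u q - u t).
  move=> z q; have := wu z q => d1.
  have -> : (fun q => rin (wt q) z) = (fun q => rin (w q) z - rin (u t) z * q).
    by apply/funext => p; rewrite /wt !rinE; ring.
  by apply: is_derive_eq; rewrite !rinE /GRing.scale /= mulr1.
have GD (c : R) q : is_derive q 1 (fun q => c * q) c.
  by apply: is_derive_eq; rewrite /GRing.scale /= mulr1.
have bnd q : `|q - t| < r -> nrm (u q - u t) <= e / 2.
  by move=> qt; apply/ltW/hr; rewrite /ball_ /= distrC.
have E : h^-1 *:: (w (t + h) - w t) - u t = h^-1 *:: (wt (t + h) - wt t).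
  by apply: rin_inj => z; rewrite /wt !rinE; field.
rewrite E nrm_sZ; apply: (@le_lt_trans _ _ (e / 2)); last by lra.
rewrite normfV ler_pdivrMl ?normr_gt0//.
have [hp|hn] := leP 0 h.
  rewrite ger0_norm//.
  have -> : h * (e / 2) = e / 2 * (t + h) - e / 2 * t by ring.
  apply: (@mean_value_ineq wt _ (fun q => e / 2 * q) (fun=> e / 2) _ _ _ wtD) => //.
    by rewrite lerDl.
  move=> q /andP[q1 q2]; apply: bnd; apply: le_lt_trans hr1.
  by rewrite !ger0_norm ?subr_ge0// lerBlDl.
rewrite ltr0_norm// nrmBC.
have -> : - h * (e / 2) = e / 2 * t - e / 2 * (t + h) by ring.
apply: (@mean_value_ineq wt _ (fun q => e / 2 * q) (fun=> e / 2) _ _ _ wtD) => //.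
  by rewrite gerDl ltW.
move=> q /andP[q1 q2]; apply: bnd; apply: le_lt_trans hr1.
by rewrite (ltr0_norm hn) ler0_norm ?subr_le0//; lra.
Unshelve. all: by end_near. Qed.

Lemma sderiv_is_derive w t d z : sderiv w t d ->
  is_derive t 1 (fun t => rin (w t) z) (rin d z).
Proof.
move=> wd; apply/is_derive1P.
have -> : (fun h => h^-1 * (rin (w (t + h)) z - rin (w t) z)) =
    (fun h => rin (h^-1 *:: (w (t + h) - w t)) z).
  by apply/funext => h; rewrite rinZl rinBl.
by apply: cvg_rin => //; exact: cvg_cst.
Qed.

Lemma sderiv_wderiv w u : (forall t, sderiv w t (u t)) -> wderiv w u.
Proof. by move=> wu z t; exact: sderiv_is_derive. Qed.

Lemma sderiv_bop {V : hilbertType R s} (T : bop H V) w t d : sderiv w t d ->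
  h^-1 *:: (T (w (t + h)) - T (w t)) @[h --> 0^'] --> T d.
Proof.
move=> /cvg_nrm wd; apply/cvg_nrm => e e0.
have K0 : 0 < opnorm T + 1 by rewrite ltr_wpDl ?opnorm_ge0.
have := wd _ (divr_gt0 e0 K0); apply: filterS => h hh.
rewrite -bopBr -bop_sZ -bopBr (le_lt_trans (le_opnorm _ _))//.
apply: (@le_lt_trans _ _ ((opnorm T + 1) * nrm (h^-1 *:: (w (t + h) - w t) - d))).
  by rewrite ler_wpM2r ?nrm_ge0// lerDl.
by rewrite mulrC -ltr_pdivlMr.
Qed.

Lemma sderiv_continuous w t d : sderiv w t d -> {for t, continuous w}.
Proof.
move=> /cvg_nrm wd; apply/cvg_nrm => e e0.
have := wd _ ltr01; rewrite near_withinE => -[/= r r0 hr].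
have K0 : 0 < nrm d + 1 by rewrite ltr_wpDl ?nrm_ge0.
pose q := Num.min r (e / (nrm d + 1)).
have q0 : 0 < q by rewrite lt_min r0 divr_gt0.
exists q => //= p; rewrite /ball_ /= distrC => pt.
have [->|pt0] := eqVneq p t; first by rewrite subrr nrm0.
have pt1 : p - t != 0 by rewrite subr_eq0.
have qr : q <= r by rewrite ge_min lexx.
have := hr (p - t); rewrite /ball_ /= sub0r normrN.
move=> /(_ (lt_le_trans pt qr) pt1).
rewrite subrKC => hh.
have : nrm ((p - t)^-1 *:: (w p - w t)) < nrm d + 1.
  rewrite -[X in nrm X](subrK d); apply: le_lt_trans (ler_nrmD _ _) _.
  by rewrite addrC ltrD2l.
rewrite nrm_sZ normfV ltr_pdivrMl ?normr_gt0// => /lt_le_trans; apply.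
rewrite -ler_pdivlMr// ltW// (lt_le_trans pt)// ge_min lexx orbT//.
Qed.

Lemma is_derive_rin w v t d e : sderiv w t d -> sderiv v t e ->
  is_derive t 1 (fun t => rin (w t) (v t)) (rin d (v t) + rin (w t) e).
Proof.
move=> wd ve; apply/is_derive1P.
have -> : (fun h => h^-1 * (rin (w (t + h)) (v (t + h)) - rin (w t) (v t))) =
    (fun h => rin (h^-1 *:: (w (t + h) - w t)) (v (t + h)) +
              rin (w t) (h^-1 *:: (v (t + h) - v t))).
  by apply/funext => h; rewrite !rinE; ring.
apply: cvgD; apply: cvg_rin => //; last exact: cvg_cst.
have := sderiv_continuous ve => /cvg_nrm cv; apply/cvg_nrm => c c0.
have := cv _ c0; rewrite near_nbhs => -[/= r r0 hr].
near=> h; apply: hr; rewrite /ball_ /= opprD addNKr normrN.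
by near: h; apply: dnbhs0_lt; exact: r0.
Unshelve. all: by end_near. Qed.

End VectorCalculus.

(** * Strongly continuous groups and their bounded perturbations *)

Lemma series_complete {R : realType} {s : scalar_kind}
    (V : completeNormedModType (scalarField R s)) (w : nat -> V) (e : nat -> R) :
  (forall n, nrm (w n.+1 - w n) <= e n) -> cvgn (series e) ->
  exists2 x, w @ \oo --> x &
    forall n, nrm (x - w n) <= limn (series e) - series e n.
Proof.
move=> we ce.
have e0 n : 0 <= e n by apply: le_trans (we n); exact: nrm_ge0.
have nd : nondecreasing_seq (series e).
  by apply/nondecreasing_seqP => n; rewrite /series /= big_nat_recr//= lerDl.
have tele n k : nrm (w (n + k)%N - w n) <= series e (n + k)%N - series e n.
  elim: k => [|k IH]; first by rewrite addn0 !subrr nrm0.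
  rewrite addnS; apply: le_trans (ler_nrm_distD (w (n + k)%N) _ _) _.
  have -> : series e (n + k).+1 = series e (n + k)%N + e (n + k)%N.
    by rewrite /series /= big_nat_recr.
  by have := we (n + k)%N; lra.
have lims n : series e n <= limn (series e) by exact: nondecreasing_cvgn_le.
have tl N n : (N <= n)%N -> nrm (w n - w N) <= limn (series e) - series e N.
  move=> /subnKC <-; apply: le_trans (tele _ _) _.
  by rewrite lerD2r.
have : cvg (w @ \oo).
  apply: nrm_complete => d d0.
  have d20 : 0 < d / 2 by rewrite divr_gt0.
  have /cvgrPdist_lt/(_ _ d20)[N _ HN] := ce.
  exists N => n m Nn Nm.
  apply: le_lt_trans (ler_nrm_distD (w N) _ _) _.
  have := HN N (leqnn N); rewrite /= ger0_norm ?subr_ge0// => h.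
  by have := tl _ _ Nn; have := tl _ _ Nm; rewrite (nrmBC (w N)); lra.
move=> /cvg_ex[x wx]; exists x => // n.
apply/ler_addgt0Pr => d d0; move/cvg_nrm: wx => /(_ _ d0)[N _ HN].
apply: le_trans (ler_nrm_distD (w (maxn N n)) _ _) _.
have := HN (maxn N n) (leq_maxl _ _); rewrite /= nrmBC => /ltW h.
by rewrite addrC lerD// tl// leq_maxr.
Qed.

Lemma continuous_bounded_nrm {R : realType} {s : scalar_kind}
    {V : normedModType (scalarField R s)} (w : R -> V) (tau : R) :
  continuous w -> exists c : R, forall t, `|t| <= tau -> nrm (w t) <= c.
Proof.
move=> cw; have [tau0|tau0] := leP 0 tau; last first.
  by exists 0 => t tt; have := le_lt_trans tt tau0; rewrite ltNge normr_ge0.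
have [||c _ hc] := @EVT_max R (fun t => nrm (w t)) (- tau) tau.
- by rewrite -subr_ge0 opprK addr_ge0.
- by apply: continuous_subspaceT; exact: continuous_nrm.
exists (nrm (w c)) => t; rewrite ler_norml => tt.
by apply: hc; rewrite in_itv.
Qed.

Lemma exp_coeffnE {R : realType} (x : R) n : exp_coeff x n = x ^+ n / n`!%:R.
Proof. by []. Qed.

Lemma exp_coeff_0 {R : realType} (x : R) : exp_coeff x 0 = 1.
Proof. by rewrite exp_coeffnE expr0 fact0 divr1. Qed.

Section StronglyContinuous.
Context {R : realType} {s : scalar_kind} {H : hilbertType R s}.
Implicit Types (x y z : H) (t h r : R) (u v w : R -> H).

(** By the uniform boundedness principle, strong continuity gives local
    boundedness in operator norm. *)
Lemma strong_local_bound (S : R -> bop H H) : (forall x, continuous (fun t => S t x)) ->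
  forall tau : R, exists2 M : R, 0 <= M & forall t, `|t| <= tau -> opnorm (S t) <= M.
Proof.
move=> cS tau.
have [|M hM] := @uniform_boundedness R s H H {t : R | `|t| <= tau} (fun i => S (sval i)).
  move=> x; have [c hc] := continuous_bounded_nrm tau (cS x).
  by exists c => -[t ht]; exact: hc.
exists (Num.max 0 M); first by rewrite le_max lexx.
by move=> t ht; rewrite le_max (hM (exist _ t ht)) orbT.
Qed.

Lemma cvg_strong {T} (F : set_system T) {FF : Filter F} (S : T -> bop H H) (M : R)
    (f : T -> H) x y : (\forall t \near F, opnorm (S t) <= M) ->
  f @ F --> x -> S t x @[t --> F] --> y -> S t (f t) @[t --> F] --> y.
Proof.
move=> SM /cvg_nrm fx /cvg_nrm Sx; apply/cvg_nrm => e e0.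
have K0 : 0 < `|M| + 1 by rewrite ltr_wpDl.
have e20 : 0 < e / 2 by rewrite divr_gt0.
near=> t.
have h1 : opnorm (S t) <= M by near: t.
have h2 : nrm (f t - x) < e / 2 / (`|M| + 1) by near: t; apply: fx; rewrite divr_gt0.
have h3 : nrm (S t x - y) < e / 2 by near: t; exact: Sx.
apply: le_lt_trans (ler_nrm_distD (S t x) _ _) _.
rewrite -bopBr (splitr e); apply: ltrD => //.
apply: le_lt_trans (le_opnorm _ _) _.
move: h2; rewrite ltr_pdivlMr//; apply: le_lt_trans; rewrite mulrC ler_wpM2l ?nrm_ge0//.
by rewrite (le_trans h1)// (le_trans (ler_norm _))// lerDl.
Unshelve. all: by end_near. Qed.

Lemma near_bounded (S : R -> bop H H) t : (forall x, continuous (fun t => S t x)) ->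
  exists M : R, \forall r \near t, opnorm (S r) <= M.
Proof.
move=> cS; have [M _ hM] := strong_local_bound cS (`|t| + 1); exists M.
near=> r; apply: hM; rewrite -(subrK t r) addrC (le_trans (ler_normD _ _))// lerD2l.
by rewrite distrC; near: r; apply: cvgr_dist_le => //; exact: cvg_id.
Unshelve. all: by end_near. Qed.

Lemma continuous_strong (S : R -> bop H H) u : (forall x, continuous (fun t => S t x)) ->
  continuous u -> continuous (fun t => S t (u t)).
Proof.
move=> cS cu t; have [M hM] := near_bounded t cS.
by apply: cvg_strong hM _ _; [exact: cu|exact: cS].
Qed.

Lemma bop_cvg {T} (F : set_system T) {FF : Filter F} (V W : normedModType (scalarField R s))
    (L : bop V W) (f : T -> V) (x : V) :
  f @ F --> x -> L (f t) @[t --> F] --> L x.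
Proof.
move=> /cvg_nrm fx; apply/cvg_nrm => e e0.
have K0 : 0 < opnorm L + 1 by rewrite ltr_wpDl ?opnorm_ge0.
have := fx _ (divr_gt0 e0 K0); apply: filterS => t.
rewrite -bopBr ltr_pdivlMr// mulrC; apply: le_lt_trans.
by rewrite (le_trans (le_opnorm _ _))// ler_wpM2r ?nrm_ge0// lerDl.
Qed.

Lemma continuous_bop {V : normedModType (scalarField R s)} (L : bop H V) u :
  continuous u -> continuous (fun t => L (u t)).
Proof. by move=> cu t; apply: bop_cvg; exact: cu. Qed.

Lemma group_continuous (S : R -> bop H H) : C0_group S ->
  forall x, continuous (fun t => S t x).
Proof.
move=> [S0 SD Sc] x t; apply/cvg_nrm => e e0.
have Sx : S t (S r x) @[r --> (0 : R)] --> S t x by exact: bop_cvg.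
move/cvg_nrm/(_ _ e0): Sx.
rewrite !near_nbhs => -[/= r r0 hr]; exists r => //= p; rewrite /ball_ /= => tp.
rewrite -{1}(subrKC t p) SD; apply: hr.
by rewrite /ball_ /= sub0r normrN distrC.
Qed.

Lemma groupVK (S : R -> bop H H) : C0_group S -> forall t, cancel (S t) (S (- t)).
Proof. by move=> [S0 SD Sc] t x; rewrite -SD addNr S0. Qed.

Lemma wderiv_comp w u (a b : R) : wderiv w u ->
  wderiv (fun t => w (a * t + b)) (fun t => a *:: u (a * t + b)).
Proof.
move=> wu z t; rewrite rinZl mulrC.
have D : is_derive t 1 (fun t => a * t + b) a.
  by apply: is_derive_eq; rewrite /GRing.scale /= mulr1 addr0.
exact: (@is_derive1_comp R (fun t => rin (w t) z) (fun t => a * t + b)).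
Qed.

Lemma eq_wderiv w u u' : (forall t, u t = u' t) -> wderiv w u -> wderiv w u'.
Proof. by move=> uu wu z t; rewrite -uu. Qed.

Lemma wderivD w u w' u' : wderiv w u -> wderiv w' u' ->
  wderiv (fun t => w t + w' t) (fun t => u t + u' t).
Proof.
move=> wu wu' z t; have := wu z t => d1; have := wu' z t => d2.
have -> : (fun t => rin (w t + w' t) z) = (fun t => rin (w t) z + rin (w' t) z).
  by apply/funext => r; rewrite rinDl.
by apply: is_derive_eq; rewrite rinDl.
Qed.

Lemma wderiv_bop (L : bop H H) w u : wderiv w u ->
  wderiv (fun t => L (w t)) (fun t => L (u t)).
Proof.
move=> wu z t; have -> : (fun t => rin (L (w t)) z) = (fun t => rin (w t) (adj L z)).
  by apply/funext => r; rewrite rin_adj.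
by rewrite rin_adj; exact: wu.
Qed.

Lemma wderivZ (a : scalarField R s) w u : wderiv w u ->
  wderiv (fun t => a *: w t) (fun t => a *: u t).
Proof.
move=> wu z t; have -> : (fun t => rin (a *: w t) z) = (fun t => rin (w t) (sconj a *: z)).
  by apply/funext => r; rewrite rin_sconj.
by rewrite rin_sconj; exact: wu.
Qed.

Lemma wderivB w u w' u' : wderiv w u -> wderiv w' u' ->
  wderiv (fun t => w t - w' t) (fun t => u t - u' t).
Proof.
move=> wu /(wderivZ (- 1)) wu'; have := wderivD wu wu'.
have -> : (fun t => w t + -1 *: w' t) = (fun t => w t - w' t).
  by apply/funext => r; rewrite scaleN1r.
by apply: eq_wderiv => t; rewrite scaleN1r.
Qed.

Lemma wderiv_cst x : wderiv (fun=> x) (fun=> 0).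
Proof. by move=> z t; rewrite rin0l; exact: is_derive_cst. Qed.

Lemma wderiv_continuous w u : continuous u -> wderiv w u -> continuous w.
Proof. by move=> cu wu t; apply: (sderiv_continuous (wderiv_sderiv wu (cu t))). Qed.

(** The gain of a factor [|t| / (n + 1)] that drives the Picard iteration. *)
Lemma wderiv_exp_bound w u (c q tau : R) n : 0 <= c -> 0 <= q ->
  w 0 = 0 -> wderiv w u ->
  (forall t, `|t| <= tau -> nrm (u t) <= q * (c * exp_coeff (q * `|t|) n)) ->
  forall t, `|t| <= tau -> nrm (w t) <= c * exp_coeff (q * `|t|) n.+1.
Proof.
move=> c0 q0.
have G (t : R) : is_derive t 1 (fun t => c * exp_coeff (q * t) n.+1)
    (q * (c * exp_coeff (q * t) n)).
  pose k : R := c * q ^+ n.+1 / n.+1`!%:R.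
  have -> : (fun t => c * exp_coeff (q * t) n.+1) = (fun t => k * t ^+ n.+1).
    by apply/funext => r; rewrite exp_coeffnE /k exprMn; ring.
  have -> : q * (c * exp_coeff (q * t) n) = k * (n.+1%:R * t ^+ n).
    have f0 : n`!%:R != 0 :> R by rewrite pnatr_eq0 -lt0n fact_gt0.
    have n0 : n.+1%:R != 0 :> R by rewrite pnatr_eq0.
    rewrite /k factS natrM exp_coeffnE exprMn exprS.
    by move: (n.+1%:R) (n`!%:R) n0 f0 => a b a0 b0; field; rewrite a0 b0.
  have d : is_derive t 1 (fun t : R => t ^+ n.+1) (n.+1%:R * t ^+ n).
    by split; [exact: exprn_derivable|rewrite exp_derive [LHS]mulr1].
  exact: (is_deriveZ k d).
have pos w' u' : w' 0 = 0 -> wderiv w' u' ->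
  (forall t, `|t| <= tau -> nrm (u' t) <= q * (c * exp_coeff (q * `|t|) n)) ->
  forall t, 0 <= t -> t <= tau -> nrm (w' t) <= c * exp_coeff (q * t) n.+1.
  move=> w0 wu ub t t0 tt.
  have := @mean_value_ineq _ _ _ w' u' _ _ 0 t t0 wu G.
  rewrite w0 subr0 (exp_coeffnE (q * 0)) mulr0 expr0n /= mul0r mulr0 subr0; apply => r /andP[r0 rt].
  by have := ub r; rewrite ger0_norm//; apply; exact: le_trans tt.
move=> w0 wu ub t tt; have [t0|t0] := leP 0 t.
  by rewrite ger0_norm//; apply: pos ub _ _ _ => //; rewrite -(ger0_norm t0).
have := @pos (fun t => w (-1 * t + 0)) (fun t => -1 *:: u (-1 * t + 0)) _ _ _ (- t).
have -> : -1 * - t + 0 = t by rewrite mulrNN mul1r addr0.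
rewrite (ltr0_norm t0); apply.
- by rewrite mulr0 addr0.
- exact: wderiv_comp.
- by move=> r rt; rewrite nrm_sZ normrN1 mul1r mulN1r addr0 -(normrN r) ub// normrN.
- by rewrite oppr_ge0 ltW.
- by rewrite -(ltr0_norm t0).
Qed.

Section NonautonomousODE.
Variable Q : R -> bop H H.
Hypothesis cQ : forall x, continuous (fun t => Q t x).

(** The difference of two solutions is bounded by every term of an
    exponential series. *)
Lemma ode_unique w v : continuous w -> continuous v ->
  wderiv w (fun t => Q t (w t)) -> wderiv v (fun t => Q t (v t)) ->
  w 0 = v 0 -> w =1 v.
Proof.
move=> cw cv wQ vQ wv t; apply/eqP; rewrite -subr_eq0; apply/eqP/nrm0_eq0/eqP.
have dQ : wderiv (fun t => w t - v t) (fun t => Q t (w t - v t)).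
  by apply: eq_wderiv (wderivB wQ vQ) => r; rewrite bopBr.
have [q q0 hq] := strong_local_bound cQ `|t|.
have cd : continuous (fun t => w t - v t).
  by move=> r; apply: cvgB; [exact: cw|exact: cv].
have [c hc] := continuous_bounded_nrm `|t| cd.
have c0 : 0 <= c by apply: le_trans (nrm_ge0 _) (hc t _).
have B n r : `|r| <= `|t| -> nrm (w r - v r) <= c * exp_coeff (q * `|r|) n.
  elim: n r => [|n IH] r rt.
    by rewrite exp_coeff_0 mulr1 hc.
  apply: (@wderiv_exp_bound _ _ c q `|t| n c0 q0 _ dQ) => //.
    by rewrite wv subrr.
  move=> p pt; apply: le_trans (le_opnorm _ _) _.
  by apply: ler_pM; rewrite ?opnorm_ge0 ?nrm_ge0 ?hq ?IH.
rewrite eq_le nrm_ge0 andbT.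
have lim0 : (fun n => c * exp_coeff (q * `|t|) n) @ \oo --> c * 0.
  by apply: cvgM; [exact: cvg_cst|exact: cvg_exp_coeff].
rewrite mulr0 in lim0.
apply: (ler_cvg_to (cvg_cst (nrm (w t - v t))) lim0).
by near=> n; exact: B.
Unshelve. all: by end_near. Qed.

(** Picard iteration; the bound on the solution is the one that makes the
    solution operators bounded in [bounded_perturbation]. *)
Lemma ode_ex y : exists w, [/\ continuous w, w 0 = y, wderiv w (fun t => Q t (w t)) &
  forall tau q : R, 0 <= tau -> 0 <= q -> (forall t, `|t| <= tau -> opnorm (Q t) <= q) ->
    forall t, `|t| <= tau -> nrm (w t) <= expR (q * tau) * nrm y].
Proof.
(* A choice of primitives, total in the curve so that it can be iterated. *)
have /choice[P hP] : forall u, exists w, continuous u -> w 0 = 0 /\ wderiv w u.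
  move=> u; have [cu|ncu] := pselect (continuous u); last by exists u.
  by have [w hw] := vprimitive_ex cu; exists w.
pose Qw w t := Q t (w t).
have cQw w : continuous w -> continuous (Qw w) by exact: continuous_strong.
have [w [w0 wS]] : exists w : nat -> R -> H, (forall t, w 0%N t = 0) /\
    forall n t, w n.+1 t = y + P (Qw (w n)) t.
  by exists (fix w n := if n is k.+1 then fun t => y + P (Qw (w k)) t else fun=> 0).
have cw n : continuous (w n).
  elim: n => [|n IH]; first by rewrite (funext w0) => t; exact: cvg_cst.
  rewrite (funext (wS n)).
  have [_ d] := hP _ (cQw _ IH) => t.
  by apply: cvgD; [exact: cvg_cst|exact: (wderiv_continuous (cQw _ IH) d)].
have diff (tau q : R) : 0 <= tau -> 0 <= q -> (forall t, `|t| <= tau -> opnorm (Q t) <= q) ->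
    forall n t, `|t| <= tau -> nrm (w n.+1 t - w n t) <= nrm y * exp_coeff (q * `|t|) n.
  move=> tau0 q0 hq; elim=> [|n IH] t tt.
    rewrite wS w0 subr0 exp_coeff_0 mulr1.
    have [P0 dP] := hP _ (cQw _ (cw 0%N)).
    have -> : P (Qw (w 0%N)) t = 0; last by rewrite addr0.
    apply: (@eq_of_wderiv _ _ _ _ (fun=> 0) (fun=> 0)) => //; last exact: wderiv_cst.
    by apply: eq_wderiv dP => r; rewrite /Qw w0 bop0r.
  have [P1 dP1] := hP _ (cQw _ (cw n.+1)); have [P0 dP0] := hP _ (cQw _ (cw n)).
  have := @wderiv_exp_bound (fun t => w n.+2 t - w n.+1 t)
    (fun t => Qw (w n.+1) t - Qw (w n) t) (nrm y) q tau n (nrm_ge0 _) q0.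
  apply => //.
  - by rewrite !wS P1 P0 subrr.
  - have := wderivB dP1 dP0; congr (wderiv _ _).
    by apply/funext => r; rewrite !wS opprD addrACA subrr add0r.
  - move=> r rt; rewrite /Qw -bopBr; apply: le_trans (le_opnorm _ _) _.
    by apply: ler_pM; rewrite ?opnorm_ge0 ?nrm_ge0 ?hq ?IH.
pose e (a : R) n := nrm y * exp_coeff a n.
have se a n : series (e a) n = nrm y * series (exp_coeff a) n.
  by rewrite /series /= mulr_sumr.
have ce a : series (e a) @ \oo --> nrm y * expR a.
  have -> : series (e a) = (fun n => nrm y * series (exp_coeff a) n).
    by apply/funext => n; exact: se.
  by apply: cvgM; [exact: cvg_cst|exact: is_cvg_series_exp_coeff].
have le : forall a, limn (series (e a)) = nrm y * expR a by move=> a; exact/cvg_lim.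
have emono (a b : R) n : 0 <= a -> a <= b -> e a n <= e b n.
  move=> a0 ab; rewrite /e ler_wpM2l ?nrm_ge0// !exp_coeffnE ler_wpM2r ?invr_ge0//.
  by apply: lerXn2r; rewrite ?nnegrE// (le_trans a0).
have wcv (tau q : R) : 0 <= tau -> 0 <= q -> (forall t, `|t| <= tau -> opnorm (Q t) <= q) ->
    forall t, `|t| <= tau -> exists2 x, (fun n => w n t) @ \oo --> x &
      forall n, nrm (x - w n t) <= nrm y * expR (q * tau) - series (e (q * tau)) n.
  move=> tau0 q0 hq t tt; rewrite -le; apply: series_complete.
    move=> n; apply: le_trans (diff tau q tau0 q0 hq n t tt) _.
    by apply: emono; [rewrite mulr_ge0|rewrite ler_wpM2l].
  by apply/cvg_ex; exists (nrm y * expR (q * tau)).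
have /choice[W hW] t : exists x, (fun n => w n t) @ \oo --> x.
  have [q q0 hq] := strong_local_bound cQ `|t|.
  by have [x wx _] := wcv `|t| q (normr_ge0 t) q0 hq t (lexx _); exists x.
have Wcv (tau q : R) : 0 <= tau -> 0 <= q -> (forall t, `|t| <= tau -> opnorm (Q t) <= q) ->
    forall t, `|t| <= tau ->
      forall n, nrm (W t - w n t) <= nrm y * expR (q * tau) - series (e (q * tau)) n.
  move=> tau0 q0 hq t tt; have [x wx hx] := wcv tau q tau0 q0 hq t tt.
  suff -> : W t = x by [].
  exact: cvg_unique (hW t) wx.
have small (a d : R) : 0 < d -> exists n, nrm y * expR a - series (e a) n < d.
  move=> d0; have /cvgrPdist_lt/(_ _ d0)[N _ HN] := ce a.
  by exists N; have := HN N (leqnn N) => /=; apply: le_lt_trans; exact: ler_norm.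
have cW : continuous W.
  move=> t; apply/cvg_nrm => d d0.
  have d30 : 0 < d / 3 by rewrite divr_gt0.
  have tau0 : 0 <= `|t| + 1 by rewrite addr_ge0.
  have [q q0 hq] := strong_local_bound cQ (`|t| + 1).
  have [n hn] := small (q * (`|t| + 1)) _ d30.
  have /cvg_nrm/(_ _ d30) := cw n t => cn.
  near=> r.
  have rt : `|r| <= `|t| + 1.
    rewrite -(subrK t r) addrC (le_trans (ler_normD _ _))// lerD2l.
    by rewrite distrC; near: r; apply: cvgr_dist_le => //; exact: cvg_id.
  have tt : `|t| <= `|t| + 1 by rewrite lerDl.
  have h1 := Wcv _ _ tau0 q0 hq r rt n.
  have h2 := Wcv _ _ tau0 q0 hq t tt n.
  have h3 : nrm (w n r - w n t) < d / 3 by near: r.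
  apply: le_lt_trans (ler_nrm_distD (w n r) _ _) _.
  have h4 := ler_nrm_distD (w n t) (w n r) (W t).
  rewrite (nrmBC (w n t)) in h4.
  by lra.
(* The limit satisfies the integral equation: both sides are close to the
   iterate [w n.+1 t]. *)
have WE t : W t = y + P (Qw W) t.
  have [PW dPW] := hP _ (cQw _ cW).
  apply/eqP; rewrite -subr_eq0; apply/eqP/nrm0_eq0/eqP; rewrite eq_le nrm_ge0 andbT.
  apply/ler_addgt0Pr => d d0; rewrite add0r.
  have [q q0 hq] := strong_local_bound cQ `|t|.
  have K0 : 0 < 1 + q * `|t| by rewrite ltr_pwDl// mulr_ge0.
  have [n hn] := small (q * `|t|) _ (divr_gt0 d0 K0).
  have e0 m : 0 <= e (q * `|t|) m by rewrite mulr_ge0 ?nrm_ge0 ?exp_coeff_ge0// mulr_ge0.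
  have sS : series (e (q * `|t|)) n <= series (e (q * `|t|)) n.+1.
    by rewrite /series /= big_nat_recr//= lerDl.
  pose k := d / (1 + q * `|t|).
  have k0 : 0 <= k by rewrite ltW// divr_gt0.
  have h1 : nrm (W t - w n.+1 t) <= k.
    apply: le_trans (Wcv _ _ (normr_ge0 t) q0 hq t (lexx _) n.+1) _.
    by rewrite /k; lra.
  have [P0 dP0] := hP _ (cQw _ (cw n)).
  have h2 : nrm (P (Qw (w n)) t - P (Qw W) t) <= k * exp_coeff (q * `|t|) 1.
    apply: (@wderiv_exp_bound (fun t => P (Qw (w n)) t - P (Qw W) t) _ k q `|t| 0%N k0 q0 _
      (wderivB dP0 dPW)) => //; first by rewrite P0 PW subrr.
    move=> r rt; rewrite exp_coeff_0 mulr1 /Qw -bopBr.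
    apply: le_trans (le_opnorm _ _) _.
    apply: ler_pM; rewrite ?opnorm_ge0 ?nrm_ge0 ?hq// nrmBC.
    by apply: le_trans (Wcv _ _ (normr_ge0 t) q0 hq r rt n) _; exact: ltW.
  rewrite exp_coeffnE expr1 divr1 in h2.
  have -> : W t - (y + P (Qw W) t) = (W t - w n.+1 t) + (P (Qw (w n)) t - P (Qw W) t).
    by rewrite wS addrA opprD; rewrite (opprD y); rewrite !addrA subrK.
  apply: le_trans (ler_nrmD _ _) _.
  have -> : d = k + k * (q * `|t|) by rewrite /k; field; rewrite gt_eqF.
  exact: lerD.
have [PW dPW] := hP _ (cQw _ cW).
exists W; split=> //.
- by rewrite WE PW addr0.
- have := wderivD (wderiv_cst y) dPW; rewrite -(funext WE).
  by apply: eq_wderiv => t; rewrite add0r.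
move=> tau q tau0 q0 hq t tt; have := Wcv tau q tau0 q0 hq t tt 0%N.
by rewrite w0 subr0 /series /= big_geq// subr0 mulrC.
Unshelve. all: by end_near. Qed.

End NonautonomousODE.

(** In the interaction picture, [W = S(-t) G(t)] for the perturbed group [G]
    solves a linear equation with bounded coefficients [S(-t) Q S(t)]. The
    conclusion compares difference quotients, so that it says at once that the
    two generators have the same domain and differ by [Q]. *)
Theorem bounded_perturbation (S : R -> bop H H) (Q : bop H H) : C0_group S ->
  exists2 G : R -> bop H H, C0_group G &
    forall y, (h^-1 *:: (G h y - y) - h^-1 *:: (S h y - y)) @[h --> 0^'] --> Q y.
Proof.
move=> gS; have cS := group_continuous gS; have [S0 SD _] := gS.
pose q t : bop H H := bop_comp (S (- t)) (bop_comp Q (S t)).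
have cSN x : continuous (fun t => S (- t) x).
  by move=> t; apply: (cvg_comp _ (fun t => S t x) (cvgN cvg_id)); exact: cS.
have cq x : continuous (fun t => q t x).
  apply: (@continuous_strong (fun t => S (- t)) (fun t => Q (S t x))) => //.
  exact: continuous_bop.
have /choice[W hW] y := ode_ex cq y.
have WD t x y : W (x + y) t = W x t + W y t.
  have [c1 i1 d1 _] := hW (x + y); have [c2 i2 d2 _] := hW x; have [c3 i3 d3 _] := hW y.
  apply: (ode_unique cq c1 (v := fun t => W x t + W y t) _ d1).
  - by move=> r; apply: cvgD; [exact: c2|exact: c3].
  - by apply: eq_wderiv (wderivD d2 d3) => r; rewrite bopDr.
  - by rewrite i1 i2 i3.
have WZ t a x : W (a *: x) t = a *: W x t.
  have [c1 i1 d1 _] := hW (a *: x); have [c2 i2 d2 _] := hW x.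
  apply: (ode_unique cq c1 (v := fun t => a *: W x t) _ d1).
  - by move=> r; apply: cvgZr; exact: c2.
  - by apply: eq_wderiv (wderivZ a d2) => r; rewrite bopZr.
  - by rewrite i1 i2.
have Wb t : bounded_op (W^~ t).
  have [p p0 hp] := strong_local_bound cq `|t|.
  apply: (@bounded_opP _ _ _ _ _ (expR (p * `|t|))) => //.
  by move=> x; have [_ _ _] := hW x; apply=> //; exact: normr_ge0.
pose G t := bop_comp (S t) (mkbop (Wb t)).
have GE t x : G t x = S t (W x t) by [].
exists G; first split.
- by move=> x; rewrite GE S0; case: (hW x).
- move=> t r x; rewrite !GE SD; congr (S t _).
  have [c1 i1 d1 _] := hW x; have [c2 i2 d2 _] := hW (S r (W x r)).
  (* The group law is uniqueness for the equation started at time [r]. *)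
  have := @ode_unique q cq (W (S r (W x r))) (fun t => S r (W x (1 * t + r))).
  move=> /(_ c2 _ d2) E.
  have -> : t + r = 1 * t + r by rewrite mul1r.
  apply/esym; apply: E.
  + move=> p; apply: bop_cvg; apply: (cvg_comp _ (fun t => W x t)); last exact: c1.
    by apply: cvgD; [apply: cvgM; [exact: cvg_cst|exact: cvg_id]|exact: cvg_cst].
  + apply: eq_wderiv (wderiv_bop (S r) (wderiv_comp 1 r d1)) => p.
    rewrite (sreal1 s) scale1r mul1r /q /=.
    by rewrite -!SD opprD addrCA subrr addr0.
  + by rewrite i2 mulr0 add0r.
- move=> x; have [c1 i1 d1 _] := hW x.
  have := @continuous_strong S (W x) cS c1 0.
  by rewrite /continuous_at S0 i1.
move=> y; have [c1 i1 d1 _] := hW y.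
have cqW : continuous (fun t => q t (W y t)) by exact: continuous_strong.
have := wderiv_sderiv d1 (cqW 0); rewrite /sderiv i1 /q /= oppr0 !S0 => dW.
have -> : (fun h => h^-1 *:: (G h y - y) - h^-1 *:: (S h y - y)) =
    (fun h => S h (h^-1 *:: (W y (0 + h) - y))).
  apply/funext => h; rewrite add0r bop_sZ bopBr -scalerBr GE; congr (_ *: _).
  by rewrite opprB addrA subrK.
have [M hM] := near_bounded 0 cS.
apply: cvg_strong (M) _ _ _ _ dW _; first exact: (cvg_within _ hM).
rewrite -[X in _ --> X]S0; apply: cvg_within_filter; exact: cS.
Qed.

End StronglyContinuous.

(** * Generators, adjoint groups and their domains *)

Lemma eq_fun_cvg {T} {V : nbhsType} (F : set_system T) (f g : T -> V) (l : V) :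
  f =1 g -> f @ F --> l -> g @ F --> l.
Proof. by move=> /funext ->. Qed.

Section Generators.
Context {R : realType} {s : scalar_kind} {H : hilbertType R s}.
Implicit Types (x y z : H) (t h r : R) (a : scalarField R s) (S : R -> bop H H).

(** The graph of the generator. As a relation it avoids choosing values outside
    the domain. *)
Definition gen S y z := h^-1 *:: (S h y - y) @[h --> 0^'] --> z.

Lemma gen_orbit S y z t : C0_group S -> gen S y z -> sderiv (fun t => S t y) t (S t z).
Proof.
move=> [S0 SD Sc] yz; rewrite /sderiv.
have -> : (fun h => h^-1 *:: (S (t + h) y - S t y)) =
    (fun h => S t (h^-1 *:: (S h y - y))).
  by apply/funext => h; rewrite SD bop_sZ bopBr.
exact: bop_cvg.
Qed.

Lemma gen_invariant S y z t : C0_group S -> gen S y z -> gen S (S t y) (S t z).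
Proof.
move=> gS yz; have := @gen_orbit S y z t gS yz; case: gS => [S0 SD Sc].
by apply: eq_fun_cvg => h; rewrite (addrC t) SD.
Qed.

Lemma gen_comb S a x y x' y' : gen S x x' -> gen S y y' ->
  gen S (a *: x + y) (a *: x' + y').
Proof.
move=> gx gy; rewrite /gen.
have -> : (fun h => h^-1 *:: (S h (a *: x + y) - (a *: x + y))) =
    (fun h => a *: (h^-1 *:: (S h x - x)) + h^-1 *:: (S h y - y)).
  apply/funext => h; rewrite bopDr bopZr opprD addrACA -scalerBr scalerDr.
  by rewrite !scalerA mulrC.
by apply: cvgD => //; apply: cvgZr.
Qed.

Lemma gen0 S : gen S 0 0.
Proof.
rewrite /gen; have -> : (fun h => h^-1 *:: (S h 0 - 0)) = (fun=> 0 : H).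
  by apply/funext => h; rewrite bop0r subrr scaler0.
exact: cvg_cst.
Qed.

Lemma genZ S a x x' : gen S x x' -> gen S (a *: x) (a *: x').
Proof. by move=> gx; have := gen_comb (a := a) gx (gen0 S); rewrite !addr0. Qed.

Lemma generatesP S (A : unbounded H H) : generates 0^' S A ->
  forall x z, gen S x z <-> dom A x /\ A x = z.
Proof.
move=> [domA limA] x z; split=> [xz|[Dx <-]]; last exact: limA.
have Dx : dom A x by apply/domA/cvg_ex; exists z.
by split=> //; apply: cvg_unique (limA x Dx) xz.
Qed.

Lemma gen_reverse S y z : gen S y z -> gen (fun t => S (- t)) y (- z).
Proof.
move=> /cvg_nrm yz; apply/cvg_nrm => e /yz; rewrite !near_withinE => -[/= r r0 hr].
exists r => //= h; rewrite /ball_ /= sub0r normrN => hr1 h0.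
have := hr (- h); rewrite /ball_ /= sub0r opprK oppr_eq0 => /(_ hr1 h0).
by rewrite invrN srealN scaleNr -nrmN opprD opprK.
Qed.

Lemma reverse_group S : C0_group S -> C0_group (fun t => S (- t)).
Proof.
move=> gS; have cS := group_continuous gS; case: gS => S0 SD Sc; split.
- by move=> x; rewrite oppr0.
- by move=> t r x; rewrite opprD.
move=> x; have c : continuous (fun t => S (- t) x).
  by move=> t; apply: (cvg_comp _ (fun t => S t x) (cvgN cvg_id)); exact: cS.
by have := c 0; rewrite /continuous_at oppr0 S0.
Qed.

(** The orbit integrals [V h x], over [0 <= r <= h], of [S(r) x]. They lie in
    the domain of the generator and approximate [h x], whence all density
    statements below. *)
Section OrbitIntegral.
Variable S : R -> bop H H.
Hypothesis gS : C0_group S.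

Lemma orbit_integral_ex : exists V : R -> bop H H,
  forall x, V 0 x = 0 /\ wderiv (fun t => V t x) (fun t => S t x).
Proof.
have cS := group_continuous gS.
have /choice[V hV] x := vprimitive_ex (cS x).
have Vb t : bounded_op (V^~ t).
  have [M M0 hM] := strong_local_bound cS `|t|.
  apply: (@bounded_opP _ _ _ _ _ (M * `|t|)).
  - move=> x y; have [x0 dx] := hV x; have [y0 dy] := hV y; have [xy0 dxy] := hV (x + y).
    apply: (eq_of_wderiv (v := fun t => V x t + V y t) t dxy).
      by apply: eq_wderiv (wderivD dx dy) => r; rewrite bopDr.
    by rewrite x0 y0 xy0 addr0.
  - move=> a x; have [x0 dx] := hV x; have [ax0 dax] := hV (a *: x).
    apply: (eq_of_wderiv (v := fun t => a *: V x t) t dax).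
      by apply: eq_wderiv (wderivZ a dx) => r; rewrite bopZr.
    by rewrite x0 ax0 scaler0.
  move=> x; have [x0 dx] := hV x.
  have := @wderiv_exp_bound _ _ _ (V x) _ (M * nrm x) 1 `|t| 0 _ ler01 x0 dx _ t (lexx _).
  rewrite exp_coeffnE expr1 divr1 mul1r mulrAC; apply; first by rewrite mulr_ge0 ?nrm_ge0.
  move=> r rt; rewrite exp_coeff_0 mulr1 mul1r (le_trans (le_opnorm _ _))//.
  by rewrite ler_wpM2r ?nrm_ge0// hM.
by exists (fun t => mkbop (Vb t)).
Qed.

Variable V : R -> bop H H.
Hypothesis V0 : forall x, V 0 x = 0.
Hypothesis Vd : forall x, wderiv (fun t => V t x) (fun t => S t x).

Lemma gen_orbit_integral h x : gen S (V h x) (S h x - x).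
Proof.
have cS := group_continuous gS; have [S0 SD _] := gS.
have E r : S r (V h x) = V (h + r) x - V r x.
  apply: (@eq_of_wderiv _ _ _ (fun h => S r (V h x)) (fun h => V (h + r) x - V r x)
    (fun h => S r (S h x))).
  - exact: wderiv_bop.
  - have := wderivB (wderiv_comp 1 r (Vd x)) (wderiv_cst (V r x)).
    have -> : (fun t => V (1 * t + r) x - V r x) = (fun h => V (h + r) x - V r x).
      by apply/funext => t; rewrite mul1r.
    apply: eq_wderiv => t.
    by rewrite subr0 (sreal1 s) scale1r mul1r addrC SD.
  - by rewrite V0 bop0r add0r subrr.
rewrite /gen.
have -> : (fun r => r^-1 *:: (S r (V h x) - V h x)) =
    (fun r => r^-1 *:: (V (h + r) x - V h x) - r^-1 *:: (V (0 + r) x - V 0 x)).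
  by apply/funext => r; rewrite E V0 add0r subr0 -scalerBr addrAC.
apply: cvgB; first exact: (wderiv_sderiv (Vd x) (cS x h)).
by have := wderiv_sderiv (Vd x) (cS x 0); rewrite /sderiv S0.
Qed.

Lemma orbit_integral_gen h x x' : gen S x x' -> V h x' = S h x - x.
Proof.
move=> xx'; have [S0 SD _] := gS.
apply: (@eq_of_wderiv _ _ _ (fun h => V h x') (fun h => S h x - x) (fun h => S h x')).
- exact: Vd.
- have d : wderiv (fun t => S t x) (fun t => S t x').
    by apply: sderiv_wderiv => t; exact: gen_orbit.
  by apply: eq_wderiv (wderivB d (wderiv_cst x)) => t; rewrite subr0.
- by rewrite V0 S0 subrr.
Qed.

(** The derivative of [rin (V h x) y] at [h = 0] is [rin x y]. *)
Lemma orbit_integral_orthogonal x y : (forall h, rin (V h x) y = 0) -> rin x y = 0.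
Proof.
move=> Vxy; have [S0 _ _] := gS; have := Vd x y 0; rewrite S0.
have -> : (fun t => rin (V t x) y) = cst 0 by apply/funext.
move=> d; have := is_derive_cst (0 : R) (0 : R) (1 : R) => d'.
by rewrite -(derive_val (is_derive := d)) derive_val.
Qed.

Lemma orbit_integral_inj x : (forall h, V h x = 0) -> x = 0.
Proof.
move=> Vx; apply: rin_inj => z; rewrite rin0l.
by apply: orbit_integral_orthogonal => h; rewrite Vx rin0l.
Qed.

End OrbitIntegral.

(** The adjoint group on [H] instead of its dual. In a Hilbert space it is
    strongly continuous, because its generator is densely defined. *)
Section AdjointGroup.
Variables (S : R -> bop H H) (A : unbounded H H).
Hypotheses (gS : C0_group S) (genA : generates 0^' S A).

Definition Sd t : bop H H := adj (S t).
Definition Dd : set H := [set y | dom (adjoint A) (rd y)].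
Definition Ad y : H := riesz (adjoint A (rd y)).

Lemma rd_Sd t y : adjoint_group S t (rd y) = rd (Sd t y).
Proof. by rewrite rd_adj. Qed.

(** The domain contains the orbit integrals [V h x]; hence the adjoint is single
    valued. *)
Lemma dom_orthogonal y : (forall x, dom A x -> rin x y = 0) -> y = 0.
Proof.
move=> hy; have [V hV] := orbit_integral_ex gS.
have V0 x := (hV x).1; have Vd x := (hV x).2.
suff E x : rin x y = 0 by apply: rin_inj => z; rewrite rinC E rin0l.
apply: (orbit_integral_orthogonal gS Vd) => h.
by apply: hy; have /(generatesP genA)[] := @gen_orbit_integral S gS V V0 Vd h x.
Qed.

Lemma adjoint_unique (f g : dual H) : (forall x, dom A x -> f (A x) = g x) ->
  adjoint A f = g.
Proof.
move=> fg; rewrite /adjoint /=; case: xgetP => [g' _ /= hg|/(_ g) []//].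
rewrite -[LHS]rieszK -[RHS]rieszK; congr rd.
apply/eqP; rewrite -subr_eq0; apply/eqP/dom_orthogonal => x Dx.
rewrite rinBr /rin -!rieszE -raddfB /= -hg// -fg// subrr.
exact: raddf0.
Qed.

Lemma adjointE (f : dual H) x : dom (adjoint A) f -> dom A x ->
  f (A x) = adjoint A f x.
Proof. by move=> [g fg] Dx; rewrite (adjoint_unique fg) fg. Qed.

Lemma Dd_inner y x : Dd y -> dom A x -> inner (A x) y = inner x (Ad y).
Proof. by move=> Dy Dx; rewrite -rdE (adjointE Dy Dx) rieszE. Qed.

Lemma dom_scale a x : dom A x -> dom A (a *: x) /\ A (a *: x) = a *: A x.
Proof. by move=> Dx; apply/(generatesP genA)/genZ; case: genA => _; exact. Qed.

(** Real parts suffice, the domain of [A] being closed under multiplication by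
    scalars. *)
Lemma Dd_intro y z : (forall x, dom A x -> rin (A x) y = rin x z) ->
  Dd y /\ Ad y = z.
Proof.
move=> yz.
have E x : dom A x -> rd y (A x) = rd z x.
  move=> Dx; apply: sRe_inj => a; rewrite !rdE -!innerZl.
  by have [Dax <-] := dom_scale a Dx; exact: yz.
by split; [exists (rd z)|rewrite /Ad (adjoint_unique E) rdK].
Qed.

(** The adjoints of the orbit integrals map into the domain of the adjoint
    generator; their ranges provide the density of that domain. *)
Lemma orbit_integral_adjoint : exists2 Vd : R -> bop H H,
  forall h y, Dd (Vd h y) & forall x, (forall h y, rin x (Vd h y) = 0) -> x = 0.
Proof.
have [V hV] := orbit_integral_ex gS.
have V0 x := (hV x).1; have Vd x := (hV x).2.
exists (fun h => adj (V h)) => [h y|x hx].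
  suff [] : Dd (adj (V h) y) /\ Ad (adj (V h) y) = Sd h y - y by [].
  apply: Dd_intro => x Dx; rewrite -rin_adj.
  have gx : gen S x (A x) by apply/(generatesP genA).
  by rewrite (@orbit_integral_gen S gS V V0 Vd _ _ _ gx) rinBl rinBr rin_adj.
apply: (orbit_integral_inj gS Vd) => h; apply: rin_inj => y.
by rewrite rin_adj hx rin0l.
Qed.

Lemma Dd_comb a x y : Dd x -> Dd y -> Dd (a *: x + y) /\ Ad (a *: x + y) = a *: Ad x + Ad y.
Proof.
move=> Dx Dy; apply: Dd_intro => z Dz.
rewrite !rinDr -(sconjK a) -!rin_sconj; congr (_ + _).
  have [Daz <-] := dom_scale (sconj a) Dz.
  by rewrite /rin Dd_inner.
by rewrite /rin Dd_inner.
Qed.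

Lemma Dd0 : Dd 0.
Proof.
by have [] : Dd 0 /\ Ad 0 = 0 by apply: Dd_intro => x Dx; rewrite !rin0r.
Qed.

Lemma DdZ a x : Dd x -> Dd (a *: x).
Proof. by move=> Dx; have [] := Dd_comb a Dx Dd0; rewrite addr0. Qed.

Lemma DdD x y : Dd x -> Dd y -> Dd (x + y).
Proof. by move=> Dx Dy; have [] := Dd_comb 1 Dx Dy; rewrite scale1r. Qed.

Lemma Dd_dense x (e : R) : 0 < e -> exists2 v, Dd v & nrm (x - v) < e.
Proof.
apply: dense_of_orthogonal.
- exact: Dd0.
- exact: DdD.
- by move=> r y; exact: DdZ.
move=> y hy; have [Vd DV Vinj] := orbit_integral_adjoint.
by apply: Vinj => h z; exact: hy.
Qed.

(** By duality from [S(r) z = z + A V(r) z]. The weak derivative is obtained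
    before strong continuity is known. *)
Lemma Sd_wderiv y : Dd y -> wderiv (fun t => Sd t y) (fun t => Sd t (Ad y)).
Proof.
move=> Dy z t.
have [V hV] := orbit_integral_ex gS.
have V0 x := (hV x).1; have Vd x := (hV x).2.
have E r : rin (Sd r y) z = rin (V r z) (Ad y) + rin z y.
  have /(generatesP genA)[DV AV] := @gen_orbit_integral S gS V V0 Vd r z.
  by rewrite /rin -(Dd_inner Dy DV) AV -raddfD /= -innerDl subrK inner_adj inner_sym sRe_sconj.
have -> : rin (Sd t (Ad y)) z = rin (S t z) (Ad y) by rewrite rinC -rin_adj.
have d := Vd z (Ad y) t.
by rewrite (funext E); apply: is_derive_eq; rewrite addr0.
Qed.

Lemma Sd_bound tau : exists2 M : R, 0 <= M & forall t, `|t| <= tau -> opnorm (Sd t) <= M.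
Proof.
have [M M0 hM] := strong_local_bound (group_continuous gS) tau.
by exists M => // t tt; apply: le_trans (opnorm_adj _) (hM t tt).
Qed.

(** Strong continuity holds on the domain, where orbits are Lipschitz near [0],
    and extends to [H] by density and local boundedness. *)
Lemma Sd_group : C0_group Sd.
Proof.
have [S0 SD _] := gS.
split.
- by move=> x; apply: rin_inj => z; rewrite rinC -rin_adj S0 rinC.
- move=> t r x; apply: rin_inj => z.
  by rewrite ![rin _ z]rinC -!rin_adj addrC SD.
move=> x; apply/cvg_nrm => e e0.
have [M M0 hM] := Sd_bound 1.
have K0 : 0 < M + 2 by rewrite ltr_wpDl.
have d0 : 0 < e / 2 / (M + 2) by rewrite !divr_gt0.
have [v Dv xv] := Dd_dense x d0.
have L t : `|t| <= 1 -> nrm (Sd t v - v) <= M * nrm (Ad v) * `|t|.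
  have w0 : Sd 0 v - v = 0 by apply: rin_inj => z; rewrite rinBl rin0l rinC -rin_adj S0 rinC subrr.
  have dw := wderivB (Sd_wderiv Dv) (wderiv_cst v).
  have := @wderiv_exp_bound _ _ _ (fun t => Sd t v - v) _ (M * nrm (Ad v)) 1 1 0 _ ler01 w0 dw _ t.
  rewrite exp_coeffnE expr1 divr1 mul1r; apply; first by rewrite mulr_ge0 ?nrm_ge0.
  move=> r rt; rewrite exp_coeff_0 mulr1 mul1r subr0 (le_trans (le_opnorm _ _))//.
  by rewrite ler_wpM2r ?nrm_ge0// hM.
have L0 : 0 < M * nrm (Ad v) + 1 by rewrite ltr_wpDl// mulr_ge0 ?nrm_ge0.
near=> t.
have t1 : `|t| <= 1.
  by rewrite -[t]subr0 distrC; near: t; apply: cvgr_dist_le => //; exact: cvg_id.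
have t2 : `|t| <= e / 2 / (M * nrm (Ad v) + 1).
  rewrite -[t]subr0 distrC; near: t; apply: cvgr_dist_le; first exact: cvg_id.
  by rewrite !divr_gt0.
apply: le_lt_trans (ler_nrm_distD v _ _) _; rewrite (nrmBC v).
apply: le_lt_trans (lerD (ler_nrm_distD (Sd t v) _ _) (lexx _)) _.
have h1 : nrm (Sd t x - Sd t v) <= M * nrm (x - v).
  by rewrite -bopBr (le_trans (le_opnorm _ _))// ler_wpM2r ?nrm_ge0// hM.
have h2 := L t t1.
have h3 : M * nrm (Ad v) * `|t| <= e / 2.
  move: t2; rewrite ler_pdivlMr// => t2; apply: le_trans t2; rewrite mulrC.
  by rewrite ler_wpM2l// lerDl.
have h4 : (M + 2) * nrm (x - v) < e / 2 by rewrite mulrC -ltr_pdivlMr.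
have := nrm_ge0 (x - v).
by lra.
Unshelve. all: by end_near. Qed.

(** From left to right, difference quotients are moved across the inner
    product; from right to left, the weak derivative is continuous. *)
Lemma Sd_gen y z : gen Sd y z <-> Dd y /\ Ad y = z.
Proof.
have [S0 _ _] := gS.
split=> [yz|[Dy <-]]; last first.
  have := wderiv_sderiv (Sd_wderiv Dy) (@group_continuous _ _ _ Sd Sd_group (Ad y) 0).
  have [Sd0 _ _] := Sd_group; rewrite Sd0.
  by apply: eq_fun_cvg => h; rewrite add0r Sd0.
apply: Dd_intro => x Dx.
have gx : gen S x (A x) by apply/(generatesP genA).
have l1 : rin (h^-1 *:: (S h x - x)) y @[h --> 0^'] --> rin (A x) y.
  by apply: cvg_rin gx _; exact: cvg_cst.
have l2 : rin x (h^-1 *:: (Sd h y - y)) @[h --> 0^'] --> rin x z.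
  by apply: cvg_rin _ yz; exact: cvg_cst.
have E : (fun h => rin (h^-1 *:: (S h x - x)) y) = (fun h => rin x (h^-1 *:: (Sd h y - y))).
  by apply/funext => h; rewrite !rinE rin_adj.
by rewrite E in l1; exact: cvg_unique l1 l2.
Qed.

End AdjointGroup.
End Generators.

(** * The observation operator and the closed loop *)

Section ObservationOperator.
Context {R : realType} {s : scalar_kind} {H U : hilbertType R s}.
Variables (S : R -> bop H H) (A : unbounded H H) (B : U -> dual H -> (scalarField R s)^o).
Hypotheses (gS : C0_group S) (genA : generates 0^' S A).
Hypothesis hB : bounded_to_dual (adjoint A) B.

(** The operator [B^*], read from [H] to [U] through the Riesz maps. *)
Definition obsop (y : H) : U := riesz (Bstar B (rd y)).

Lemma BstarE (f : dual H) u : dom (adjoint A) f -> Bstar B f u = B u f.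
Proof.
move=> Df; rewrite /Bstar; case: xgetP => [g _ /= -> //|hg].
have [_ Blin [c Bc]] := hB.
have Bf : bounded_op (fun u => B u f).
  split; first by move=> a v w; rewrite Blin.
  exists (c * graph_norm (adjoint A) f) => v.
  by rewrite mulrAC; exact: Bc.
by have := hg (mkbop Bf); case.
Qed.

Lemma obsopE y u : Dd A y -> inner u (obsop y) = B u (rd y).
Proof. by move=> Dy; rewrite -rieszE BstarE. Qed.

Lemma obsop_comb (a : scalarField R s) y z : Dd A y -> Dd A z ->
  obsop (a *: y + z) = a *: obsop y + obsop z.
Proof.
move=> Dy Dz; have [Dayz _] := Dd_comb gS genA a Dy Dz.
apply: rd_inj; apply: bopP => u; rewrite !rdE innerDr innerZr !obsopE//.
have [Bgb _ _] := hB; have [lin _] := Bgb u.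
by rewrite rdD rdZ; exact: lin.
Qed.

Lemma obsopB y z : Dd A y -> Dd A z -> obsop (y - z) = obsop y - obsop z.
Proof.
by move=> Dy Dz; rewrite addrC -scaleN1r obsop_comb// scaleN1r addrC.
Qed.

Lemma obsopZ (a : scalarField R s) y : Dd A y -> obsop (a *: y) = a *: obsop y.
Proof.
move=> Dy; have D0 := Dd0 gS genA.
have E0 : obsop 0 = 0 by rewrite -(subrr 0) obsopB// subrr.
by rewrite -{1}(addr0 (a *: y)) obsop_comb// E0 addr0.
Qed.

Lemma obsop_bound : exists2 c : R, 0 <= c &
  forall y, Dd A y -> nrm (obsop y) <= c * (nrm y + nrm (Ad A y)).
Proof.
have [_ _ [c Bc]] := hB; exists `|c| => // y Dy.
have g1 : graph_norm (adjoint A) (rd y) <= nrm y + nrm (Ad A y).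
  rewrite /graph_norm nrm_rd nrm_riesz -(ger0_norm (addr_ge0 (nrm_ge0 y) (nrm_ge0 _))).
  rewrite -sqrtr_sqr ler_wsqrtr// sqrrD addrAC lerDl mulrn_wge0// mulr_ge0 ?nrm_ge0//.
have g0 : 0 <= graph_norm (adjoint A) (rd y) by exact: sqrtr_ge0.
apply: nrm_le_rin => [|u]; first by rewrite mulr_ge0// addr_ge0 ?nrm_ge0.
rewrite rinC; apply: le_trans (ler_norm _) _; apply: le_trans (ler_norm_sRe _) _.
rewrite obsopE//; apply: le_trans (Bc u _ Dy) _.
rewrite mulrAC ler_wpM2r ?nrm_ge0// (le_trans (ler_norm _))// normrM.
by rewrite (ger0_norm g0) ler_wpM2l.
Qed.

Lemma obsop_continuous (u : R -> H) : continuous u -> (forall t, Dd A (u t)) ->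
  continuous (fun t => Ad A (u t)) -> continuous (fun t => obsop (u t)).
Proof.
move=> cu Du cAu t; apply/cvg_nrm => e e0.
have [c c0 hc] := obsop_bound.
have K0 : 0 < c + 1 by rewrite ltr_wpDl.
have d0 : 0 < e / (c + 1) / 2 by rewrite !divr_gt0.
have /cvg_nrm/(_ _ d0) h1 := cu t; have /cvg_nrm/(_ _ d0) h2 := cAu t.
near=> r.
have m1 : nrm (u r - u t) < e / (c + 1) / 2 by near: r.
have m2 : nrm (Ad A (u r) - Ad A (u t)) < e / (c + 1) / 2 by near: r.
have [Dd1 E] := Dd_comb gS genA (- 1) (Du t) (Du r).
have E1 : -1 *: u t + u r = u r - u t by rewrite scaleN1r addrC.
have E2 : -1 *: Ad A (u t) + Ad A (u r) = Ad A (u r) - Ad A (u t) by rewrite scaleN1r addrC.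
rewrite -obsopB//; rewrite E1 E2 in Dd1 E; apply: le_lt_trans (hc _ Dd1) _; rewrite E.
have m3 : nrm (u r - u t) + nrm (Ad A (u r) - Ad A (u t)) < e / (c + 1).
  by rewrite (splitr (e / (c + 1))) ltrD.
move: m3; rewrite ltr_pdivlMr// mulrC => m3; apply: le_lt_trans m3.
by rewrite ler_wpM2r ?addr_ge0 ?nrm_ge0// lerDl.
Unshelve. all: by end_near. Qed.

Section ClosedLoop.
Variables (P Q L : bop H H) (kappa beta k c2 : R).
Hypotheses (PQ : cancel P Q) (QP : cancel Q P).
Hypothesis PC : forall x y, rin (P x) y = rin (P y) x.
Hypotheses (kappa0 : 0 < kappa) (Pk : forall x, kappa * nrm x ^+ 2 <= rin (P x) x).
Hypotheses (k0 : 0 <= k) (beta0 : 0 <= beta).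
Hypothesis riccati : forall y z, Dd A y -> Dd A z ->
  rin (P (Ad A y)) z + rin (P y) (Ad A z) =
  k * rin (obsop y) (obsop z) + c2 * rin y z - rin (L y) z - beta * rin (P y) z.
Hypothesis observability : forall y, Dd A y -> c2 * nrm y ^+ 2 <= rin (L y) y.

Lemma reversed_gen y z : gen (fun t => Sd S (- t)) y z <-> Dd A y /\ Ad A y = - z.
Proof.
split=> [/gen_reverse yz|[Dy Ay]].
  apply/(Sd_gen gS genA).
  by move: yz; rewrite /gen; apply: eq_fun_cvg => h; rewrite opprK.
by rewrite -(opprK z) -Ay; apply: gen_reverse; apply/(Sd_gen gS genA).
Qed.

(** What the Riccati identity leaves of [P^-1 (A P - k B B^* ) + A^*]: the
    unbounded terms cancel. *)
Lemma closed_loop_perturbation : exists M : bop H H,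
  forall y, M y = Q (c2 *:: y - L y) - beta *:: y.
Proof.
have fb : bounded_op (fun y => Q (c2 *:: y - L y) - beta *:: y).
  apply: (@bounded_opP _ _ _ _ _ (opnorm Q * (`|c2| + opnorm L) + `|beta|)).
  - by move=> x y; rewrite (bopDr L) !scalerDr !opprD [X in Q X]addrACA bopDr addrACA.
  - move=> a x; rewrite !bopZr !scalerA ![sreal _ * a]mulrC -!scalerA -scalerBr.
    by rewrite bopZr -scalerBr.
  move=> x; rewrite mulrDl; apply: le_trans (ler_nrmB _ _) _.
  rewrite nrm_sZ lerD2r -mulrA (le_trans (le_opnorm _ _))// ler_wpM2l ?opnorm_ge0//.
  rewrite mulrDl (le_trans (ler_nrmB _ _))// nrm_sZ lerD2l.
  exact: le_opnorm.
by exists (mkbop fb).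
Qed.

(** The closed loop in the coordinate [y = P^-1 x]. The third clause says that
    its generator is [P^-1 (A - k B B^* P^-1) P], tested on the domain. The
    last two follow from [V' <= - beta V - k |B^* y|^2] for [V y = rin (P y) y]. *)
Theorem closed_loop : exists (G : R -> bop H H) (M : bop H H),
  [/\ C0_group G,
    forall y z, gen G y z <-> Dd A y /\ z = M y - Ad A y,
    forall y z, Dd A y -> Dd A z ->
      rin (P (M y - Ad A y)) z = rin (P y) (Ad A z) - k * rin (obsop y) (obsop z),
    forall y (t : R), 0 <= t -> rin (P (G t y)) (G t y) <= expR (- (beta * t)) * rin (P y) y &
    forall y, Dd A y -> (forall t, Dd A (G t y)) /\
      continuous (fun t => obsop (G t y)) /\
      forall t : R, 0 <= t -> (\int[@lebesgue_measure R]_(r in `[0%R, t])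
        (k ^+ 2 * nrm (obsop (G r y)) ^+ 2)%:E <= (k * rin (P y) y)%:E)%E].
Proof.
have [M hM] := closed_loop_perturbation.
have gSd := Sd_group gS genA.
have [G gG hG] := bounded_perturbation M (reverse_group gSd).
have genG y z : gen G y z <-> Dd A y /\ z = M y - Ad A y.
  split=> [yz|[Dy ->]].
    have : gen (fun t => Sd S (- t)) y (z - M y).
      apply: eq_fun_cvg (cvgB yz (hG y)) => h.
      by rewrite subKr.
    by move=> /reversed_gen[Dy Ay]; rewrite Ay opprK subrKC.
  have /reversed_gen : Dd A y /\ Ad A y = - - Ad A y by rewrite opprK.
  by move=> /(cvgD (hG y)); apply: eq_fun_cvg => h; rewrite subrK.
have form y z : Dd A y -> Dd A z ->
  rin (P (M y - Ad A y)) z = rin (P y) (Ad A z) - k * rin (obsop y) (obsop z).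
  move=> Dy Dz; have := riccati Dy Dz.
  by rewrite hM !(bopBr, rinE, QP, bop_sZ); lra.
have V0 y : 0 <= rin (P y) y.
  by apply: le_trans (Pk y); rewrite mulr_ge0 ?sqr_ge0// ltW.
exists G, M.
have orbit y : Dd A y -> forall t, sderiv (fun t => G t y) t (G t (M y - Ad A y)) /\
    (Dd A (G t y) /\ G t (M y - Ad A y) = M (G t y) - Ad A (G t y)).
  move=> Dy t; have gy : gen G y (M y - Ad A y) by apply/genG.
  split; first exact: gen_orbit.
  by apply/genG; exact: gen_invariant.
pose V y t := rin (P (G t y)) (G t y).
have dV y (t : R) : Dd A y -> is_derive t 1 (V y)
    (2 * rin (P (M (G t y) - Ad A (G t y))) (G t y)).
  move=> Dy; have [d [Dt E]] := orbit y Dy t.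
  have dP : sderiv (fun t => P (G t y)) t (P (G t (M y - Ad A y))) by exact: sderiv_bop d.
  have := is_derive_rin dP d; rewrite E.
  by rewrite [rin (P (G t y)) (_ - _)]PC mulr2n mulrDl mul1r; exact.
have dVle y (t : R) : Dd A y -> 2 * rin (P (M (G t y) - Ad A (G t y))) (G t y) <=
    - (beta * V y t) - k * nrm (obsop (G t y)) ^+ 2.
  move=> Dy; have [_ [Dt _]] := orbit y Dy t.
  have := riccati Dt Dt; have := observability Dt; rewrite form// PC.
  by rewrite -/(V y t) !rinxx; lra.
have cG := group_continuous gG.
split=> //.
- move=> y t t0.
  have main y' : Dd A y' -> V y' t <= expR (- (beta * t)) * rin (P y') y'.
    move=> Dy.
    have D (r : R) : is_derive r 1 (fun r => - (expR (beta * r) * V y' r))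
      (- (expR (beta * r) * (2 * rin (P (M (G r y') - Ad A (G r y'))) (G r y')
          + beta * V y' r))).
      have d1 := dV y' r Dy.
      have d2 : is_derive r 1 (fun r => expR (beta * r)) (beta * expR (beta * r)).
        exact: is_derive_expRM.
      have d4 : is_derive r 1 (fun r => expR (beta * r) * V y' r)
        (expR (beta * r) * (2 * rin (P (M (G r y') - Ad A (G r y'))) (G r y')
          + beta * V y' r)).
        by apply: is_derive_eq; rewrite /GRing.scale /=; ring.
      exact: is_deriveN.
    have D0 (r : R) : 0 <= r <= t -> 0 <= - (expR (beta * r) *
        (2 * rin (P (M (G r y') - Ad A (G r y'))) (G r y') + beta * V y' r)).
      move=> _; rewrite oppr_ge0 mulr_ge0_le0 ?expR_ge0//.
      have := dVle y' r Dy.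
      have : 0 <= k * nrm (obsop (G r y')) ^+ 2 by rewrite mulr_ge0 ?sqr_ge0.
      by lra.
    have := derive_le t0 D D0.
    rewrite mulr0 expR0 mul1r lerN2 /V; have [G0 _ _] := gG; rewrite !G0 => h.
    by rewrite expRN -ler_pdivrMl ?invr_gt0 ?expR_gt0// invrK.
  (* The inequality passes from the domain to [H] by density. *)
  apply/ler_addgt0Pr => e e0.
  have /choice[u hu] (n : nat) : exists v, Dd A v /\ nrm (y - v) < n.+1%:R^-1.
    have [|v Dv hv] := @Dd_dense _ _ _ S A gS genA y n.+1%:R^-1; first by rewrite invr_gt0.
    by exists v.
  have uy : u @ \oo --> y.
    apply/cvg_nrm => d d0; have := near_infty_natSinv_lt (PosNum d0).
    by apply: filterS => n; apply: lt_trans; rewrite nrmBC; case: (hu n).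
  have cP : (fun n => rin (P (u n)) (u n)) @ \oo --> rin (P y) y.
    by apply: cvg_rin => //; exact: bop_cvg.
  have cV : (fun n => V (u n) t) @ \oo --> V y t.
    by apply: cvg_rin; [apply: bop_cvg|]; exact: bop_cvg.
  have cR : (fun n => expR (- (beta * t)) * rin (P (u n)) (u n)) @ \oo -->
      expR (- (beta * t)) * rin (P y) y by apply: cvgM => //; exact: cvg_cst.
  apply: (@le_trans _ _ (expR (- (beta * t)) * rin (P y) y)); last by rewrite lerDl ltW.
  apply: (ler_cvg_to cV cR); near=> n; apply: main; exact: (hu n).1.
- move=> y Dy; have Dt t := (orbit y Dy t).2.1.
  have cAd : continuous (fun t => Ad A (G t y)).
    have -> : (fun t => Ad A (G t y)) = (fun t => M (G t y) - G t (M y - Ad A y)).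
      by apply/funext => t; have [_ [_ ->]] := orbit y Dy t; rewrite subKr.
    by move=> t; apply: cvgB; [apply: bop_cvg; exact: cG|exact: cG].
  have co : continuous (fun t => obsop (G t y)) by exact: obsop_continuous.
  split=> //; split=> // t t0.
  have ci : continuous (fun t => k ^+ 2 * nrm (obsop (G t y)) ^+ 2).
    move=> r; apply: cvgM; first exact: cvg_cst.
    by apply: cvgM; exact: (continuous_nrm co).
  have [F [F0 dF]] := primitive_ex ci.
  rewrite (integral_derive ci t0 dF) lee_fin F0 subr0.
  have D (r : R) : is_derive r 1 (fun r => - (k * V y r) - F r)
      (- (k * (2 * rin (P (M (G r y) - Ad A (G r y))) (G r y))) -
        k ^+ 2 * nrm (obsop (G r y)) ^+ 2).
    by have d1 := dV y r Dy; have d2 := dF r; apply: is_derive_eq.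
  have D0 (r : R) : 0 <= r <= t -> 0 <= - (k * (2 * rin (P (M (G r y) - Ad A (G r y))) (G r y))) -
        k ^+ 2 * nrm (obsop (G r y)) ^+ 2.
    move=> _; have Vr0 : 0 <= beta * V y r by rewrite mulr_ge0// V0.
    have h : 2 * rin (P (M (G r y) - Ad A (G r y))) (G r y) <= - (k * nrm (obsop (G r y)) ^+ 2).
      by have := dVle y r Dy; lra.
    by have := ler_wpM2l k0 h; lra.
  have := derive_le t0 D D0; rewrite F0 {1}/V; have [-> _ _] := gG.
  have : 0 <= k * V y t by rewrite mulr_ge0// V0.
  by lra.
Unshelve. all: by end_near. Qed.

End ClosedLoop.
End ObservationOperator.

(** * Step functions, strong measurability and almost everywhere convergence *)

Section StepFunctions.
Context {R : realType}.

(** Simple functions with values in an arbitrary type, in particular pairs,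
    which reduce operations on several functions to a single composition. *)
Definition step_fun {T : Type} (f : R -> T) : Prop :=
  finite_set (range f) /\ forall v, measurable (f @^-1` [set v]).

Lemma step_preimage {T : Type} (f : R -> T) (B : set T) : step_fun f ->
  measurable (f @^-1` B).
Proof.
move=> [ff mf].
have -> : f @^-1` B = \bigcup_(v in B `&` range f) (f @^-1` [set v]).
  apply/seteqP; split => t /=; first by move=> Bt; exists (f t) => //; split => //; exists t.
  by move=> [v [Bv _]] /= ->.
apply: fin_bigcup_measurable => [|v _]; last exact: mf.
exact: finite_setIr.
Qed.

Lemma step_comp {T W : Type} (phi : T -> W) (f : R -> T) : step_fun f ->
  step_fun (fun t => phi (f t)).
Proof.
move=> sf; split; last by move=> v; exact: (step_preimage (phi @^-1` [set v]) sf).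
have -> : range (fun t => phi (f t)) = phi @` range f.
  by apply/seteqP; split => [_ [t _ <-]|_ [_ [t _ <-] <-]]; [exists (f t)|exists t].
by apply: finite_image; case: sf.
Qed.

Lemma step_pair {T W : Type} (f : R -> T) (g : R -> W) : step_fun f -> step_fun g ->
  step_fun (fun t => (f t, g t)).
Proof.
move=> [ff mf] [fg mg]; split.
  apply: (@sub_finite_set _ _ (range f `*` range g)); last exact: finite_setX.
  by move=> _ [t _ <-]; split; exists t.
move=> [v w]; have -> : (fun t => (f t, g t)) @^-1` [set (v, w)] =
    f @^-1` [set v] `&` g @^-1` [set w].
  by apply/seteqP; split => t /= [-> ->].
exact: measurableI.
Qed.

Lemma step_indic {T : Type} (x0 : T) (C : set R) (f : R -> T) : measurable C ->
  step_fun f -> step_fun (fun t => if t \in C then f t else x0).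
Proof.
move=> mC sf.
have sC : step_fun (fun t => t \in C).
  split; first exact: finite_finset.
  move=> [].
    have -> : (fun t => t \in C) @^-1` [set true] = C => //.
    by apply/seteqP; split => t /=; [move/set_mem|move/mem_set].
  have -> : (fun t => t \in C) @^-1` [set false] = ~` C; last exact: measurableC.
  apply/seteqP; split => t /=; first by move=> tC Ct; rewrite mem_set in tC.
  by move=> tC; apply/negbTE/negP => /set_mem.
exact: (step_comp (fun p => if p.1 then p.2 else x0) (step_pair sC sf)).
Qed.

Lemma step_reflect {T : Type} (f : R -> T) : step_fun f -> step_fun (fun t => f (- t)).
Proof.
move=> [ff mf]; split.
  by apply: sub_finite_set ff => _ [t _ <-]; exists (- t).
move=> v; have mN : measurable_fun [set: R] (-%R : R -> R) by exact: oppr_measurable.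
by rewrite -[_ @^-1` _]setTI; exact: (mN measurableT _ (mf v)).
Qed.

Lemma step_measurable (f : R -> R) D : step_fun f -> measurable_fun D f.
Proof.
move=> sf; apply: (@measurable_funS _ _ _ _ setT) => // _ B mB.
by rewrite setTI; exact: step_preimage.
Qed.

End StepFunctions.

Section UniformApproximation.
Context {R : realType} {s : scalar_kind} {V : normedModType (scalarField R s)}.

Lemma uniform_continuity (u : R -> V) (n e : R) : continuous u -> 0 < e ->
  exists2 d : R, 0 < d & forall t r, `|t| <= n -> `|t - r| < d -> nrm (u t - u r) < e.
Proof.
move=> cu e0; have e20 : 0 < e / 2 by rewrite divr_gt0.
have /compact_near_coveringP K := @segment_compact R (- n) n.
have [|d /= d0 hd] := K R (0 : R)^'+ (fun d t => forall r, `|t - r| < d -> nrm (u t - u r) < e) _.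
  move=> t _.
  have /cvg_nrm/(_ _ e20) := cu t; rewrite near_nbhs => -[/= c c0 hc].
  have c20 : 0 < c / 2 by rewrite divr_gt0.
  near=> t' d => r t'r.
  have tt' : `|t - t'| < c / 2 by near: t'; apply: cvgr_dist_lt => //; exact: cvg_id.
  have dc : d < c / 2 by near: d; exact: nbhs_right_lt.
  apply: le_lt_trans (ler_nrm_distD (u t) _ _) _; rewrite (splitr e) (nrmBC (u t)).
  apply: ltrD; apply: hc; rewrite /ball_ /=; first by lra.
  rewrite -(subrK t' t) -addrA (le_lt_trans (ler_normD _ _))//.
  by have := lt_trans t'r dc; lra.
exists (d / 2); first by rewrite divr_gt0.
move=> t r tn tr; apply: (hd (d / 2)) tr => /=.
- by rewrite sub0r normrN ger0_norm ?ltr_pdivrMr ?ltr_pMr ?ltr1n// ltW// divr_gt0.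
- by rewrite divr_gt0.
- by rewrite in_itv /= -ler_norml.
Unshelve. all: by end_near. Qed.

Lemma step_approximation (u : R -> V) (n e : R) : continuous u -> 0 < n -> 0 < e ->
  exists2 g : R -> V, step_fun g & forall t, `|t| <= n -> nrm (g t - u t) < e.
Proof.
move=> cu n0 e0; have [d d0 hd] := uniform_continuity n cu e0.
(* The interval is cut into [m] pieces of length [d]; [idx t] is the index of the
   piece that contains [t]. *)
pose m := (Num.truncn (2 * n / d)).+1.
pose idx (t : R) : option nat :=
  if (- n <= t) && (t < - n + m%:R * d) then Some (Num.truncn ((t + n) / d)) else None.
have idxP t k : idx t = Some k <->
    (k < m)%N /\ - n + k%:R * d <= t < - n + k.+1%:R * d.
  rewrite /idx; case: ifPn => [/andP[t1 t2]|tn]; split => //.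
  - move=> [<-]; have q0 : 0 <= (t + n) / d by rewrite divr_ge0 ?(ltW d0)//; lra.
    have /andP[h1 h2] := truncn_itv q0; split.
      rewrite -(ltr_nat R); apply: le_lt_trans h1 _.
      by rewrite ltr_pdivrMr//; lra.
    by move: h1 h2; rewrite ler_pdivlMr// ltr_pdivrMr//; lra.
  - move=> [_ /andP[h1 h2]]; congr Some.
    have kd : 0 <= k%:R * d by rewrite mulr_ge0// ltW.
    have q0 : 0 <= (t + n) / d by rewrite divr_ge0 ?(ltW d0)//; lra.
    apply/eqP; rewrite truncn_eq//.
    by rewrite ler_pdivlMr// ltr_pdivrMr//; apply/andP; split; lra.
  - move=> [km /andP[h1 h2]]; move: tn; rewrite negb_and -ltNge -leNgt => tn; exfalso; case/orP: tn => h.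
      have : 0 <= k%:R * d by rewrite mulr_ge0// ltW.
      by lra.
    have : k.+1%:R * d <= m%:R * d by rewrite ler_pM2r// ler_nat.
    by lra.
have sidx : step_fun idx.
  split.
    apply: (@sub_finite_set _ _ ([set None] `|` Some @` `I_m)).
      move=> _ [t _ <-]; case E : (idx t) => [k|]; last by left.
      by right; exists k => //=; have /idxP[] := E.
    by rewrite finite_setU; split => //; exact: finite_image.
  move=> [k|].
    have -> : idx @^-1` [set Some k] = if (k < m)%N then `[- n + k%:R * d, - n + k.+1%:R * d[%classic else set0.
      apply/seteqP; split => t /=.
        by move=> /idxP[-> h]; rewrite /= in_itv.
      by case: ifP => // km; rewrite /= in_itv /= => h; apply/idxP.
    by case: ifP.
  have -> : idx @^-1` [set None] = ~` `[- n, - n + m%:R * d[%classic.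
    by apply/seteqP; split => t /=; rewrite in_itv /= /idx; case: ifP.
  exact: measurableC.
exists (fun t => if idx t is Some k then u (- n + k%:R * d) else 0).
  exact: (step_comp (fun o => if o is Some k then u (- n + k%:R * d) else 0) sidx).
move=> t tn; case E : (idx t) => [k|].
  have /idxP[km /andP[h1 h2]] := E; rewrite nrmBC; apply: hd => //.
  rewrite ger0_norm; last by lra.
  by move: h2; rewrite -natr1; lra.
move: E; rewrite /idx; case: ifPn => // /negP; case.
move: tn; rewrite ler_norml => /andP[-> tn] /=.
apply: le_lt_trans tn _.
have := Num.Theory.truncnS_gt (2 * n / d); rewrite -/m ltr_pdivrMr//.
by lra.
Qed.

End UniformApproximation.

Section StrongMeasurability.
Context {R : realType} {s : scalar_kind}.

Lemma sm_continuous {V : normedModType (scalarField R s)} (u : R -> V) D :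
  continuous u -> strongly_measurable D u.
Proof.
move=> cu.
have /choice[g hg] (n : nat) : exists g : R -> V, step_fun g /\
    forall t, `|t| <= n.+1%:R -> nrm (g t - u t) < n.+1%:R^-1.
  have [||g sg hg] := @step_approximation _ _ _ u n.+1%:R n.+1%:R^-1 cu => //.
  by exists g.
exists g; split => [n|t _]; first by case: (hg n).
apply/cvg_nrm => e e0; near=> n.
apply: (@lt_trans _ _ n.+1%:R^-1).
  apply: (hg n).2; apply: (@le_trans _ _ n%:R); last by rewrite ler_nat.
  by near: n; exact: nbhs_infty_ger.
by near: n; exact: (near_infty_natSinv_lt (PosNum e0)).
Unshelve. all: by end_near. Qed.

Lemma sm_lipschitz {V W : normedModType (scalarField R s)} (phi : V -> W) (c : R)
    (f : R -> V) D : (forall x y, nrm (phi x - phi y) <= c * nrm (x - y)) ->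
  strongly_measurable D f -> strongly_measurable D (fun t => phi (f t)).
Proof.
move=> hphi [g [sg gf]]; exists (fun n t => phi (g n t)); split.
  by move=> n; exact: (step_comp phi (sg n)).
move=> t /gf/cvg_nrm gt; apply/cvg_nrm => e e0.
have K0 : 0 < `|c| + 1 by rewrite ltr_wpDl.
have := gt _ (divr_gt0 e0 K0); apply: filterS => n.
rewrite ltr_pdivlMr// mulrC; apply: le_lt_trans; apply: le_trans (hphi _ _) _.
by rewrite ler_wpM2r ?nrm_ge0// (le_trans (ler_norm c))// lerDl.
Qed.

Lemma sm_add {V : normedModType (scalarField R s)} (f g : R -> V) D :
  strongly_measurable D f -> strongly_measurable D g ->
  strongly_measurable D (fun t => f t + g t).
Proof.
move=> [f' [sf ff]] [g' [sg gg]]; exists (fun n t => f' n t + g' n t); split.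
  by move=> n; exact: (step_comp (fun p => p.1 + p.2) (step_pair (sf n) (sg n))).
by move=> t Dt; apply: cvgD; [exact: ff|exact: gg].
Qed.

Lemma sm_scale {V : normedModType (scalarField R s)} (a : scalarField R s) (f : R -> V) D :
  strongly_measurable D f -> strongly_measurable D (fun t => a *: f t).
Proof.
by apply: (@sm_lipschitz _ _ _ (sRe `|a|)) => x y; rewrite -scalerBr nrmZ.
Qed.

Lemma sm_sub {V : normedModType (scalarField R s)} (f g : R -> V) D :
  strongly_measurable D f -> strongly_measurable D g ->
  strongly_measurable D (fun t => f t - g t).
Proof.
move=> sf /(sm_scale (-1)) sg; have := sm_add sf sg.
by congr strongly_measurable; apply/funext => t; rewrite scaleN1r.
Qed.

Lemma sm_reflect {V : normedModType (scalarField R s)} (f : R -> V) (D D' : set R) :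
  (forall t, D t -> D' (- t)) ->
  strongly_measurable D' f -> strongly_measurable D (fun t => f (- t)).
Proof.
move=> DD [g [sg gf]]; exists (fun n t => g n (- t)); split.
  by move=> n; exact: (step_reflect (sg n)).
by move=> t /DD; exact: gf.
Qed.

Lemma sm_subset {V : normedModType (scalarField R s)} (f : R -> V) (D D' : set R) :
  D `<=` D' -> strongly_measurable D' f -> strongly_measurable D f.
Proof. by move=> DD [g [sg gf]]; exists g; split => // t /DD; exact: gf. Qed.

Lemma sm_nrm {V : normedModType (scalarField R s)} (f : R -> V) D :
  strongly_measurable D f -> measurable_fun D (fun t => nrm (f t)).
Proof.
move=> [g [sg gf]]; apply: (@measurable_fun_cvg _ _ _ _ (fun n t => nrm (g n t))).
  by move=> n; apply: step_measurable; exact: (step_comp (fun x => nrm x) (sg n)).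
move=> t /gf/cvg_nrm gt; apply/cvgrPdist_lt => e /gt; apply: filterS => n.
by rewrite distrC; apply: le_lt_trans; exact: ler_dist_nrm.
Qed.

Lemma sm_rin {H : hilbertType R s} (f g : R -> H) D :
  strongly_measurable D f -> strongly_measurable D g ->
  measurable_fun D (fun t => rin (f t) (g t)).
Proof.
move=> [f' [sf ff]] [g' [sg gg]].
apply: (@measurable_fun_cvg _ _ _ _ (fun n t => rin (f' n t) (g' n t))).
  move=> n; apply: step_measurable.
  exact: (step_comp (fun p => rin p.1 p.2) (step_pair (sf n) (sg n))).
by move=> t Dt; apply: cvg_rin; [exact: ff|exact: gg].
Qed.

Lemma sm_nrm2 {V : normedModType (scalarField R s)} (f : R -> V) D :
  strongly_measurable D f -> measurable_fun D (fun t => (nrm (f t) ^+ 2)%:E).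
Proof.
by move=> sf; apply/measurable_EFinP; apply: measurable_funX; exact: sm_nrm.
Qed.

End StrongMeasurability.

Section AlmostEverywhere.
Context {R : realType}.
Local Notation mu := (@lebesgue_measure R).

Lemma ae_mono (P Q : R -> Prop) : (forall t, P t -> Q t) ->
  {ae mu, forall t, P t} -> {ae mu, forall t, Q t}.
Proof. by move=> PQ; apply: (@filterS _ _ (ae_filter_ringOfSetsType mu)). Qed.

Lemma ae_and (P Q : R -> Prop) : {ae mu, forall t, P t} -> {ae mu, forall t, Q t} ->
  {ae mu, forall t, P t /\ Q t}.
Proof. by move=> hP hQ; apply: (@filterI _ _ (ae_filter_ringOfSetsType mu)). Qed.

Lemma geometric_sum (K : R) n : \sum_(i < n) K * 2^-1 ^+ i = 2 * K - 2 * K * 2^-1 ^+ n.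
Proof.
elim: n => [|n IH]; first by rewrite big_ord0 expr0 mulr1 subrr.
by rewrite big_ord_recr /= IH exprS; field.
Qed.

(** Borel-Cantelli in integral form: the sum of the [f n] has a finite
    integral, hence is finite almost everywhere. *)
Lemma ae_bounded (D : set R) (f : nat -> R -> R) (K : R) : measurable D ->
  (forall n, measurable_fun D (f n)) -> (forall n t, 0 <= f n t) ->
  (forall n, (\int[mu]_(t in D) (f n t)%:E <= (K * 2^-1 ^+ n)%:E)%E) ->
  {ae mu, forall t, D t -> exists M : R, forall n, f n t <= M}.
Proof.
move=> mD mf f0 hf.
pose F t := (\sum_(n <oo) (f n t)%:E)%E.
have mfE n : measurable_fun D (fun t => (f n t)%:E) by apply/measurable_EFinP.
have F0 t : (0 <= F t)%E by apply: nneseries_ge0 => n _ _; rewrite lee_fin.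
have mF : measurable_fun D F.
  by apply: ge0_emeasurable_sum => // n t _ _; rewrite lee_fin.
have iF : (\int[mu]_(t in D) F t <= (2 * K)%:E)%E.
  rewrite integral_nneseries//; last by move=> n t _; rewrite lee_fin.
  apply: lime_le.
    by apply: is_cvg_nneseries => n _ _; apply: integral_ge0 => t _; rewrite lee_fin.
  apply: nearW => n.
  apply: (@le_trans _ _ (\sum_(0 <= i < n) (K * 2^-1 ^+ i)%:E)%E).
    by apply: lee_sum => i _; exact: hf.
  rewrite sumEFin lee_fin big_mkord geometric_sum gerBl mulr_ge0 ?exprn_ge0 ?invr_ge0//.
  have := hf 0%N; rewrite expr0 mulr1 => /(le_trans _) h.
  have : (0 <= K%:E)%E by apply: h; apply: integral_ge0 => t _; rewrite lee_fin.
  by rewrite lee_fin => K0; rewrite mulr_ge0.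
have iF' : mu.-integrable D F.
  apply/integrableP; split => //.
  under eq_integral do rewrite gee0_abs//.
  by apply: le_lt_trans iF _; rewrite ltry.
have : {ae mu, forall t, D t -> F t \is a fin_num} by exact: integrable_ae.
apply: (@filterS _ _ (ae_filter_ringOfSetsType mu)) => t h /h Ff.
exists (fine (F t)) => n; rewrite -lee_fin fineK//.
apply: (@le_trans _ _ (\sum_(0 <= i < n.+1) (f i t)%:E)%E).
  by rewrite big_nat_recr//= leeDr// sume_ge0// => i _; rewrite lee_fin.
by apply: nneseries_lim_ge => i _; rewrite lee_fin.
Qed.

Lemma ae_itv (P : R -> Prop) :
  (forall n : nat, {ae mu, forall t, `[- n.+1%:R, n.+1%:R]%classic t -> P t}) ->
  {ae mu, forall t, P t}.
Proof.
move=> hP; have := ae_foralln hP; apply: filterS => t ht.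
apply: (ht (Num.truncn `|t|)); rewrite /= in_itv /= -ler_norml.
exact/ltW/Num.Theory.truncnS_gt.
Qed.

Lemma ae_reflect (P : R -> Prop) : {ae mu, forall t, P t} -> {ae mu, forall t, P (- t)}.
Proof.
move=> [N [mN N0 PN]]; exists ((fun t => - t) @^-1` N); split.
- have mo : measurable_fun [set: R] (-%R : R -> R) by exact: oppr_measurable.
  by rewrite -[_ @^-1` _]setTI; exact: mo.
- by rewrite -N0; exact: (lebesgue_measureN mN).
- by move=> t /= nP; exact: PN.
Qed.

Lemma limn_einf_le (u : nat -> \bar R) (M : \bar R) :
  (\forall n \near \oo, (u n <= M)%E) -> (limn_einf u <= M)%E.
Proof.
move=> [N _ HN]; rewrite limn_einf_lim; apply: lime_le; first exact: is_cvg_einfs.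
apply: nearW => n; apply: (@le_trans _ _ (u (maxn N n))).
  by apply: ereal_inf_lbound; exists (maxn N n) => //=; exact: leq_maxr.
by apply: HN => /=; exact: leq_maxl.
Qed.

Lemma measurable_limn_einf (D : set R) (f : nat -> R -> \bar R) :
  measurable D -> (forall n, measurable_fun D (f n)) ->
  measurable_fun D (fun t => limn_einf (f ^~ t)).
Proof.
move=> mD mf.
have -> : (fun t => limn_einf (f ^~ t)) = (fun t => - limn_esup ((fun n t => - f n t) ^~ t))%E.
  by apply/funext => t; rewrite -limn_einfN; congr limn_einf; apply/funext => n /=; rewrite oppeK.
by apply: measurableT_comp => //; apply: measurable_fun_limn_esup => // n; exact: measurableT_comp.
Qed.

End AlmostEverywhere.

(** * The extension of the observation map *)

Lemma nrm_cvg {R : realType} {s : scalar_kind} {V : normedModType (scalarField R s)} {T}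
    (F : set_system T) {FF : Filter F} (f : T -> V) (x : V) :
  f @ F --> x -> nrm (f t) @[t --> F] --> nrm x.
Proof.
move=> /cvg_nrm fx; apply/cvgrPdist_lt => e /fx; apply: filterS => t.
by rewrite distrC; apply: le_lt_trans; exact: ler_dist_nrm.
Qed.

Section ObservationExtension.
Context {R : realType} {s : scalar_kind} {H U : hilbertType R s}.
Variables (S : R -> bop H H) (A : unbounded H H) (B : U -> dual H -> (scalarField R s)^o).
Hypotheses (gS : C0_group S) (genA : generates 0^' S A).
Hypothesis hB : bounded_to_dual (adjoint A) B.
Hypothesis admissible : forall T : R, 0 < T -> exists C : R, 0 < C /\
  forall f : dual H, dom (adjoint A) f ->
    (l2sq `[0%R, T] (observation S B f) <= (C * nrm f ^+ 2)%:E)%E.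
Local Notation mu := (@lebesgue_measure R).
Local Notation Ddom := (Dd A).

Definition orb (y : H) (t : R) : U := obsop B (Sd S t y).

Lemma observation_orb y t : observation S B (rd y) t = rd (orb y t).
Proof. by rewrite /orb /obsop rieszK /observation rd_Sd. Qed.

Lemma Sd_Dd y t : Ddom y -> Ddom (Sd S t y) /\ Ad A (Sd S t y) = Sd S t (Ad A y).
Proof.
move=> Dy; apply/(Sd_gen gS genA); apply: gen_invariant; first exact: Sd_group gS genA.
exact/(Sd_gen gS genA).
Qed.

Lemma orb_continuous y : Ddom y -> continuous (orb y).
Proof.
move=> Dy; have cS := group_continuous (Sd_group gS genA).
apply: (obsop_continuous gS genA hB) => [|t|]; first exact: cS.
  by have [] := Sd_Dd t Dy.
have -> : (fun t => Ad A (Sd S t y)) = (fun t => Sd S t (Ad A y)); last exact: cS.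
by apply/funext => t; have [] := Sd_Dd t Dy.
Qed.

Lemma orb_comb (a : scalarField R s) y z t : Ddom y -> Ddom z ->
  orb (a *: y + z) t = a *: orb y t + orb z t.
Proof.
move=> Dy Dz; rewrite /orb bopDr bopZr.
by apply: (obsop_comb gS genA hB); [exact: (Sd_Dd t Dy).1|exact: (Sd_Dd t Dz).1].
Qed.

Lemma orbB y z t : Ddom y -> Ddom z -> orb (y - z) t = orb y t - orb z t.
Proof.
by move=> Dy Dz; rewrite addrC -scaleN1r orb_comb// scaleN1r addrC.
Qed.

Lemma DdB y z : Ddom y -> Ddom z -> Ddom (y - z).
Proof.
move=> Dy Dz; rewrite addrC -scaleN1r.
by have [] := Dd_comb gS genA (-1) Dz Dy.
Qed.

Lemma orb_shift y t r : orb (Sd S r y) t = orb y (t + r).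
Proof. by rewrite /orb; have [_ -> _] := Sd_group gS genA. Qed.

Lemma continuous_nrm2 {V : normedModType (scalarField R s)} (u : R -> V) :
  continuous u -> continuous (fun t => nrm (u t) ^+ 2).
Proof. by move=> cu t; apply: cvgM; exact: (continuous_nrm cu). Qed.

Lemma l2sq_shift {V : normedModType (scalarField R s)} (u : R -> V) (a b c : R) :
  continuous u -> a <= b ->
  l2sq `[a, b] (fun t => u (t + c)) = l2sq `[(a + c)%R, (b + c)%R] u.
Proof.
move=> cu ab; have [F [F0 dF]] := primitive_ex (continuous_nrm2 cu).
have cuc : continuous (fun t => u (t + c)).
  by move=> t; apply: (cvg_comp _ u _ (cu _)); apply: cvgD; [exact: cvg_id|exact: cvg_cst].
rewrite /l2sq (integral_derive (continuous_nrm2 cu) _ dF) ?lerD2r//.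
have dFc (t : R) : is_derive t 1 (fun t => F (t + c)) (nrm (u (t + c)) ^+ 2).
  have d : is_derive t 1 (fun t : R => t + c) 1 by apply: is_derive_eq; rewrite addr0.
  by have := @is_derive1_comp R F (fun t => t + c) t _ _ (dF _) d; rewrite mulr1.
by rewrite (integral_derive (continuous_nrm2 cuc) ab dFc).
Qed.

Lemma l2sq_reflect {V : normedModType (scalarField R s)} (u : R -> V) (a b : R) :
  continuous u -> a <= b ->
  l2sq `[a, b] (fun t => u (- t)) = l2sq `[(- b)%R, (- a)%R] u.
Proof.
move=> cu ab; have [F [F0 dF]] := primitive_ex (continuous_nrm2 cu).
have cuc : continuous (fun t => u (- t)).
  by move=> t; apply: (cvg_comp _ u _ (cu _)); apply: cvgN; exact: cvg_id.
rewrite /l2sq (integral_derive (continuous_nrm2 cu) _ dF) ?lerN2//.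
have dFc (t : R) : is_derive t 1 (fun t => - F (- t)) (nrm (u (- t)) ^+ 2).
  have d : is_derive t 1 (fun t : R => - t) (-1) by apply: is_derive_eq.
  have dc := @is_derive1_comp R F (fun t => - t) t _ _ (dF _) d.
  by apply: is_derive_eq; rewrite mulrN1 opprK.
by rewrite (integral_derive (continuous_nrm2 cuc) ab dFc) opprK addrC.
Qed.

Lemma orb_bound (T : R) : 0 < T -> exists2 c : R, 0 <= c &
  forall y, Ddom y -> (l2sq `[(- T)%R, T] (orb y) <= (c * nrm y ^+ 2)%:E)%E.
Proof.
move=> T0; have T20 : 0 < T + T by rewrite addr_gt0.
have [C [C0 hC]] := admissible T20.
exists (C * opnorm (Sd S (- T)) ^+ 2) => [|y Dy]; first by rewrite mulr_ge0 ?sqr_ge0// ltW.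
have [Dz _] := Sd_Dd (- T) Dy.
have := hC (rd (Sd S (- T) y)) Dz.
have -> : l2sq `[0, T + T] (observation S B (rd (Sd S (- T) y))) =
    l2sq `[0, T + T] (fun t => orb y (t + - T)).
  by apply: eq_integral => t _; rewrite observation_orb orb_shift nrm_rd.
rewrite (l2sq_shift (- T) (orb_continuous Dy) (ltW T20)).
rewrite add0r addrK nrm_rd => /le_trans; apply; rewrite lee_fin -mulrA -exprMn.
rewrite ler_wpM2l ?(ltW C0)// lerXn2r ?nnegrE ?nrm_ge0 ?le_opnorm//.
by rewrite mulr_ge0 ?opnorm_ge0 ?nrm_ge0.
Qed.

(** The rate [4^-n] leaves room for a factor [2^n] lost when square integrals
    are turned into pointwise bounds. *)
Definition approximates (y : H) (u : nat -> H) :=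
  (forall n, Ddom (u n)) /\ exists2 K : R, 0 <= K & forall n, nrm (y - u n) <= K * 4^-1 ^+ n.

Lemma approximates_ex y : exists u, approximates y u.
Proof.
have /choice[u hu] (n : nat) : exists v, Ddom v /\ nrm (y - v) < 4^-1 ^+ n.
  have [|v Dv hv] := @Dd_dense _ _ _ S A gS genA y (4^-1 ^+ n); last by exists v.
  by rewrite exprn_gt0// invr_gt0.
exists u; split => [n|]; first by case: (hu n).
by exists 1 => // n; rewrite mul1r ltW//; case: (hu n).
Qed.

Lemma approximates_step y u : approximates y u -> exists2 K : R, 0 <= K &
  forall n, nrm (u n.+1 - u n) <= K * 4^-1 ^+ n.
Proof.
move=> [Du [K K0 hK]]; exists (2 * K) => [|n]; first by rewrite mulr_ge0.
apply: le_trans (ler_nrm_distD y _ _) _; rewrite (nrmBC (u n.+1)).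
have := hK n; have := hK n.+1; rewrite exprS.
have : 0 <= K * 4^-1 ^+ n by rewrite mulr_ge0 ?exprn_ge0 ?invr_ge0.
by lra.
Qed.

Lemma half_sqr n : (2^-1 ^+ n : R) ^+ 2 = 4^-1 ^+ n.
Proof. by rewrite -exprM mulnC exprM; congr (_ ^+ _); field. Qed.

(** The functions [4^n |f n|^2] have summable integrals. *)
Lemma ae_geometric {V : normedModType (scalarField R s)} (D : set R) (f : nat -> R -> V) (K : R) :
  measurable D -> (forall n, measurable_fun D (fun t => nrm (f n t))) -> 0 <= K ->
  (forall n, (l2sq D (f n) <= (K * (4^-1 ^+ n) ^+ 2)%:E)%E) ->
  {ae mu, forall t, D t -> exists2 M : R, 0 <= M & forall n, nrm (f n t) <= M * 2^-1 ^+ n}.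
Proof.
move=> mD mf K0 hf.
have mf2 n : measurable_fun D (fun t => 4 ^+ n * nrm (f n t) ^+ 2).
  by apply: measurable_funM => //; apply: measurable_funX; exact: mf.
have H1 n : (\int[mu]_(t in D) (4 ^+ n * nrm (f n t) ^+ 2)%:E <= (K * 2^-1 ^+ n)%:E)%E.
  under eq_integral do rewrite EFinM.
  rewrite ge0_integralZl//.
  - apply: (@le_trans _ _ ((4 ^+ n)%:E * (K * (4^-1 ^+ n) ^+ 2)%:E)%E).
      by apply: lee_wpmul2l; rewrite ?lee_fin ?exprn_ge0//; exact: hf.
    rewrite -EFinM lee_fin mulrCA ler_wpM2l// expr2 mulrA -exprMn divff// expr1n mul1r.
    by apply: lerXn2r; rewrite ?nnegrE ?invr_ge0// lef_pV2 ?posrE// ler_nat.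
  - by apply/measurable_EFinP; apply: measurable_funX; exact: mf.
  - by move=> t _; rewrite lee_fin sqr_ge0.
have := ae_bounded mD mf2 (ltac:(by move=> n t; rewrite mulr_ge0 ?sqr_ge0// exprn_ge0)) H1.
apply: ae_mono => t h /h[M hM]; exists (`|M| + 1) => [|n]; first by rewrite addr_ge0.
have B0 : 0 <= (`|M| + 1) * 2^-1 ^+ n by rewrite mulr_ge0 ?addr_ge0 ?exprn_ge0 ?invr_ge0.
rewrite -ler_sqr ?nnegrE ?nrm_ge0//.
rewrite exprMn half_sqr exprVn ler_pdivlMr ?exprn_gt0// mulrC (le_trans (hM n))//.
by have := ler_norm M; have := normr_ge0 M; nra.
Qed.

(** Admissibility bounds the differences of consecutive observations in square
    mean, and fast approximation makes the bounds summable. *)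
Lemma orb_ae_cauchy y u : approximates y u ->
  {ae mu, forall t, cvg ((fun n => orb (u n) t) @ \oo)}.
Proof.
move=> yu; have [Du _] := yu; have [K K0 hK] := approximates_step yu.
apply: ae_itv => m.
have m0 : 0 < m.+1%:R :> R by [].
move: (m.+1%:R) m0 => T T0.
have [c c0 hc] := orb_bound T0.
have step n : (l2sq `[(- T)%R, T] (fun t => orb (u n.+1) t - orb (u n) t)%R <=
    (c * K ^+ 2 * (4^-1 ^+ n) ^+ 2)%:E)%E.
  have -> : (fun t => orb (u n.+1) t - orb (u n) t) = orb (u n.+1 - u n).
    by apply/funext => t; rewrite orbB.
  apply: le_trans (hc _ (DdB (Du _) (Du _))) _; rewrite lee_fin -mulrA -exprMn ler_wpM2l//.
  by rewrite lerXn2r ?nnegrE ?nrm_ge0 ?hK// mulr_ge0// exprn_ge0// invr_ge0.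
have mf n : measurable_fun `[- T, T]%classic
    (fun t : R => nrm (orb (u n.+1) t - orb (u n) t)).
  by apply: sm_nrm; apply: sm_sub; apply: sm_continuous; exact: orb_continuous.
have := ae_geometric (measurable_itv _) mf (mulr_ge0 c0 (sqr_ge0 K)) step.
apply: ae_mono => t h /h[M M0 hM].
have [|x ux _] := @series_complete _ _ U (fun n => orb (u n) t) (geometric M 2^-1) hM.
  by apply: is_cvg_geometric_series; rewrite ger0_norm ?invr_ge0// invf_lt1// ltr1n.
by apply/cvg_ex; exists x.
Qed.

(** Strong measurability asks for step functions that converge at every point.
    Step functions [g n] close to the observations have the same limits, and
    are replaced by [0] off the measurable set where they converge. *)
Lemma extension_ex y : exists e : R -> U,
  (forall D, strongly_measurable D e) /\
  exists2 u, approximates y u & {ae mu, forall t, (fun n => orb (u n) t) @ \oo --> e t}.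
Proof.
have [u yu] := approximates_ex y; have [Du _] := yu.
have /choice[g hg] (n : nat) : exists g : R -> U, step_fun g /\
    forall t, `|t| <= n.+1%:R -> nrm (g t - orb (u n) t) < n.+1%:R^-1.
  have [||g sg hg] := @step_approximation _ _ _ (orb (u n)) n.+1%:R n.+1%:R^-1
    (orb_continuous (Du n)) => //.
  by exists g.
have gu (t : R) (x : U) : ((fun n => g n t) @ \oo --> x) <-> ((fun n => orb (u n) t) @ \oo --> x).
  have d0 : (fun n => g n t - orb (u n) t) @ \oo --> (0 : U).
    apply/cvg_nrm => e e0; near=> n; rewrite subr0.
    apply: (@lt_trans _ _ n.+1%:R^-1).
      apply: (hg n).2; apply: (@le_trans _ _ n%:R); last by rewrite ler_nat.
      by near: n; exact: nbhs_infty_ger.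
    by near: n; exact: (near_infty_natSinv_lt (PosNum e0)).
  split=> h.
    rewrite -(subr0 x); apply: eq_fun_cvg (cvgB h d0) => n.
    by rewrite subKr.
  rewrite -(add0r x); apply: eq_fun_cvg (cvgD d0 h) => n.
  by rewrite subrK.
pose C := [set t | cvg ((fun n => g n t) @ \oo)].
have mC : measurable C.
  have -> : C = \bigcap_k \bigcup_N \bigcap_n \bigcap_m
      [set t | nrm (g (N + n)%N t - g (N + m)%N t) < k.+1%:R^-1].
    apply/seteqP; split => t /=.
      move=> /cvg_ex[x /cvg_nrm gx] k _.
      have k0 : (0 : R) < k.+1%:R^-1 / 2 by rewrite divr_gt0.
      have [N _ HN] := gx _ k0; exists N => // n _ m _ /=.
      apply: le_lt_trans (ler_nrm_distD x _ _) _; rewrite (nrmBC x).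
      by rewrite (splitr k.+1%:R^-1) ltrD//; apply: HN => /=; exact: leq_addr.
    move=> h; apply: nrm_complete => e e0.
    have [k _ hk] := near_infty_natSinv_lt (PosNum e0).
    have [N _ HN] := h k Logic.I; exists N => n m Nn Nm.
    have := HN (n - N)%N Logic.I (m - N)%N Logic.I; rewrite /= !subnKC// => /lt_trans; apply.
    exact: hk (leqnn k).
  apply: bigcapT_measurable => k; apply: bigcupT_measurable => N.
  apply: bigcapT_measurable => n; apply: bigcapT_measurable => m.
  exact: (step_preimage [set p : U * U | nrm (p.1 - p.2) < k.+1%:R^-1]
    (step_pair (hg (N + n)%N).1 (hg (N + m)%N).1)).
pose e t := if t \in C then lim ((fun n => g n t) @ \oo) else 0.
exists e; split.
  move=> D; exists (fun n t => if t \in C then g n t else 0); split.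
    by move=> n; exact: step_indic mC (hg n).1.
  move=> t _; rewrite /e; case: ifPn => [/set_mem Ct|_]; first exact: Ct.
  exact: cvg_cst.
exists u => //; apply: ae_mono (orb_ae_cauchy yu) => t /cvg_ex[/= x ux].
have gx := (gu t x).2 ux.
have Ct : C t by apply/cvg_ex; exists x.
rewrite /e mem_set//; apply/gu; exact: Ct.
Unshelve. all: by end_near. Qed.

(** The admissibility bound passes to the limit by Fatou's lemma. It gives the
    bound on the extension for [z = 0], and otherwise the independence of the
    approximating sequence. *)
Lemma extension_estimate (T c : R) y u e :
  (forall y, Ddom y -> (l2sq `[(- T)%R, T] (orb y) <= (c * nrm y ^+ 2)%:E)%E) -> 0 <= c ->
  (forall D, strongly_measurable D e) -> approximates y u ->
  {ae mu, forall t, (fun n => orb (u n) t) @ \oo --> e t} ->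
  forall z, Ddom z ->
    (l2sq `[(- T)%R, T] (fun t => e t - orb z t)%R <= (c * nrm (y - z) ^+ 2)%:E)%E.
Proof.
move=> hc c0 sme [Du [K K0 hK]] aeu z Dz.
have mD : measurable `[- T, T]%classic by exact: measurable_itv.
pose f n t := (nrm (orb (u n) t - orb z t) ^+ 2)%:E.
have smz : strongly_measurable `[- T, T]%classic (orb z) by exact/sm_continuous/orb_continuous.
have mf n : measurable_fun `[- T, T]%classic (f n).
  by apply: sm_nrm2; apply: sm_sub => //; apply: sm_continuous; exact: orb_continuous.
have f0 n t : `[- T, T]%classic t -> (0 <= f n t)%E by move=> _; rewrite lee_fin sqr_ge0.
have fle n : (\int[mu]_(t in `[(- T)%R, T]) f n t <= (c * nrm (u n - z) ^+ 2)%:E)%E.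
  have -> : (\int[mu]_(t in `[(- T)%R, T]) f n t)%E = l2sq `[(- T)%R, T] (orb (u n - z)).
    by apply: eq_integral => t _; rewrite /f orbB.
  by apply: hc; exact: DdB.
have cu : (fun n => c * nrm (u n - z) ^+ 2) @ \oo --> c * nrm (y - z) ^+ 2.
  have uy : u @ \oo --> y.
    apply/cvg_nrm_real; apply: (@squeeze_cvgr _ _ _ _ (fun=> 0) (fun n => K * 4^-1 ^+ n)).
    - by apply: nearW => n; rewrite nrm_ge0 nrmBC hK.
    - exact: cvg_cst.
    - rewrite -[X in _ --> X](mulr0 K); apply: cvgM; first exact: cvg_cst.
      by apply: cvg_expr; rewrite ger0_norm ?invr_ge0// invf_lt1// ltr1n.
  apply: cvgM; first exact: cvg_cst.
  have cn : (fun n => nrm (u n - z)) @ \oo --> nrm (y - z).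
    by apply: nrm_cvg; apply: cvgB => //; exact: cvg_cst.
  by apply: cvgM.
apply: (@le_trans _ _ (\int[mu]_(t in `[(- T)%R, T]) limn_einf (f ^~ t))%E).
  apply: ae_ge0_le_integral => //.
  - by move=> t _; rewrite lee_fin sqr_ge0.
  - by apply: sm_nrm2; exact: sm_sub.
  - move=> t Dt; rewrite limn_einf_lim; apply: lime_ge; first exact: is_cvg_einfs.
    by apply: nearW => n; apply: le_ereal_inf_tmp => _ [m _ <-]; exact: f0.
  - exact: measurable_limn_einf.
  apply: ae_mono aeu => t uet _.
  have cf : f ^~ t @ \oo --> (nrm (e t - orb z t) ^+ 2)%:E.
    apply/cvg_EFin; first by apply: nearW.
    have cn : (fun n => nrm (orb (u n) t - orb z t)) @ \oo --> nrm (e t - orb z t).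
      by apply: nrm_cvg; apply: cvgB => //; exact: cvg_cst.
    by apply: cvgM.
  by have [-> _] := cvg_limn_einf_sup cf.
apply: le_trans (fatou mu mD mf f0) _.
apply/lee_addgt0Pr => d d0; apply: limn_einf_le.
have := cu => /cvgrPdist_lt/(_ _ d0); apply: filterS => n h.
apply: le_trans (fle n) _; rewrite -EFinD lee_fin.
by move: h; rewrite ltr_norml => /andP[h1 h2]; lra.
Qed.

Lemma extension_unique y u v e :
  (forall D, strongly_measurable D e) -> approximates y u ->
  {ae mu, forall t, (fun n => orb (u n) t) @ \oo --> e t} ->
  approximates y v -> {ae mu, forall t, (fun n => orb (v n) t) @ \oo --> e t}.
Proof.
move=> sme yu aeu [Dv [K K0 hK]]; apply: ae_itv => m.
have m0 : 0 < m.+1%:R :> R by [].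
move: (m.+1%:R) m0 => T T0.
have [c c0 hc] := orb_bound T0.
have mf n : measurable_fun `[- T, T]%classic (fun t : R => nrm (e t - orb (v n) t)).
  by apply: sm_nrm; apply: sm_sub => //; apply: sm_continuous; exact: orb_continuous.
have bnd n : (l2sq `[(- T)%R, T] (fun t => e t - orb (v n) t)%R <=
    (c * K ^+ 2 * (4^-1 ^+ n) ^+ 2)%:E)%E.
  apply: le_trans (extension_estimate hc c0 sme yu aeu (Dv n)) _.
  rewrite lee_fin -mulrA -exprMn ler_wpM2l//.
  by rewrite lerXn2r ?nnegrE ?nrm_ge0 ?hK// mulr_ge0// exprn_ge0// invr_ge0.
have := ae_geometric (measurable_itv _) mf (mulr_ge0 c0 (sqr_ge0 K)) bnd.
apply: ae_mono => t h /h[M M0 hM].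
apply/cvg_nrm_real; apply: (@squeeze_cvgr _ _ _ _ (fun=> 0) (fun n => M * 2^-1 ^+ n)).
- by apply: nearW => n; rewrite nrm_ge0 nrmBC hM.
- exact: cvg_cst.
- rewrite -[X in _ --> X](mulr0 M); apply: cvgM; first exact: cvg_cst.
  by apply: cvg_expr; rewrite ger0_norm ?invr_ge0// invf_lt1// ltr1n.
Qed.

Lemma approximates_comb (a : scalarField R s) y z u v : approximates y u ->
  approximates z v -> approximates (a *: y + z) (fun n => a *: u n + v n).
Proof.
move=> [Du [K K0 hK]] [Dv [L L0 hL]]; split=> [n|].
  by have [] := Dd_comb gS genA a (Du n) (Dv n).
exists (sRe `|a| * K + L) => [|n]; first by rewrite addr_ge0// mulr_ge0// sRe_norm_ge0.
rewrite opprD addrACA -scalerBr (le_trans (ler_nrmD _ _))// nrmZ mulrDl -mulrA lerD//.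
by rewrite ler_wpM2l ?sRe_norm_ge0.
Qed.

Lemma approximates_cst y : Ddom y -> approximates y (fun=> y).
Proof. by move=> Dy; split=> //; exists 0 => // n; rewrite subrr nrm0 mul0r. Qed.

Theorem observation_extension_ex : exists E, is_observation_extension A S B E.
Proof.
have /choice[e he] y := extension_ex y.
have sme y D : strongly_measurable D (e y) by case: (he y).
have est (T : R) : 0 < T -> exists2 c : R, 0 <= c &
    forall y, (l2sq `[(- T)%R, T] (e y) <= (c * nrm y ^+ 2)%:E)%E.
  move=> T0; have [c c0 hc] := orb_bound T0; exists c => // y.
  have [_ [u yu aeu]] := he y; have D0 := Dd0 gS genA.
  have := extension_estimate hc c0 (sme y) yu aeu D0; rewrite subr0.
  congr (_ <= _)%E; apply: eq_integral => t _.
  by rewrite -(subrr 0) orbB// subrr subr0.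
exists (fun f t => rd (e (riesz f) t)); split.
- move=> f T T0; split.
    apply: (@sm_lipschitz _ _ _ _ (@rd R s U) 1); last exact: sme.
    by move=> x y; rewrite -rdB nrm_rd mul1r.
  have [c c0 hc] := est T T0; apply: le_lt_trans (ltry (c * nrm (riesz f) ^+ 2)).
  apply: le_trans (hc _); rewrite le_eqVlt; apply/predU1P; left.
  by apply: eq_integral => t _; rewrite nrm_rd.
- move=> a f g; have [_ [u yu aeu]] := he (riesz f); have [_ [v zv aev]] := he (riesz g).
  have [_ [w yw aew]] := he (sconj a *: riesz f + riesz g).
  have := extension_unique (sme _) yw aew (approximates_comb (sconj a) yu zv).
  move=> /ae_and/(_ (ae_and aeu aev)); apply: ae_mono => t [h1 [h2 h3]].
  rewrite rieszD rieszZ -{2}(sconjK a) -rdZ -rdD; congr rd.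
  have h4 : (fun n => sconj a *: orb (u n) t + orb (v n) t) @ \oo -->
      sconj a *: e (riesz f) t + e (riesz g) t by apply: cvgD => //; exact: cvgZr.
  have E n : orb (sconj a *: u n + v n) t = sconj a *: orb (u n) t + orb (v n) t.
    by rewrite orb_comb//; [case: yu|case: zv].
  rewrite (funext E) in h1.
  exact: (cvg_unique (@norm_hausdorff _ U) h1 h4).
- move=> T T0; have [c c0 hc] := est T T0; exists c => f.
  rewrite -nrm_riesz; apply: le_trans (hc _); rewrite le_eqVlt; apply/predU1P; left.
  by apply: eq_integral => t _; rewrite nrm_rd.
- move=> f Df; have [_ [u yu aeu]] := he (riesz f).
  have Dy : Ddom (riesz f) by change (dom (adjoint A) (rd (riesz f))); rewrite rieszK.
  have := extension_unique (sme _) yu aeu (approximates_cst Dy).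
  apply: ae_mono => t h; rewrite -[in RHS](rieszK f) observation_orb; congr rd.
  exact: (cvg_unique (@norm_hausdorff _ U) h (cvg_cst _)).
Qed.

Lemma observation_extP : is_observation_extension A S B (observation_ext A S B).
Proof.
rewrite /observation_ext; case: xgetP => // hE.
by have [E /hE] := observation_extension_ex.
Qed.

End ObservationExtension.

(** * The quadratic forms [Lambda] and [Pi] *)

Local Notation sintegral := Defs.sintegral.

Section ScalarIntegrals.
Context {R : realType} {s : scalar_kind}.
Local Notation mu := (@lebesgue_measure R).

Lemma integrable_scale (D : set R) (r : R) (f : R -> R) : measurable D ->
  mu.-integrable D (EFin \o f) -> mu.-integrable D (EFin \o (fun x => r * f x)).
Proof.
move=> mD fi; have -> : EFin \o (fun x => r * f x) = (fun x => r%:E * (EFin \o f) x)%E by [].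
exact: integrableZl.
Qed.

Lemma integrable_add (D : set R) (f g : R -> R) : measurable D ->
  mu.-integrable D (EFin \o f) -> mu.-integrable D (EFin \o g) ->
  mu.-integrable D (EFin \o (fun x => f x + g x)).
Proof.
move=> mD fi gi.
have -> : EFin \o (fun x => f x + g x) = (EFin \o f) \+ (EFin \o g) by [].
exact: integrableD.
Qed.

(** Integrability of the real and imaginary parts, in a form that does not
    distinguish the two kinds of scalars. *)
Definition sintegrable (D : set R) (q : R -> scalarField R s) :=
  forall a, mu.-integrable D (EFin \o (fun r => sRe (a * q r))).

Lemma sRe_sintegral (D : set R) (q : R -> scalarField R s) a : measurable D ->
  sintegrable D q -> sRe (a * sintegral D q) = \int[mu]_(r in D) sRe (a * q r).
Proof.
move=> mD; rewrite /sintegrable; case: s q a => /= q a iq.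
  rewrite RintegralZl//; have := iq 1; congr (is_true (integrable _ _ _)).
  by apply/funext => r /=; rewrite mul1r.
have i1 : mu.-integrable D (EFin \o (fun r => complex.Re (q r))).
  have := iq 1; congr (is_true (integrable _ _ _)).
  by apply/funext => r /=; rewrite mul1r.
have i2 : mu.-integrable D (EFin \o (fun r => complex.Im (q r))).
  have := iq (Complex 0 (-1)); congr (is_true (integrable _ _ _)).
  by apply/funext => r /=; case: (q r) => x y /=; rewrite mul0r mulN1r opprK add0r.
case: a => a1 a2 /=.
rewrite -!RintegralZl// -RintegralB//; last 2 first.
- have := iq (Complex a1 0); congr (is_true (integrable _ _ _)).
  by apply/funext => r /=; case: (q r) => x y /=; rewrite mul0r subr0.
- have := iq (Complex 0 (- a2)); congr (is_true (integrable _ _ _)).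
  by apply/funext => r /=; case: (q r) => x y /=; rewrite mul0r mulNr opprK add0r.
by apply: eq_Rintegral => r _; case: (q r).
Qed.

Lemma ae_Rintegral (D : set R) (f g : R -> R) : measurable D ->
  measurable_fun D f -> measurable_fun D g -> {ae mu, forall t, D t -> f t = g t} ->
  \int[mu]_(t in D) f t = \int[mu]_(t in D) g t.
Proof.
move=> mD mf mg fg; congr fine; apply: ae_eq_integral => //.
- exact/measurable_EFinP.
- exact/measurable_EFinP.
by apply: ae_mono fg => t h /h ->.
Qed.

Section WeightedProduct.
Context {H : hilbertType R s}.
Variables (D : set R) (k : R -> R) (f g : R -> H) (a b : R).
Hypotheses (mD : measurable D) (mk : measurable_fun D k).
Hypothesis k01 : forall r, D r -> 0 <= k r <= 1.
Hypotheses (sf : strongly_measurable D f) (sg : strongly_measurable D g).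
Hypotheses (fa : (l2sq D f <= a%:E)%E) (gb : (l2sq D g <= b%:E)%E).

Lemma l2_integrable (h : R -> H) (d : R) : strongly_measurable D h ->
  (l2sq D h <= d%:E)%E -> mu.-integrable D (EFin \o (fun r => nrm (h r) ^+ 2)).
Proof.
move=> sh hd; apply/integrableP; split; first exact: sm_nrm2.
apply: le_lt_trans (ltry d); apply: le_trans hd.
rewrite le_eqVlt; apply/predU1P; left; apply: eq_integral => r _ /=.
by rewrite ger0_norm ?sqr_ge0.
Qed.

Lemma weighted_product_measurable :
  measurable_fun D (fun r => k r * rin (f r) (g r)).
Proof. by apply: measurable_funM => //; exact: sm_rin. Qed.

Let dom_bound r : D r -> `|k r * rin (f r) (g r)| <= nrm (f r) ^+ 2 + nrm (g r) ^+ 2.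
Proof.
move=> /k01/andP[k0 k1]; rewrite normrM (ger0_norm k0).
apply: (@le_trans _ _ (1 * (nrm (f r) * nrm (g r)))).
  by apply: ler_pM => //; exact: CauchySchwarz.
have := sqr_ge0 (nrm (f r) - nrm (g r)); rewrite sqrrB mul1r.
have := sqr_ge0 (nrm (f r)); have := sqr_ge0 (nrm (g r)).
have : 0 <= nrm (f r) * nrm (g r) by rewrite mulr_ge0 ?nrm_ge0.
by rewrite -mulr_natr; lra.
Qed.

Let isum : mu.-integrable D (EFin \o (fun r => nrm (f r) ^+ 2 + nrm (g r) ^+ 2)).
Proof.
exact: integrable_add mD (l2_integrable sf fa) (l2_integrable sg gb).
Qed.

Lemma weighted_product_integrable :
  mu.-integrable D (EFin \o (fun r => k r * rin (f r) (g r))).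
Proof.
apply: le_integrable isum => //.
  by apply/measurable_EFinP; exact: weighted_product_measurable.
move=> r Dr; rewrite /= lee_fin (le_trans (dom_bound Dr))//.
exact: ler_norm.
Qed.

Lemma weighted_product_bound :
  `|\int[mu]_(r in D) (k r * rin (f r) (g r))| <= a + b.
Proof.
have iW := weighted_product_integrable.
apply: (@le_trans _ _ (\int[mu]_(r in D) `|k r * rin (f r) (g r)|)).
  exact: le_normr_Rintegral.
have iN : mu.-integrable D (EFin \o (fun r => `|k r * rin (f r) (g r)|)).
  by exact: (integrable_norm iW).
apply: (@le_trans _ _ (\int[mu]_(r in D) (nrm (f r) ^+ 2 + nrm (g r) ^+ 2))).
  by apply: le_Rintegral.
have i1 := l2_integrable sf fa; have i2 := l2_integrable sg gb.
rewrite RintegralD//.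
apply: lerD; rewrite /Rintegral.
- rewrite -lee_fin fineK; first exact: fa.
  exact: integrable_fin_num i1.
- rewrite -lee_fin fineK; first exact: gb.
  exact: integrable_fin_num i2.
Qed.

End WeightedProduct.
End ScalarIntegrals.

(** By homogeneity: both vectors can be normalised. *)
Lemma bilinear_bound {R : realType} {s : scalar_kind} {H : hilbertType R s}
    (b : H -> H -> R) (K : R) :
  (forall (r : R) x z, b (r *:: x) z = r * b x z) ->
  (forall (r : R) x z, b x (r *:: z) = r * b x z) ->
  (forall x z, `|b x z| <= K * (nrm x ^+ 2 + nrm z ^+ 2)) ->
  forall x z, `|b x z| <= 2 * K * nrm x * nrm z.
Proof.
move=> bl br bK x z.
have z0 v : b 0 v = 0 by rewrite -(scaler0 _ (sreal 0)) bl mul0r.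
have z1 v : b v 0 = 0 by rewrite -(scaler0 _ (sreal 0)) br mul0r.
have [->|x0] := eqVneq x 0; first by rewrite z0 normr0 nrm0 mulr0 mul0r.
have [->|y0] := eqVneq z 0; first by rewrite z1 normr0 nrm0 mulr0.
have np (v : H) : v != 0 -> 0 < nrm v.
  by move=> v0; rewrite lt_neqAle nrm_ge0 andbT eq_sym; apply: contra v0 => /eqP/nrm0_eq0 ->.
have := bK ((nrm x)^-1 *:: x) ((nrm z)^-1 *:: z).
have xp := np _ x0; have zp := np _ y0.
rewrite bl br !nrm_sZ !normfV !(ger0_norm (nrm_ge0 _)) !mulVf ?gt_eqF//.
rewrite !normrM !normfV !(ger0_norm (nrm_ge0 _)) expr1n mulrA -invfM mulrC.
by rewrite ler_pdivrMr ?mulr_gt0// => /le_trans; apply; rewrite le_eqVlt; apply/predU1P; left; ring.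
Qed.

(** The forms defining [Lambda] and [Pi], used with [w y] the observation of the
    backward orbit of [y] and [V r = S^*(-r)]. The observation is additive only
    almost everywhere, for each pair of vectors; after integration the forms
    are bilinear. *)
Section Forms.
Context {R : realType} {s : scalar_kind} {H U : hilbertType R s}.
Variables (w : H -> R -> U) (V : R -> bop H H) (T beta c c2 cw : R).
Local Notation mu := (@lebesgue_measure R).
Hypotheses (T0 : 0 < T) (beta0 : 0 <= beta) (c0 : 0 <= c) (c20 : 0 <= c2) (cw0 : 0 <= cw).
Hypothesis cV : forall y, continuous (fun r => V r y).
Hypothesis wsm : forall y, strongly_measurable `[0, T]%classic (w y).
Hypothesis wb : forall y, (l2sq `[0%R, T] (w y) <= (cw * nrm y ^+ 2)%:E)%E.
Hypothesis wlin : forall (a : scalarField R s) y z,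
  {ae mu, forall r, `[0, T]%classic r -> w (a *: y + z) r = a *: w y r + w z r}.

Let e r := expR (- (beta * r)).

Let me D : measurable D -> measurable_fun D e.
Proof.
move=> mD; apply: measurable_funTS; apply: continuous_measurable_fun => r.
apply: (cvg_comp _ expR _ (@continuous_expR _ _)).
by apply: cvgN; apply: cvgM; [exact: cvg_cst|exact: cvg_id].
Qed.

Let e01 r : 0 <= r -> 0 <= e r <= 1.
Proof. by move=> r0; rewrite expR_ge0 /= -expR0 ler_expR oppr_le0 mulr_ge0. Qed.

Let sub t : t <= T -> `[0, t]%classic `<=` `[0, T]%classic.
Proof. by move=> tT; apply: subset_itvl; rewrite bnd_simp. Qed.

Let l2t t y : t <= T -> (l2sq `[0%R, t] (w y) <= (cw * nrm y ^+ 2)%:E)%E.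
Proof.
move=> tT; apply: le_trans (wb y); apply: ge0_subset_integral => //; last exact: sub.
- exact: (sm_nrm2 (wsm y)).
- by move=> r _; rewrite lee_fin sqr_ge0.
Qed.

Let wint t y z : t <= T -> mu.-integrable `[0, t] (EFin \o (fun r => e r * rin (w y r) (w z r))).
Proof.
move=> tT; have mt : measurable `[0, t]%classic by exact: measurable_itv.
apply: weighted_product_integrable (l2t y tT) (l2t z tT) => //.
- exact: me.
- by move=> r; rewrite /= in_itv /= => /andP[r0 _]; exact: e01.
- exact: sm_subset (sub tT) (wsm y).
- exact: sm_subset (sub tT) (wsm z).
Qed.

Definition obs_form t y z := \int[mu]_(r in `[0, t]) (e r * rin (w y r) (w z r)).

Lemma obs_form_sym t y z : obs_form t y z = obs_form t z y.
Proof. by apply: eq_Rintegral => r _; rewrite rinC. Qed.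

Lemma obs_form_comb t (r : R) x y z : t <= T ->
  obs_form t (r *:: x + y) z = r * obs_form t x z + obs_form t y z.
Proof.
move=> tT; rewrite /obs_form -RintegralZl//; last exact: wint.
have i1 : mu.-integrable `[0, t] (EFin \o (fun p => r * (e p * rin (w x p) (w z p)))).
  by apply: integrable_scale => //; exact: wint.
have i2 := wint y z tT.
rewrite -RintegralD//.
apply: ae_Rintegral => //.
- have /integrableP[+ _] := wint (r *:: x + y) z tT.
  by move=> /measurable_EFinP.
- by apply: measurable_funD; apply/measurable_EFinP; [have /integrableP[] := i1|have /integrableP[] := i2].
apply: ae_mono (wlin (sreal r) x y) => p h pt.
rewrite h ?rinDl ?rinZl; first by ring.
by move: pt; rewrite /= !in_itv /= => /andP[-> pt]; exact: le_trans tT.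
Qed.

Lemma obs_form_scale t (a : scalarField R s) y z : t <= T ->
  obs_form t (a *: y) z = \int[mu]_(r in `[0, t]) (e r * rin (a *: w y r) (w z r)).
Proof.
move=> tT; apply: ae_Rintegral => //.
- by have /integrableP[+ _] := wint (a *: y) z tT; move=> /measurable_EFinP.
- apply: measurable_funM; first exact: me.
    by apply: sm_rin; [apply: sm_scale|]; exact: sm_subset (sub tT) (wsm _).
(* The case [z = 0] of linearity needs [w 0 = 0] almost everywhere. *)
have h0 := wlin (-1) y y; rewrite scaleN1r addNr in h0.
have := wlin a y 0; rewrite addr0 => /(ae_and h0); apply: ae_mono => p [w0 wa] pt.
have pT : `[0, T]%classic p.
  by move: pt; rewrite /= !in_itv /= => /andP[-> pt]; exact: le_trans tT.
by rewrite wa// w0// scaleN1r addNr addr0.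
Qed.

Lemma obs_form_bound t y z : t <= T ->
  `|obs_form t y z| <= cw * (nrm y ^+ 2 + nrm z ^+ 2).
Proof.
move=> tT; rewrite mulrDr; apply: weighted_product_bound (l2t y tT) (l2t z tT) => //.
- exact: me.
- by move=> r; rewrite /= in_itv /= => /andP[r0 _]; exact: e01.
- exact: sm_subset (sub tT) (wsm y).
- exact: sm_subset (sub tT) (wsm z).
Qed.

Lemma obs_form_continuous y z : {within `[0, T], continuous (fun t => obs_form t y z)}.
Proof. exact: parameterized_integral_continuous (ltW T0) (wint y z (lexx T)). Qed.

Lemma obs_form_ge0 t y : 0 <= obs_form t y y.
Proof.
by apply: Rintegral_ge0 => r _; rewrite rinxx mulr_ge0 ?sqr_ge0// expR_ge0.
Qed.

(** The real part of the form of [Lambda t] at [rd y] and [rd z]. *)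
Definition Lform t y z := c * obs_form t y z + c2 * e t * rin (V t y) (V t z).

Lemma Lform_sym t y z : Lform t y z = Lform t z y.
Proof. by rewrite /Lform obs_form_sym rinC. Qed.

Lemma Lform_comb t (r : R) x y z : t <= T ->
  Lform t (r *:: x + y) z = r * Lform t x z + Lform t y z.
Proof.
by move=> tT; rewrite /Lform obs_form_comb// bopDr bop_sZ rinDl rinZl; ring.
Qed.

Lemma Lform_scale t (a : scalarField R s) y z : t <= T ->
  Lform t (a *: y) z = Lform t y (sconj a *: z).
Proof.
move=> tT; rewrite /Lform !bopZr rin_sconj; congr (_ * _ + _).
rewrite [RHS]obs_form_sym !obs_form_scale//; apply: eq_Rintegral => r _.
by rewrite rin_sconj rinC.
Qed.

(** Values of the complex form are recovered from the real parts of their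
    multiples. *)
Lemma Lform_scalar t (a : scalarField R s) y z : 0 <= t <= T ->
  sRe (a * (sreal c * sintegral `[0, t] (fun r => sreal (e r) * inner (w y r) (w z r)) +
    sreal (c2 * e t) * inner (V t y) (V t z))) = Lform t (a *: y) z.
Proof.
move=> /andP[t0 tT]; have mt : measurable `[0, t]%classic by exact: measurable_itv.
have E b r : sRe (b * (sreal (e r) * inner (w y r) (w z r))) = e r * rin (b *: w y r) (w z r).
  by rewrite mulrCA sRe_srealM /rin innerZl.
rewrite mulrDr [a * (sreal c * _)]mulrCA [a * (sreal (c2 * _) * _)]mulrCA.
rewrite raddfD /= !sRe_srealM sRe_sintegral//.
  rewrite /Lform bopZr /rin innerZl obs_form_scale//; congr (_ * _ + _).
  by apply: eq_Rintegral => r _; exact: E.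
move=> b; have -> : (fun r => sRe (b * (sreal (e r) * inner (w y r) (w z r)))) =
    (fun r => e r * rin (b *: w y r) (w z r)) by apply/funext => r; exact: E.
apply: (weighted_product_integrable (a := sRe `|b| ^+ 2 * (cw * nrm y ^+ 2))) (l2t z tT) => //.
- exact: me.
- by move=> r; rewrite /= in_itv /= => /andP[r0 _]; exact: e01.
- by apply: sm_scale; exact: sm_subset (sub tT) (wsm y).
- exact: sm_subset (sub tT) (wsm z).
have -> : l2sq `[0, t] (fun r => b *: w y r) = ((sRe `|b| ^+ 2)%:E * l2sq `[0%R, t] (w y))%E.
  rewrite /l2sq -ge0_integralZl//; last 3 first.
  - exact: sm_nrm2 (sm_subset (sub tT) (wsm y)).
  - by move=> r _; rewrite lee_fin sqr_ge0.
  - by rewrite lee_fin sqr_ge0.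
  by apply: eq_integral => r _; rewrite nrmZ exprMn EFinM.
by rewrite [leRHS]EFinM; apply: lee_wpmul2l; rewrite ?lee_fin ?sqr_ge0//; exact: l2t.
Qed.

Lemma Lform_bound : exists2 K : R, 0 <= K &
  forall t y z, 0 <= t <= T -> `|Lform t y z| <= K * nrm y * nrm z.
Proof.
have [M M0 hM] := strong_local_bound cV T.
exists (2 * (c * cw) + c2 * M ^+ 2) => [|t y z /andP[t0 tT]].
  by rewrite addr_ge0// !mulr_ge0 ?sqr_ge0.
have b1 : `|obs_form t y z| <= 2 * cw * nrm y * nrm z.
  apply: bilinear_bound.
  - move=> r x v; rewrite -(addr0 (r *:: x)) obs_form_comb//.
    have /= := @obs_form_comb t 1 0 0 v tT; rewrite sreal1 scale1r addr0 mul1r => /eqP.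
    by rewrite -subr_eq subrr => /eqP <-; rewrite addr0.
  - move=> r x v; rewrite !(obs_form_sym _ x) -(addr0 (r *:: v)) obs_form_comb//.
    have /= := @obs_form_comb t 1 0 0 x tT; rewrite sreal1 scale1r addr0 mul1r => /eqP.
    by rewrite -subr_eq subrr => /eqP <-; rewrite addr0.
  - by move=> x v; exact: obs_form_bound.
have b2 : `|rin (V t y) (V t z)| <= M ^+ 2 * nrm y * nrm z.
  apply: le_trans (CauchySchwarz _ _) _.
  have hV y' : nrm (V t y') <= M * nrm y'.
    by rewrite (le_trans (le_opnorm _ _))// ler_wpM2r ?nrm_ge0// hM// ger0_norm.
  have := ler_pM (nrm_ge0 _) (nrm_ge0 _) (hV y) (hV z).
  by move=> /le_trans; apply; rewrite le_eqVlt; apply/predU1P; left; ring.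
rewrite /Lform; apply: le_trans (ler_normD _ _) _.
rewrite !normrM (ger0_norm c0) (ger0_norm c20) (ger0_norm (expR_ge0 _)).
have /andP[e0 e1] := e01 t0.
have h1 := ler_wpM2l c0 b1; have h2 := ler_wpM2l c20 b2.
have h3 : c2 * e t * `|rin (V t y) (V t z)| <= c2 * `|rin (V t y) (V t z)|.
  by rewrite mulrAC ler_piMr// mulr_ge0.
rewrite -/(e t); by lra.
Qed.

Lemma Lform_integrable y z : mu.-integrable `[0, T] (EFin \o (fun t => Lform t y z)).
Proof.
apply: continuous_compact_integrable; first exact: segment_compact.
move=> t; apply: cvgD.
  by apply: cvgM; [exact: cvg_cst|exact: obs_form_continuous].
have cr : continuous (fun t => c2 * e t * rin (V t y) (V t z)).
  move=> r; apply: cvgM; last by apply: cvg_rin; exact: cV.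
  apply: cvgM; first exact: cvg_cst.
  apply: (cvg_comp _ expR _ (@continuous_expR _ _)).
  by apply: cvgN; apply: cvgM; [exact: cvg_cst|exact: cvg_id].
exact: (continuous_subspaceT cr).
Qed.

(** The real part of the form of [Pi] at [rd y] and [rd z]. *)
Definition Pform y z := \int[mu]_(t in `[0, T]) Lform t y z.

Lemma Pform_sym y z : Pform y z = Pform z y.
Proof. by apply: eq_Rintegral => t _; rewrite Lform_sym. Qed.

Let tT_of t : t \in `[0, T]%classic -> t <= T.
Proof. by rewrite inE /= in_itv /= => /andP[]. Qed.

Lemma Pform_comb (r : R) x y z : Pform (r *:: x + y) z = r * Pform x z + Pform y z.
Proof.
have i1 := Lform_integrable x z; have i2 := Lform_integrable y z.
rewrite /Pform -RintegralZl// -RintegralD//; last exact: integrable_scale.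
by apply: eq_Rintegral => t /tT_of tT; rewrite Lform_comb.
Qed.

Lemma Pform_scale (a : scalarField R s) y z : Pform (a *: y) z = Pform y (sconj a *: z).
Proof. by apply: eq_Rintegral => t /tT_of tT; rewrite Lform_scale. Qed.

Lemma Pform_scalar (q : R -> scalarField R s) (a : scalarField R s) y z :
  (forall t b, 0 <= t <= T -> sRe (b * q t) = Lform t (b *: y) z) ->
  sRe (a * sintegral `[0, T] q) = Pform (a *: y) z.
Proof.
move=> hq; have mT : measurable `[0, T]%classic by exact: measurable_itv.
rewrite sRe_sintegral//.
  by apply: eq_Rintegral => t; rewrite inE /= in_itv /= => tT; rewrite hq.
move=> b; apply: eq_integrable (Lform_integrable (b *: y) z) => //.
by move=> t; rewrite inE /= in_itv /= => tT; rewrite hq.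
Qed.

Lemma const_integrable (r : R) : mu.-integrable `[0, T] (EFin \o (fun=> r)).
Proof. by apply: continuous_integrable => t; exact: cst_continuous. Qed.

Lemma Rint_cst (r : R) : \int[mu]_(_ in `[0, T]) r = r * T.
Proof.
by rewrite Rintegral_cst//= lebesgue_measure_itv /= lte_fin T0 oppr0 addr0.
Qed.

Lemma Pform_bound : exists2 K : R, 0 <= K & forall y z, `|Pform y z| <= K * nrm y * nrm z.
Proof.
have [K K0 hK] := Lform_bound; exists (K * T) => [|y z]; first by rewrite mulr_ge0// ltW.
have iL := Lform_integrable y z.
apply: le_trans (le_normr_Rintegral _ iL) _; first exact: measurable_itv.
have -> : K * T * nrm y * nrm z = \int[mu]_(_ in `[0, T]) (K * nrm y * nrm z).
  by rewrite Rint_cst; ring.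
apply: le_Rintegral => //; last by move=> t; rewrite /= in_itv /= => tT; exact: hK.
  by exact: (integrable_norm iL).
exact: const_integrable.
Qed.

(** The term in [V] already dominates [nrm y ^+ 2] at each time, since [V] has
    the locally bounded inverse [W]. *)
Lemma Pform_coercive (W : R -> bop H H) : (forall t, cancel (V t) (W t)) ->
  (forall y, continuous (fun r => W r y)) -> 0 < c2 ->
  exists2 kappa : R, 0 < kappa & forall y, kappa * nrm y ^+ 2 <= Pform y y.
Proof.
move=> VW cW c2p; have [M M0 hM] := strong_local_bound cW T.
have M1 : 0 < M + 1 by rewrite ltr_wpDl.
pose k := c2 * e T / (M + 1) ^+ 2.
have k0 : 0 < k by rewrite divr_gt0 ?exprn_gt0// mulr_gt0// expR_gt0.
exists (k * T) => [|y]; first by rewrite mulr_gt0.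
have -> : k * T * nrm y ^+ 2 = \int[mu]_(_ in `[0, T]) (k * nrm y ^+ 2).
  by rewrite Rint_cst; ring.
apply: le_Rintegral => //; [exact: const_integrable|exact: Lform_integrable|].
move=> t; rewrite /= in_itv /= => /andP[t0 tT].
have h1 : nrm y <= (M + 1) * nrm (V t y).
  rewrite -{1}(VW t y) (le_trans (le_opnorm _ _))// ler_wpM2r ?nrm_ge0//.
  by rewrite (le_trans (hM t _)) ?lerDl// ger0_norm.
have h2 : nrm y ^+ 2 <= (M + 1) ^+ 2 * nrm (V t y) ^+ 2.
  rewrite -exprMn lerXn2r ?nnegrE ?nrm_ge0//.
  by rewrite mulr_ge0 ?nrm_ge0// ltW.
have eT : e T <= e t by rewrite ler_expR lerN2 ler_wpM2l.
have h3 : k * nrm y ^+ 2 <= c2 * e T * nrm (V t y) ^+ 2.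
  have := ler_wpM2l (ltW k0) h2.
  have -> // : k * ((M + 1) ^+ 2 * nrm (V t y) ^+ 2) = c2 * e T * nrm (V t y) ^+ 2.
  by rewrite /k; field; rewrite gt_eqF.
apply: (le_trans h3); rewrite /Lform rinxx.
have h4 : c2 * e T * nrm (V t y) ^+ 2 <= c2 * e t * nrm (V t y) ^+ 2.
  by rewrite ler_wpM2r ?sqr_ge0// ler_wpM2l.
by apply: (le_trans h4); rewrite lerDr mulr_ge0// obs_form_ge0.
Qed.

End Forms.

(** The compatibility with scalars makes the operator given by the real Riesz
    theorem linear over the scalars, and not only over the reals. *)
Lemma form_operator {R : realType} {s : scalar_kind} {H : hilbertType R s}
    (b : H -> H -> R) (K : R) :
  (forall (r : R) x y z, b (r *:: x + y) z = r * b x z + b y z) ->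
  (forall x y, b x y = b y x) ->
  (forall (a : scalarField R s) y z, b (a *: y) z = b y (sconj a *: z)) ->
  0 <= K -> (forall y z, `|b y z| <= K * nrm y * nrm z) ->
  exists L : bop H H, forall y z, rin (L y) z = b y z.
Proof.
move=> bl bC ba K0 bK.
have b0 z : b 0 z = 0.
  by have := bl 1 0 0 z; rewrite sreal1 scale1r addr0 mul1r => h; lra.
have bD x y z : b (x + y) z = b x z + b y z.
  by have := bl 1 x y z; rewrite sreal1 scale1r mul1r.
have bZ (r : R) x z : b (r *:: x) z = r * b x z.
  by have := bl r x 0 z; rewrite addr0 b0 addr0.
have /choice[L hL] y : exists x, forall z, b y z = rin x z.
  apply: (@real_riesz _ _ _ (b y) (K * nrm y)).
  - by move=> x z; rewrite !(bC y) bD.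
  - by move=> r x; rewrite !(bC y) bZ.
  - by move=> x; exact: le_trans (ler_norm _) (bK y x).
have Lb : bounded_op L.
  apply: (@bounded_opP _ _ _ _ _ K).
  - by move=> x y; apply: rin_inj => z; rewrite rinDl -!hL bD.
  - by move=> a x; apply: rin_inj => z; rewrite rin_sconj -!hL ba.
  - move=> x; apply: nrm_le_rin => [|z]; first by rewrite mulr_ge0 ?nrm_ge0.
    by rewrite -hL; exact: le_trans (ler_norm _) (bK x z).
by exists (mkbop Lb) => y z; rewrite hL.
Qed.

(** * The Riccati identity *)

Section WindowedIntegral.
Context {R : realType}.
Local Notation mu := (@lebesgue_measure R).
Implicit Types (u F : R -> R) (a b t r : R).

Lemma Rintegral_derive u F a b : continuous u -> a <= b ->
  (forall t, is_derive t 1 F (u t)) -> \int[mu]_(t in `[a, b]) u t = F b - F a.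
Proof. by move=> cu ab Fu; rewrite /Rintegral (integral_derive cu ab Fu). Qed.

Lemma is_derive_shift F (a t d : R) : is_derive (t + a) 1 F d ->
  is_derive t 1 (fun t => F (t + a)) d.
Proof.
move=> dF; have h : is_derive t 1 (fun t : R => t + a) 1 by apply: is_derive_eq; rewrite addr0.
by have := @is_derive1_comp R F (fun t => t + a) t _ _ dF h; rewrite mulr1.
Qed.

Lemma is_derive_mirror F (a t d : R) : is_derive (a - t) 1 F d ->
  is_derive t 1 (fun t => F (a - t)) (- d).
Proof.
move=> dF; have h : is_derive t 1 (fun t : R => a - t) (-1).
  by apply: is_derive_eq; rewrite add0r mul1r.
by have := @is_derive1_comp R F (fun t => a - t) t _ _ dF h; rewrite mulrN1.
Qed.

Lemma is_derive_scale F (a t d : R) : is_derive t 1 F d ->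
  is_derive t 1 (fun t => a * F t) (a * d).
Proof. by move=> dF; exact: (is_deriveZ a dF). Qed.

Lemma continuous_mirror u a : continuous u -> continuous (fun t => u (a - t)).
Proof.
move=> cu t; apply: (cvg_comp _ u _ (cu _)); apply: cvgB; [exact: cvg_cst|exact: cvg_id].
Qed.

Lemma continuous_scale u a : continuous u -> continuous (fun t => a * u t).
Proof. by move=> cu t; apply: cvgM; [exact: cvg_cst|exact: cu]. Qed.

Lemma continuous_exp_mul u b : continuous u -> continuous (fun t => expR (b * t) * u t).
Proof.
move=> cu t; apply: cvgM; last exact: cu.
apply: (cvg_comp _ expR _ (@continuous_expR _ _)).
by apply: cvgM; [exact: cvg_cst|exact: cvg_id].
Qed.

Variables (q m : R -> R) (c c2 beta T : R).
Hypotheses (cq : continuous q) (cm : continuous m) (T0 : 0 <= T).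

(** [Lform t] along the orbit, at time [rho], in terms of the two functions [q]
    and [m] of the time alone. *)
Definition window (t rho : R) := c * \int[mu]_(r in `[0, t]) (expR (- (beta * r)) * q (rho - r)) +
  c2 * expR (- (beta * t)) * m (rho - t).

(** With [Q' = e^(beta r) q], [QQ' = Q] and [N' = e^(beta r) m], the substitution
    [r -> rho - r] turns the integral into
    [e^(- beta rho) (c (T Q(rho) - QQ(rho) + QQ(rho - T)) + c2 (N(rho) - N(rho - T)))]. *)
Lemma windowed_derive : is_derive (0 : R) 1
  (fun rho => \int[mu]_(t in `[0, T]) window t rho)
  (c * T * q 0 + c2 * m 0 - window T 0 - beta * \int[mu]_(t in `[0, T]) window t 0).
Proof.
have [Q [_ dQ]] := primitive_ex (continuous_exp_mul (b := beta) cq).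
have cQ : continuous Q by exact: derive_continuous dQ.
have [QQ [_ dQQ]] := primitive_ex cQ.
have [N [_ dN]] := primitive_ex (continuous_exp_mul (b := beta) cm).
have ex (rho r : R) : expR (- (beta * rho)) * expR (beta * (rho - r)) = expR (- (beta * r)).
  by rewrite -expRD; congr expR; ring.
have E1 (t rho : R) : 0 <= t -> window t rho =
    expR (- (beta * rho)) * (c * (Q rho - Q (rho - t)) + c2 * (expR (beta * (rho - t)) * m (rho - t))).
  move=> t0; rewrite /window -(ex rho t).
  have -> : \int[mu]_(r in `[0, t]) (expR (- (beta * r)) * q (rho - r)) =
      - expR (- (beta * rho)) * Q (rho - t) - (- expR (- (beta * rho)) * Q (rho - 0)).
    apply: (@Rintegral_derive _ (fun r => - expR (- (beta * rho)) * Q (rho - r))) => //.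
    - have -> : (fun r => expR (- (beta * r)) * q (rho - r)) =
          (fun r => expR ((- beta) * r) * q (rho - r)) by apply/funext => r; rewrite mulNr.
      by apply: continuous_exp_mul; exact: continuous_mirror.
    - move=> r; rewrite -(ex rho r).
      have d := is_derive_scale (- expR (- (beta * rho))) (is_derive_mirror (dQ (rho - r))).
      by apply: (is_derive_eq d); ring.
  by rewrite subr0; ring.
have E2 (rho : R) : \int[mu]_(t in `[0, T]) window t rho =
    expR (- (beta * rho)) * (c * (T * Q rho + QQ (rho + - T) - QQ rho) - c2 * (N (rho + - T) - N rho)).
  pose G t := expR (- (beta * rho)) * (c * (t * Q rho + QQ (rho - t)) - c2 * N (rho - t)).
  transitivity (G T - G 0); last by rewrite /G subr0; ring.
  pose g t := expR (- (beta * rho)) * (c * (Q rho - Q (rho - t)) + c2 * (expR (beta * (rho - t)) * m (rho - t))).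
  transitivity (\int[mu]_(t in `[0, T]) g t).
    by apply: eq_Rintegral => t; rewrite inE /= in_itv /= => /andP[t0 _]; exact: E1.
  apply: Rintegral_derive => //.
    apply: continuous_scale => t; apply: cvgD.
      apply: cvgM; first exact: cvg_cst.
      by apply: cvgB; [exact: cvg_cst|exact: continuous_mirror].
    have := continuous_mirror (a := rho) (continuous_exp_mul (b := beta) cm).
    by move=> h; apply: cvgM; [exact: cvg_cst|exact: h].
  move=> t; apply: is_derive_scale.
  have d1 := @is_derive_mirror _ rho t _ (dQQ (rho - t)).
  have d2 := @is_derive_mirror _ rho t _ (dN (rho - t)).
  have d3 : is_derive t 1 (fun t : R => t * Q rho) (Q rho).
    by apply: is_derive_eq; rewrite scaler0 add0r /GRing.scale /= mulr1.
  have d4 := is_derive_scale c (is_deriveD d3 d1).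
  have d5 := is_derive_scale c2 d2.
  have d6 := is_deriveB d4 d5.
  by apply: (is_derive_eq d6); ring.
rewrite E2 E1// (funext E2).
have d1 := @is_derive_shift QQ (- T) 0 _ (dQQ _).
have d2 := @is_derive_shift N (- T) 0 _ (dN _).
have d3 := is_derive_scale T (dQ 0).
have d4 := is_derive_scale c (is_deriveB (is_deriveD d3 d1) (dQQ 0)).
have d5 := is_derive_scale c2 (is_deriveB d2 (dN 0)).
have d6 := is_deriveB d4 d5.
have d7 : is_derive (0 : R) 1 (fun t => expR (- (beta * t))) (- beta * expR (- beta * 0)).
  have -> : (fun t => expR (- (beta * t))) = (fun t => expR (- beta * t)).
    by apply/funext => t; rewrite mulNr.
  exact: is_derive_expRM.
have d8 := is_deriveM d7 d6.
apply: (is_derive_eq d8).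
rewrite /GRing.scale /= !fctE /= !(mulr0, oppr0, expR0, add0r, sub0r).
by ring.
Qed.

End WindowedIntegral.

(** * The operators [Pi] and [Lambda(T)] on the Hilbert space *)

Lemma integral_reflect {R : realType} (f : R -> \bar R) (T : R) :
  measurable_fun `[- T, 0]%classic f -> (forall t, 0 <= f t)%E ->
  (\int[@lebesgue_measure R]_(t in `[0%R, T]) f (- t)%R =
   \int[@lebesgue_measure R]_(t in `[(- T)%R, 0%R]) f t)%E.
Proof.
move=> mf f0.
transitivity (\int[pushforward (@lebesgue_measure R) (-%R : R -> measurableTypeR R)]_(t in
    `[(- T)%R, 0%R]) f t)%E.
  rewrite ge0_integral_pushforward//.
  by rewrite opp_preimage_itvbndbnd oppr0 opprK.
by apply: eq_measure_integral => //= X mX _; exact/lebesgue_measureN.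
Qed.

Section Gramian.
Context {R : realType} {s : scalar_kind} {H U : hilbertType R s}.
Variables (S : R -> bop H H) (A : unbounded H H) (B : U -> dual H -> (scalarField R s)^o).
Hypotheses (gS : C0_group S) (genA : generates 0^' S A).
Hypothesis hB : bounded_to_dual (adjoint A) B.
Hypothesis admissible : forall T : R, 0 < T -> exists C : R, 0 < C /\
  forall f : dual H, dom (adjoint A) f ->
    (l2sq `[0%R, T] (observation S B f) <= (C * nrm f ^+ 2)%:E)%E.
Local Notation mu := (@lebesgue_measure R).
Local Notation Ddom := (Dd A).
Local Notation E := (observation_ext A S B).
Local Notation orb := (orb S B).

Definition backward_observation (y : H) (r : R) : U := riesz (E (rd y) (- r)).
Local Notation w := backward_observation.
Local Notation V := (fun r => Sd S (- r)).

Let ext := observation_extP gS genA hB admissible.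

Lemma backward_measurable (T : R) y : 0 < T -> strongly_measurable `[0, T]%classic (w y).
Proof.
move=> T0; have [L _ _ _] := ext; have [sm _] := L (rd y) T T0.
have := sm_reflect (D := `[0, T]%classic) _ sm; rewrite /w => h.
apply: (@sm_lipschitz _ _ _ _ (@riesz R s U) 1); last first.
  apply: h => t; rewrite /= !in_itv /= => /andP[t0 tT].
  by rewrite lerN2 tT /= (le_trans _ (ltW T0))// oppr_le0.
by move=> x y'; rewrite -rieszB nrm_riesz mul1r.
Qed.

Lemma backward_bound (T : R) : 0 < T -> exists2 c : R, 0 <= c &
  forall y, (l2sq `[0%R, T] (w y) <= (c * nrm y ^+ 2)%:E)%E.
Proof.
move=> T0; have [L _ bd _] := ext; have [c hc] := bd T T0.
exists `|c| => // y; have [sm _] := L (rd y) T T0.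
have m2 : measurable_fun `[- T, 0]%classic (fun t => (nrm (E (rd y) t) ^+ 2)%:E).
  by apply: sm_nrm2; apply: sm_subset sm; apply: subset_itvl; rewrite bnd_simp ltW.
have -> : l2sq `[0, T] (w y) = l2sq `[- T, 0] (E (rd y)).
  rewrite /l2sq -(integral_reflect m2); last by move=> t; rewrite lee_fin sqr_ge0.
  by apply: eq_integral => t _; rewrite /w nrm_riesz.
have -> : nrm y = nrm (rd y) by rewrite nrm_rd.
apply: (@le_trans _ _ (l2sq `[- T, T] (E (rd y)))).
  apply: ge0_subset_integral => //.
  - exact: sm_nrm2 sm.
  - by move=> t _; rewrite lee_fin sqr_ge0.
  - by apply: subset_itvl; rewrite bnd_simp ltW.
by apply: le_trans (hc _) _; rewrite lee_fin ler_wpM2r ?sqr_ge0// ler_norm.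
Qed.

Lemma backward_linear (a : scalarField R s) y z :
  {ae mu, forall r, w (a *: y + z) r = a *: w y r + w z r}.
Proof.
have [_ lin _ _] := ext; apply: ae_mono (ae_reflect (lin (sconj a) (rd y) (rd z))) => r h.
by rewrite /w rdD rdZ h rieszD rieszZ sconjK.
Qed.

Lemma backward_orb y : Ddom y -> {ae mu, forall r, w y r = orb y (- r)}.
Proof.
move=> Dy; have [_ _ _ obs] := ext; apply: ae_mono (ae_reflect (obs _ Dy)) => r h.
by rewrite /w h observation_orb rdK.
Qed.

Variables (alpha C1 C2 eps T : R).
Hypotheses (T0 : 0 < T) (C10 : 0 <= C1) (C20 : 0 < C2) (beta0 : 0 <= alpha - eps).
Local Notation beta := (alpha - eps).
Local Notation c := (C1 * expR (alpha * T)).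

(** The operators exist because their forms are bounded, and they represent
    the chosen values of [Lambda] and [Pi] because those are determined by the
    real parts of the multiples of their forms. *)
Lemma gramian_ex : exists P L : bop H H,
  [/\ forall y, Pi A S B alpha C1 C2 eps T (rd y) = P y,
      forall x y, rin (P x) y = rin (P y) x,
      exists2 kappa : R, 0 < kappa & forall y, kappa * nrm y ^+ 2 <= rin (P y) y,
      forall y z, rin (P y) z = Pform w V T beta c C2 y z
    & forall y z, rin (L y) z = Lform w V beta c C2 T y z].
Proof.
have [cw cw0 wb] := backward_bound T0.
have wsm y := backward_measurable y T0.
have wlin (a : scalarField R s) y z :
    {ae mu, forall r, `[0, T]%classic r -> w (a *: y + z) r = a *: w y r + w z r}.
  by apply: ae_mono (backward_linear a y z) => r ->.
have c0 : 0 <= c by rewrite mulr_ge0// expR_ge0.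
have cS := group_continuous (Sd_group gS genA).
have cV y : continuous (fun r => Sd S (- r) y).
  by move=> t; apply: (cvg_comp _ (fun r => Sd S r y) _ (cS y _)); apply: cvgN; exact: cvg_id.
have c20 := ltW C20.
have [K K0 hK] := Lform_bound beta0 c0 c20 cw0 cV wsm wb wlin.
have /choice[Lt hLt] (t : R) : exists L : bop H H, 0 <= t <= T ->
    forall y z, rin (L y) z = Lform w V beta c C2 t y z.
  have [tT|] := boolP (0 <= t <= T); last by exists 0.
  have tT' : t <= T by case/andP: tT.
  have [L hL] := @form_operator _ _ _ (Lform w V beta c C2 t) K
    (fun r x y z => Lform_comb V c C2 beta0 wsm wb wlin r x y z tT')
    (Lform_sym w V beta c C2 t)
    (fun a y z => Lform_scale V c C2 beta0 wsm wb wlin a y z tT') K0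
    (fun y z => hK t y z tT).
  by exists L.
have [K' K'0 hK'] := Pform_bound T0 beta0 c0 c20 cw0 cV wsm wb wlin.
have [P hP] := @form_operator _ _ _ (Pform w V T beta c C2) K'
    (Pform_comb c C2 T0 beta0 cV wsm wb wlin)
    (Pform_sym w V T beta c C2)
    (Pform_scale V c C2 beta0 wsm wb wlin) K'0 hK'.
have LambdaE t y : 0 <= t <= T -> Lambda A S B alpha C1 C2 eps T t (rd y) = Lt t y.
  move=> tT; have ok (g : dual H) : g (Lt t y) = Lambda_form A S B alpha C1 C2 eps T t (rd y) g.
    rewrite -(rieszK g); apply: sRe_inj => a; rewrite rdE.
    have := Lform_scalar V c C2 beta0 wsm wb wlin a y (riesz g) tT.
    have -> : sRe (a * inner (Lt t y) (riesz g)) = rin (Lt t (a *: y)) (riesz g).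
      by rewrite bopZr /rin innerZl.
    rewrite hLt// => <-; rewrite /Lambda_form !rd_Sd rdK rdE.
    congr (sRe (_ * (_ * sintegral _ _ + _))); apply/funext => r.
    by rewrite -(rieszE (E (rd (riesz g)) (- r))).
  rewrite /Lambda; case: xgetP => [x _ /= hx|/(_ (Lt t y)) []//].
  by apply: rin_inj => z; rewrite /rin -!rdE hx ok.
exists P, (Lt T); split.
- move=> y.
  have ok (g : dual H) : g (P y) = sintegral `[0, T] (fun t => g (Lambda A S B alpha C1 C2 eps T t (rd y))).
    rewrite -(rieszK g); apply: sRe_inj => a; rewrite rdE.
    rewrite (@Pform_scalar _ _ _ _ w V T beta c C2 cw T0 beta0 cV wsm wb _ a y (riesz g)).
      by rewrite -hP bopZr /rin innerZl.
    by move=> t b tT; rewrite -hLt// LambdaE// rdE bopZr /rin innerZl.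
  rewrite /Pi; case: xgetP => [x _ /= hx|/(_ (P y)) []//].
  by apply: rin_inj => z; rewrite /rin -!rdE hx ok.
- by move=> x y; rewrite !hP Pform_sym.
- have VW t : cancel (Sd S (- t)) (Sd S t).
    by move=> y; have [S0 Sa _] := Sd_group gS genA; rewrite -Sa subrr S0.
  have [kappa k0 hk] := Pform_coercive T0 beta0 c0 c20 cV wsm wb VW cS C20.
  by exists kappa => // y; rewrite hP.
- exact: hP.
- by move=> y z; rewrite hLt// (ltW T0) lexx.
Qed.

Let cq y z : Ddom y -> Ddom z -> continuous (fun r => rin (orb y r) (orb z r)).
Proof.
by move=> Dy Dz; apply: continuous_rin; apply: (orb_continuous gS genA hB).
Qed.

Let cexp u : continuous u -> continuous (fun r : R => expR (- (beta * r)) * u r).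
Proof.
move=> cu; have -> : (fun r => expR (- (beta * r)) * u r) = (fun r => expR (- beta * r) * u r).
  by apply/funext => r; rewrite mulNr.
exact: continuous_exp_mul.
Qed.

(** On the domain the extension is the observation itself, so that the form
    only involves values at earlier times of two continuous functions. *)
Lemma Lform_window t rho y z : 0 <= t -> Ddom y -> Ddom z ->
  Lform w V beta c C2 t (Sd S rho y) (Sd S rho z) =
  window (fun r => rin (orb y r) (orb z r)) (fun r => rin (Sd S r y) (Sd S r z)) c C2 beta t rho.
Proof.
move=> t0 Dy Dz; have [Sd0 SdD _] := Sd_group gS genA.
rewrite /Lform /window -!SdD ![- t + rho]addrC; congr (_ * _ + _).
have co : continuous (fun r => expR (- (beta * r)) * rin (orb y (rho - r)) (orb z (rho - r))).
  exact: cexp (continuous_mirror (a := rho) (cq Dy Dz)).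
have t1 : 0 < t + 1 by rewrite ltr_wpDl.
have sub : `[0, t]%classic `<=` `[0, t + 1]%classic by apply: subset_itvl; rewrite bnd_simp lerDl.
apply: ae_Rintegral => //.
- apply: measurable_funM.
    apply: measurable_funTS; apply: continuous_measurable_fun.
    move=> r; apply: (cvg_comp _ expR _ (@continuous_expR _ _)).
    by apply: cvgN; apply: cvgM; [exact: cvg_cst|exact: cvg_id].
  by apply: sm_rin; apply: sm_subset (backward_measurable _ t1).
- by apply: measurable_funTS; exact: continuous_measurable_fun.
have [Dy' _] := Sd_Dd gS genA rho Dy; have [Dz' _] := Sd_Dd gS genA rho Dz.
apply: ae_mono (ae_and (backward_orb Dy') (backward_orb Dz')) => r [-> ->] _.
by rewrite !(orb_shift B gS genA) [- r + rho]addrC.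
Qed.

Section RiccatiAndObservability.
Variables P L : bop H H.
Hypothesis hP : forall y z, rin (P y) z = Pform w V T beta c C2 y z.
Hypothesis hL : forall y z, rin (L y) z = Lform w V beta c C2 T y z.

(** Both sides are the derivative at [0] of [<P S^*(rho) y, S^*(rho) z>]. *)
Lemma riccati_identity y z : Ddom y -> Ddom z ->
  rin (P (Ad A y)) z + rin (P y) (Ad A z) =
  T * C1 * expR (alpha * T) * rin (obsop B y) (obsop B z) + C2 * rin y z - rin (L y) z -
  beta * rin (P y) z.
Proof.
move=> Dy Dz; have gSd := Sd_group gS genA; have [Sd0 _ _] := gSd.
pose q r := rin (orb y r) (orb z r); pose m r := rin (Sd S r y) (Sd S r z).
have E rho : rin (P (Sd S rho y)) (Sd S rho z) =
    \int[mu]_(t in `[0, T]) window q m c C2 beta t rho.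
  rewrite hP; apply: eq_Rintegral => t; rewrite inE /= in_itv /= => /andP[t0 _].
  exact: Lform_window.
have cm : continuous m by apply: continuous_rin; exact: group_continuous gSd _.
have d1 := windowed_derive c C2 beta (cq Dy Dz) cm (ltW T0).
have orbit v : Ddom v -> sderiv (fun t => Sd S t v) 0 (Ad A v).
  move=> Dv; have gv : gen (Sd S) v (Ad A v) by apply/(Sd_gen gS genA).
  by have := gen_orbit (t := 0) gSd gv; rewrite Sd0.
have dP : sderiv (fun t => P (Sd S t y)) 0 (P (Ad A y)).
  exact: sderiv_bop (orbit y Dy).
have d2 := is_derive_rin dP (orbit z Dz).
have := @derive_val _ _ _ _ _ _ _ d2; rewrite (funext E) (@derive_val _ _ _ _ _ _ _ d1).
rewrite !Sd0 => <-; rewrite -E -(Lform_window 0 (ltW T0) Dy Dz) -hL !Sd0.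
by rewrite /q /m /orb !Sd0; ring.
Qed.

(** The hypothesis is applied to [S^*(-T) y], whose orbit reaches [y] at time
    [T]. *)
Lemma gramian_observability y : expR (eps * T) = C2 ->
  (forall f : dual H, dom (adjoint A) f ->
    ((nrm (adjoint_group S T f) ^+ 2)%:E <= C1%:E * l2sq `[0%R, T] (observation S B f) +
      (C2 * expR (- (alpha * T)) * nrm f ^+ 2)%:E)%E) ->
  Ddom y -> C2 * nrm y ^+ 2 <= rin (L y) y.
Proof.
move=> eC2 obs Dy; have [Sd0 SdD _] := Sd_group gS genA.
have co := orb_continuous gS genA hB Dy.
have [DT _] := Sd_Dd gS genA (- T) Dy.
have cor : continuous (fun r => orb y (- r)).
  by move=> t; apply: (cvg_comp _ (orb y) _ (co _)); apply: cvgN; exact: cvg_id.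
have [F [_ dF]] := primitive_ex (continuous_nrm2 cor).
have lE : l2sq `[0%R, T] (observation S B (rd (Sd S (- T) y))) = (F T - F 0)%:E.
  rewrite -(integral_derive (continuous_nrm2 cor) (ltW T0) dF).
  rewrite -[RHS]/(l2sq `[0%R, T] (fun r => orb y (- r))) (l2sq_reflect co (ltW T0)).
  have := l2sq_shift (- T) co (ltW T0); rewrite add0r subrr oppr0 => <-.
  by apply: eq_integral => t _; rewrite observation_orb nrm_rd (orb_shift B gS genA).
have := obs _ DT; rewrite rd_Sd -SdD subrr Sd0 !nrm_rd lE -EFinM -EFinD lee_fin => h.
have := Lform_window 0 (ltW T0) Dy Dy; rewrite !Sd0 -hL => ->.
rewrite /window sub0r rinxx.
have int_le : expR (- (beta * T)) * (F T - F 0) <= \int[mu]_(r in `[0, T])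
    (expR (- (beta * r)) * rin (orb y (0 - r)) (orb y (0 - r))).
  have <- : \int[mu]_(r in `[0, T]) (nrm (orb y (- r)) ^+ 2) = F T - F 0.
    exact: Rintegral_derive (continuous_nrm2 cor) (ltW T0) dF.
  rewrite -RintegralZl//; last by apply: continuous_integrable; exact: continuous_nrm2.
  apply: le_Rintegral => //.
  - by apply: continuous_integrable; apply: continuous_scale; exact: continuous_nrm2.
  - by apply: continuous_integrable; exact: cexp (continuous_mirror (a := 0) (cq Dy Dy)).
  - move=> r; rewrite /= in_itv /= => /andP[_ rT]; rewrite sub0r rinxx.
    by rewrite ler_wpM2r ?sqr_ge0// ler_expR lerN2 ler_wpM2l.
have c0 : 0 <= c by rewrite mulr_ge0// expR_ge0.
(* The two uses of the choice of [eps]. *)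
have e1 : expR (alpha * T) * expR (- (beta * T)) = C2.
  by rewrite -expRD -eC2; congr expR; ring.
have e2 : expR (- (beta * T)) = C2 * expR (- (alpha * T)).
  by rewrite -eC2 -expRD; congr expR; ring.
have := ler_wpM2l c0 int_le; have := ler_wpM2l (ltW C20) h.
have -> : c * (expR (- (beta * T)) * (F T - F 0)) = C2 * (C1 * (F T - F 0)).
  by rewrite -e1; ring.
by rewrite e2; lra.
Qed.

End RiccatiAndObservability.

End Gramian.

(** * The feedback law *)

Lemma cvg_at_right_nrm {R : realType} {s : scalar_kind} {V : normedModType (scalarField R s)}
    (f : R -> V) (l : V) : f x @[x --> 0^'+] --> l <->
  forall e : R, 0 < e -> exists2 d : R, 0 < d & forall x, 0 < x -> x < d -> nrm (l - f x) < e.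
Proof.
split=> [/cvg_nrm h e e0|h].
  have := h e e0; rewrite near_withinE => -[/= d d0 hd]; exists d => // x x0 xd.
  by rewrite nrmBC; apply: hd => //; rewrite /ball_ /= sub0r normrN gtr0_norm.
apply/cvg_nrm => e e0; have [d d0 hd] := h e e0; rewrite near_withinE.
exists d => // x; rewrite /ball_ /= sub0r normrN => xd x0.
by rewrite nrmBC; apply: hd => //; rewrite -(gtr0_norm x0).
Qed.

(** The group law turns the quotient at [- h] into that at [h], so that a
    one-sided derivative at [0] is two-sided. *)
Lemma gen_of_right {R : realType} {s : scalar_kind} {H : hilbertType R s}
    (G : R -> bop H H) y z : C0_group G ->
  h^-1 *:: (G h y - y) @[h --> 0^'+] --> z -> gen G y z.
Proof.
move=> gG yz; have [G0 GD Gc] := gG.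
have [M M0 hM] := strong_local_bound (group_continuous gG) 1.
have yzN : (- h)^-1 *:: (G (- h) y - y) @[h --> 0^'+] --> z.
  have Gz : G (- h) z @[h --> 0^'+] --> z.
    have N0 : - h @[h --> (0 : R)] --> (0 : R).
      by rewrite -[X in _ --> X]oppr0; apply: cvgN; exact: cvg_id.
    by apply: cvg_at_right_filter; exact: (cvg_comp -%R (fun r => G r z) N0 (Gc z)).
  have nb : \forall h \near (0 : R)^'+, opnorm (G (- h)) <= M.
    rewrite near_withinE; exists 1 => //= h; rewrite /ball_ /= sub0r normrN => h1 _.
    by apply: hM; rewrite normrN ltW.
  apply: (eq_fun_cvg _ (cvg_strong nb yz Gz)) => h.
  by rewrite bop_sZ bopBr (groupVK gG) invrN srealN scaleNr -scalerN opprB.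
have /cvg_at_right_nrm h1 := yz; have /cvg_at_right_nrm h2 := yzN.
apply/cvg_nrm => e e0; have [d1 d10 hd1] := h1 e e0; have [d2 d20 hd2] := h2 e e0.
rewrite near_withinE; exists (Num.min d1 d2); first by rewrite /= lt_min d10.
move=> h; rewrite /ball_ /= sub0r normrN lt_min => /andP[hd1' hd2'] h0; rewrite nrmBC.
have [hp|hn] := ltP 0 h; first by apply: hd1 => //; rewrite -(gtr0_norm hp).
have hn' : h < 0 by rewrite lt_neqAle h0.
by rewrite -(opprK h); apply: hd2; rewrite ?oppr_gt0// -ltr0_norm.
Qed.

(** Monotone convergence along bounded intervals. *)
Lemma l2sq_halfline {R : realType} {s : scalar_kind} {V : normedModType (scalarField R s)}
    (u : R -> V) (K : \bar R) : continuous u ->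
  (forall t : R, 0 <= t -> (l2sq `[0%R, t] u <= K)%E) -> (l2sq `[0%R, +oo[ u <= K)%E.
Proof.
move=> cu hK.
pose F (n : nat) := `[0%R, n%:R : R]%classic.
have UF : \bigcup_n F n = `[0%R, +oo[%classic.
  apply/seteqP; split=> [x [n _]|x].
    by rewrite /F /= !in_itv /= => /andP[-> _].
  rewrite /= in_itv /= andbT => x0; exists (Num.truncn x).+1 => //.
  by rewrite /F /= in_itv /= x0 ltW// truncnS_gt.
have mF n : measurable (F n) by exact: measurable_itv.
have f0 x : (0 <= (nrm (u x) ^+ 2)%:E)%E by rewrite lee_fin sqr_ge0.
have mf D : measurable_fun D (fun x => (nrm (u x) ^+ 2)%:E).
  by apply: sm_nrm2; exact: sm_continuous.
have nF : nondecreasing_seq F.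
  move=> m n mn; apply/subsetPset; apply: subset_itvl; rewrite bnd_simp.
  by rewrite ler_nat.
have cv : l2sq (F n) u @[n --> \oo] --> l2sq `[0%R, +oo[ u.
  rewrite /l2sq -UF.
  exact: (@ge0_nondecreasing_set_cvg_integral _ (measurableTypeR R) R F
    (fun x => (nrm (u x) ^+ 2)%:E) (@lebesgue_measure R) nF mF (fun n => mf (F n))
    (fun n x _ => f0 x)).
rewrite -(cvg_lim _ cv)//; apply: lime_le; first by apply: cvgP; exact: cv.
by apply: nearW => n; exact: hK.
Qed.

Theorem theorem1p4 (R : realType) (s : scalar_kind) (H U : hilbertType R s)
    (A : unbounded H H) (S : R -> bop H H)
    (B : U -> dual H -> (scalarField R s)^o) (alpha C1 C2 : R)
    (S_group : C0_group S)
    (A_generates : generates 0^' S A)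
    (B_bounded : bounded_to_dual (adjoint A) B)
    (B_admissible : forall T : R, 0 < T -> exists C : R, 0 < C /\
      forall f : dual H, dom (adjoint A) f ->
        (l2sq `[0%R, T] (observation S B f) <= (C * nrm f ^+ 2)%:E)%E)
    (alpha_gt0 : 0 < alpha) (C1_ge0 : 0 <= C1) (C2_ge1 : 1 <= C2)
    (weak_observability : forall (t : R) (f : dual H),
      0 < t -> dom (adjoint A) f ->
        ((nrm (adjoint_group S t f) ^+ 2)%:E <=
           C1%:E * l2sq `[0%R, t] (observation S B f) +
           (C2 * expR (- (alpha * t)) * nrm f ^+ 2)%:E)%E)
    (T : R) (T_gt0 : 0 < T) (T_large : alpha^-1 * ln C2 < T) :
  stabilizing_feedback A B (feedback A S B alpha C1 C2 T)
    (2^-1 * (alpha - T^-1 * ln C2)).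

Proof.
have C20 : 0 < C2 by apply: lt_le_trans C2_ge1.
pose eps := T^-1 * ln C2; pose k := T * C1 * expR (alpha * T).
have beta0 : 0 < alpha - eps.
  by rewrite subr_gt0 /eps ltr_pdivrMl// mulrC -ltr_pdivrMl.
have eC2 : expR (eps * T) = C2 by rewrite /eps mulrAC mulVf ?gt_eqF// mul1r lnK.
have k0 : 0 <= k by rewrite !mulr_ge0 ?expR_ge0// ltW.
have [P [L [PiE PC [kappa kappa0 Pk] hP hL]]] :=
  gramian_ex S_group A_generates B_bounded B_admissible T_gt0 C1_ge0 C20 (ltW beta0).
have [Q [PQ QP]] := coercive_inv kappa0 PC Pk.
have ric y z Dy Dz : rin (P (Ad A y)) z + rin (P y) (Ad A z) =
    k * rin (obsop B y) (obsop B z) + C2 * rin y z - rin (L y) z - (alpha - eps) * rin (P y) z :=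
  riccati_identity S_group A_generates B_bounded B_admissible T_gt0 hP hL Dy Dz.
have obs y Dy : C2 * nrm y ^+ 2 <= rin (L y) y :=
  gramian_observability S_group A_generates B_bounded B_admissible T_gt0 C1_ge0 C20 (ltW beta0)
    hL eC2 (fun f => weak_observability T f T_gt0) Dy.
have [G [M [gG genG form decay obsG]]] :=
  closed_loop S_group A_generates B_bounded QP PC kappa0 Pk k0 (ltW beta0) ric obs.
pose K := feedback A S B alpha C1 C2 T.
have PiP f : Pi A S B alpha C1 C2 eps T f = P (riesz f) by rewrite -{1}(rieszK f) PiE.
have domK x : dom K x <-> Dd A (Q x).
  split=> [[f Df <-]|Dx].
    by rewrite -/eps PiP PQ; change (dom (adjoint A) (rd (riesz f))); rewrite rieszK.
  by exists (rd (Q x)) => //; rewrite -/eps PiP rdK QP.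
have KE x : K x = - (k *:: obsop B (Q x)).
  rewrite /K /feedback /= -/k; congr (- (_ *: riesz (Bstar B _))).
  rewrite /Pi_inv; case: xgetP => [f _ /= hf|/(_ (rd (Q x)))/=]; last by rewrite PiP rdK QP.
  by rewrite -hf -/eps PiP PQ rieszK.
(* The group [G] lives in the coordinate [y = P^-1 x]. *)
pose Sc t := bop_comp P (bop_comp (G t) Q).
pose Ac := Unbounded (dom K) (fun x => P (M (Q x) - Ad A (Q x))).
have [G0 GD Gc] := gG.
have ScE t x : Sc t x = P (G t (Q x)) by [].
have quotE x (h : R) : h^-1 *:: (Sc h x - x) = P (h^-1 *:: (G h (Q x) - Q x)).
  by rewrite ScE bop_sZ bopBr QP.
have gen_dom x : Dd A (Q x) -> h^-1 *:: (Sc h x - x) @[h --> 0^'+] --> Ac x.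
  move=> Dx; have gx : gen G (Q x) (M (Q x) - Ad A (Q x)) by apply/genG.
  apply: (eq_fun_cvg (fun h => esym (quotE x h))); apply: bop_cvg.
  by move: gx; apply: cvg_trans; apply: cvg_app; apply: within_subset => r r0; rewrite gt_eqF.
have opP y : rin (P y) y <= opnorm P * nrm y ^+ 2.
  apply: le_trans (rin_le _ _) _; rewrite expr2 mulrA ler_wpM2r ?nrm_ge0//.
  exact: le_opnorm.
split; first by rewrite mulr_gt0// invr_gt0.
exists Sc, Ac; split.
- split=> [x|t r x _ _|x]; rewrite ?ScE.
  + by rewrite G0 QP.
  + by rewrite GD PQ.
  + rewrite -[X in _ --> X](QP x); apply: bop_cvg; apply: cvg_at_right_filter.
    exact: Gc.
- split=> [x|x /domK]; last exact: gen_dom.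
  split=> [/domK/gen_dom cx|/cvg_ex[l lx]]; first exact: cvgP cx.
  apply/domK; have [] // := (genG (Q x) (Q l)).1 _.
  apply: gen_of_right => //.
  apply: (eq_fun_cvg _ (bop_cvg (L := Q) lx)) => h.
  by rewrite quotE PQ.
- split=> //; split=> [a x y /domK Dx /domK Dy|].
    have DQ : Q (a *: x + y) = a *: Q x + Q y by rewrite bopDr bopZr.
    rewrite !KE DQ (obsop_comb S_group A_generates B_bounded)// scalerDr opprD scalerN.
    congr (- _ - _).
    by rewrite !scalerA mulrC.
  have [c c0 hc] := obsop_bound B_bounded.
  pose N := opnorm Q + opnorm M * opnorm Q.
  exists (k * (c * (2 * (N + opnorm Q)))) => x /domK Dx.
  rewrite KE nrmN nrm_sZ (ger0_norm k0) -[k * _ * _]mulrA ler_wpM2l// -[c * _ * _]mulrA.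
  apply: le_trans (hc _ Dx) _; rewrite ler_wpM2l//.
  (* The graph norms of [Ac] at [x] and of [Ad] at [Q x] are equivalent. *)
  have AdE : Ad A (Q x) = M (Q x) - Q (Ac x) by rewrite /Ac /= PQ subKr.
  have hQ v : nrm (Q v) <= opnorm Q * nrm v by exact: le_opnorm.
  have hM : nrm (M (Q x)) <= opnorm M * opnorm Q * nrm x.
    by apply: le_trans (le_opnorm _ _) _; rewrite -mulrA ler_wpM2l ?opnorm_ge0.
  have h1 : nrm (Q x) + nrm (Ad A (Q x)) <= N * nrm x + opnorm Q * nrm (Ac x).
    have := ler_nrmB (M (Q x)) (Q (Ac x)); have := hQ x; have := hQ (Ac x).
    by rewrite AdE /N; lra.
  apply: (le_trans h1).
  have g1 : nrm x <= graph_norm Ac x.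
    rewrite /graph_norm -{1}(ger0_norm (nrm_ge0 x)) -sqrtr_sqr ler_wsqrtr//.
    by rewrite lerDl sqr_ge0.
  have g2 : nrm (Ac x) <= graph_norm Ac x.
    rewrite /graph_norm -{1}(ger0_norm (nrm_ge0 (Ac x))) -sqrtr_sqr ler_wsqrtr//.
    by rewrite lerDr sqr_ge0.
  have gr0 : 0 <= graph_norm Ac x by exact: sqrtr_ge0.
  have N0 : 0 <= N by rewrite addr_ge0 ?mulr_ge0 ?opnorm_ge0.
  have := ler_wpM2l N0 g1; have := ler_wpM2l (opnorm_ge0 Q) g2.
  have := mulr_ge0 N0 gr0; have := mulr_ge0 (opnorm_ge0 Q) gr0.
  by lra.
split.
- (* The condition number of the Lyapunov function. *)
  pose D := Num.sqrt (opnorm P / kappa).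
  have D0 : 0 <= D by exact: sqrtr_ge0.
  have hG (t : R) y : 0 <= t ->
      nrm (G t y) <= D * expR (- (2^-1 * (alpha - eps) * t)) * nrm y.
    move=> t0; set e := expR _; have e0 : 0 <= e by exact: expR_ge0.
    rewrite -(@ler_pXn2r _ 2) ?nnegrE ?nrm_ge0 ?mulr_ge0 ?nrm_ge0//.
    have -> : (D * e * nrm y) ^+ 2 = expR (- ((alpha - eps) * t)) * (opnorm P * nrm y ^+ 2) / kappa.
      rewrite !exprMn sqr_sqrtr; last by rewrite divr_ge0 ?opnorm_ge0// ltW.
      have -> : e ^+ 2 = expR (- ((alpha - eps) * t)).
        by rewrite expr2 /e -expRD; congr expR; field.
      by ring.
    rewrite ler_pdivlMr// mulrC; apply: le_trans (Pk _) _.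
    by apply: le_trans (decay _ _ t0) _; rewrite ler_wpM2l ?expR_ge0.
  pose C := opnorm P * D * opnorm Q.
  have C0 : 0 <= C by rewrite !mulr_ge0 ?opnorm_ge0.
  exists (1 + C); split=> [|t t0]; first by rewrite lerDl.
  rewrite nrm_bopE; apply: opnorm_le => [|x].
    by rewrite mulr_ge0 ?expR_ge0// addr_ge0.
  rewrite ScE; apply: le_trans (le_opnorm _ _) _.
  set e := expR _; have e0 : 0 <= e by exact: expR_ge0.
  have h1 := hG t (Q x) t0; rewrite -/e in h1.
  have h2 := ler_wpM2l (mulr_ge0 D0 e0) (le_opnorm Q x).
  have h3 := ler_wpM2l (opnorm_ge0 P) (le_trans h1 h2).
  apply: (le_trans h3).
  have -> : opnorm P * (D * e * (opnorm Q * nrm x)) = C * e * nrm x by rewrite /C; ring.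
  by rewrite ler_wpM2r ?nrm_ge0// ler_wpM2r// lerDr.
- (* Both sides are additive in [f] but conjugate linear in [z]; testing [form] on
     the multiples of [z] recovers the scalar identity. *)
  move=> x /domK Dx f Df; have Dz : Dd A (riesz f).
    by change (dom (adjoint A) (rd (riesz f))); rewrite rieszK.
  rewrite -(rieszK f); move: (riesz f) Dz => z Dz; rewrite rdE.
  have -> : Atilde A x (rd z) = inner x (Ad A z) by rewrite /Atilde rieszE.
  rewrite -(obsopE B_bounded)//; apply: sRe_inj => a.
  have E (V : hilbertType R s) (u v : V) : sRe (a * inner u v) = rin u (sconj a *: v).
    by rewrite -rin_sconj /rin innerZl.
  have Daz := DdZ S_group A_generates (sconj a) Dz.
  have [_ AdZ] := Dd_comb S_group A_generates (sconj a) Dz (Dd0 S_group A_generates).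
  rewrite [feedback _ _ _ _ _ _ _ _]KE mulrDr raddfD /= !E rinNl rinZl.
  have := form (Q x) (sconj a *: z) Dx Daz.
  have Ad0 : Ad A 0 = 0.
    have [_] := Dd_comb S_group A_generates (-1) (Dd0 S_group A_generates) (Dd0 S_group A_generates).
    by rewrite scaler0 addr0 scaleN1r addNr.
  rewrite addr0 Ad0 addr0 in AdZ; rewrite AdZ QP => ->.
  by rewrite (obsopZ S_group A_generates B_bounded).
- pose C := Num.sqrt (k * (opnorm P * opnorm Q ^+ 2)).
  exists C; split=> [|x /domK Dx]; first exact: sqrtr_ge0.
  have [DG [cG bG]] := obsG _ Dx.
  have KSc (t : R) : K (Sc t x) = - (k *:: obsop B (G t (Q x))) by rewrite KE ScE PQ.
  have cK : continuous (fun t => K (Sc t x)).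
    rewrite (funext KSc) => t; apply: cvgN; apply: cvgZr; exact: cG.
  split; first exact: sm_continuous.
  apply: l2sq_halfline => // t t0.
  have -> : l2sq `[0%R, t] (fun r => K (Sc r x)) =
      (\int[@lebesgue_measure R]_(r in `[0%R, t]) (k ^+ 2 * nrm (obsop B (G r (Q x))) ^+ 2)%:E)%E.
    by apply: eq_integral => r _; rewrite KSc nrmN nrm_sZ (ger0_norm k0) exprMn.
  apply: le_trans (bG t t0) _; rewrite lee_fin exprMn sqr_sqrtr; last first.
    by apply: (mulr_ge0 k0); rewrite mulr_ge0 ?opnorm_ge0 ?sqr_ge0.
  rewrite -[k * _ * _]mulrA ler_wpM2l//; apply: le_trans (opP _) _.
  rewrite -mulrA ler_wpM2l ?opnorm_ge0// -exprMn lerXn2r ?nnegrE ?nrm_ge0 ?le_opnorm//.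
  by rewrite mulr_ge0 ?opnorm_ge0 ?nrm_ge0.
Qed.
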